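(* Let $I=[-1,1]$, $d,d_a,d_u\ge1$, $s\ge 0$, and let $\mathcal G: H^s(I^d;\mathbb R^{d_a})\to L^2(I^d;\mathbb R^{d_u})$ be a continuous operator. Let $K\subset H^s(I^d;\mathbb R^{d_a})$ be a compact subset. Then for every $\epsilon>0$ there exists an orthogonal polynomial neural operator (OPNO) $\mathcal L: H^s(I^d;\mathbb R^{d_a})\to L^2(I^d;\mathbb R^{d_u})$ such that $$\|\mathcal L(a)-\mathcal G(a)\|_{L^2}<\epsilon\qquad\text{for all } a\in K .$$
   Context: Chebyshev polynomials on $I$: $T_0=1$, $T_1(x)=x$, $T_{n+1}(x)=2xT_n(x)-T_{n-1}(x)$; on $I^d$, for a multi-index $k\in\mathbb N^d$ ($\mathbb N=\{0,1,2,\dots\}$), $T_k(x)=\prod_iT_{k_i}(x_i)$. Compact combination basis: fix real constants $a_\pm,b_\pm$ (Dirichlet: $a_\pm=1,b_\pm=0$; Neumann: $a_\pm=0,b_\pm=1$; in general Robin) such that for every integer $k\ge0$ there is a unique pair $(a_k,b_k)$ of reals for which $\phi_k=T_k+a_kT_{k+1}+b_kT_{k+2}$ satisfies $a_-\phi_k(-1)+b_-\phi_k'(-1)=0$ and $a_+\phi_k(1)+b_+\phi_k'(1)=0$. For example $\phi_k=T_k-T_{k+2}$ (Dirichlet) and $\phi_k=T_k-\frac{k^2}{(k+2)^2}T_{k+2}$ (Neumann). On $I^d$, $\phi_k(x)=\prod_i\phi_{k_i}(x_i)$ for $k\in\mathbb N^d$. Chebyshev transform $\mathcal C_h$: $\mathcal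 C_h(u)=(\hat u_k)_{k\in\mathbb N^d}$, the Chebyshev coefficients $$\hat u_k=\Big(\prod_{i=1}^d\frac{2}{\pi c_{k_i}}\Big)\int_{I^d}u(x)T_k(x)\prod_{i=1}^d(1-x_i^2)^{-1/2}\,dx,\qquad c_0=2,\ c_n=1\ (n\ge1),$$ defined for functions $u$ integrable against the Chebyshev weight. Compacting transform $\mathcal C_p$: for $d=1$ it maps Chebyshev coefficients $(\alpha_k)$ to coefficients $(\beta_k)$ with respect to $\{\phi_k\}$ by the recursion $\beta_k=\alpha_k-a_{k-1}\beta_{k-1}-b_{k-2}\beta_{k-2}$ (terms with negative index are $0$); for $d>1$ it is applied in each coordinate direction. Shen transform: $\mathcal S=\mathcal C_p\circ\mathcal C_h$; for a finitely supported $(\beta_k)$, $\mathcal S^{-1}(\beta)=\sum_k\beta_k\phi_k$. All transforms act componentwise on vector-valued functions. OPNO: a map of the form $$\mathcal L=\mathcal Q\circ\mathcal L^{(L)}\circ\cdots\circ\mathcal L^{(1)}\circ\mathcal P$$ for some number of layers $L$ and channel width $d_v$ (both arbitrary finite), where: (i) the layers are $$\mathcal L^{(l)}(v)=v+\sigma\big(W_lv+b_l+\mathcal S^{-1}(A_l\cdot\mathcal C_h(v))\big),\qquad v:I^d\to\mathbb R^{d_v},$$ with $\sigma$ a non-polynomial activation function applied pointwise (part of the data of the OPNO), $W_l\in\mathbb R^{d_v\times d_v}$, $b_l:I^d\to\mathbb R^{d_v}$ a continuous bias function, and $A_l$ a linear map on frequency space, $(A_l\hat v)_i=\sum_jA_{l,ij}\hat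 v_j$ with blocks $A_{l,ij}\in\mathbb R^{d_v\times d_v}$, truncated to finitely many modes and banded (number of modes and bandwidth arbitrary finite); (ii) the lifting layer $\mathcal P$ is a simple neural network acting pointwise on the values of the input function $a$ (possibly together with the coordinate $x$), possibly concatenated in the channel dimension with a kernel layer $\mathcal S^{-1}(A\cdot\mathcal C_h(\cdot))$; (iii) the final layer $\mathcal Q$ is a neural network $Q$ acting pointwise from $\mathbb R^{d_v}$ to $\mathbb R^{d_u}$, possibly followed by the projection $w\mapsto\mathcal S^{-1}[\mathbf 1_{k\le N}\mathcal S(w)]$, where $\mathbf 1_{k\le N}$ is truncation of coefficients to finitely many modes. All network parameters are fixed numbers (or functions, for the biases) independent of the input, and the composition is required to be well defined as a map $H^s(I^d;\mathbb R^{d_a})\to L^2(I^d;\mathbb R^{d_u})$. Conventional feedforward networks (with all $A_l=0$) count as degenerate OPNOs. *)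

(* Defs.v *)
From HB Require Import structures.
From mathcomp Require Import all_boot all_order all_algebra.
From mathcomp Require Import all_classical all_reals all_analysis.
From mathcomp Require Import ring.

Set Implicit Arguments.
Unset Strict Implicit.
Unset Printing Implicit Defensive.

Import Order.TTheory GRing.Theory Num.Theory.
Import numFieldNormedType.Exports.

Local Open Scope classical_set_scope.
Local Open Scope ring_scope.

(* R^d carries the product sigma-algebra, which is also its Borel sigma-algebra. *)
Fact rV_display : measure_display.
Proof. exact: default_measure_display. Qed.

Section rV_measurable.
Context {R : realType} (d : nat).

Definition rV_coord (i : 'I_d) (x : 'rV[R]_d) : R := x ord0 i.

Let rV_set0 : g_sigma_preimage rV_coord set0.
Proof. exact: sigma_algebra0. Qed.

Let rV_setC A : g_sigma_preimage rV_coord A -> g_sigma_preimage rV_coord (~` A).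
Proof. exact: sigma_algebraC. Qed.

Let rV_bigcup (F : (set 'rV[R]_d)^nat) :
  (forall i, g_sigma_preimage rV_coord (F i)) ->
  g_sigma_preimage rV_coord (\bigcup_i (F i)).
Proof. exact: sigma_algebra_bigcup. Qed.

HB.instance Definition _ := @isMeasurable.Build rV_display
  'rV[R]_d (g_sigma_preimage rV_coord) rV_set0 rV_setC rV_bigcup.

End rV_measurable.

Lemma measurable_rV_coord (R : realType) d (i : 'I_d) :
  measurable_fun setT (@rV_coord R d i).
Proof.
move=> _ Y mY; rewrite setTI; apply: sub_sigma_algebra => /=.
rewrite -bigcup_seq/=; exists i => /=; first by rewrite mem_index_enum.
by exists Y => //; rewrite setTI.
Qed.

Lemma measurable_fun_rVP (R : realType) dd (T : measurableType dd) d
    (f : T -> 'rV[R]_d) :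
  (forall i, measurable_fun setT (@rV_coord R d i \o f)) ->
  measurable_fun setT f.
Proof.
move=> mf _ A mA; rewrite setTI.
suff : g_sigma_preimage (@rV_coord R d) `<=` [set B | measurable (f @^-1` B)].
  exact.
apply: smallest_sub.
  split => /=; first by rewrite preimage_set0.
  - by move=> B mB; rewrite setTD preimage_setC; exact: measurableC.
  - by move=> F mF; rewrite preimage_bigcup; exact: bigcup_measurable.
rewrite -bigcup_seq => B /= [i _ [C mC <-]]; rewrite setTI.
by have := mf i measurableT C mC; rewrite setTI.
Qed.

Section cube_measure.
Context {R : realType}.

Let I_lty : (@lebesgue_measure R `[(-1)%R, 1%R]%classic < +oo)%E.
Proof. by rewrite lebesgue_measure_itv/=; case: ifP => _; rewrite ltry. Qed.

Definition leb_I : {finite_measure set (measurableTypeR R) -> \bar R} :=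
  @mfrestr _ (measurableTypeR R) R `[(-1)%R, 1%R] lebesgue_measure
    (measurable_itv `[(-1)%R, 1%R]) I_lty.

Definition rV_cons n (p : measurableTypeR R * 'rV[R]_n) : 'rV[R]_n.+1 :=
  \row_i if unlift ord0 i is Some j then p.2 ord0 j else p.1.

Lemma measurable_rV_cons n : measurable_fun setT (@rV_cons n).
Proof.
apply: measurable_fun_rVP => i; rewrite /comp /rV_coord /rV_cons.
case: (unliftP ord0 i) => [j ij|i0].
- rewrite (_ : (fun _ => _) = @rV_coord R n j \o snd).
    by apply: measurableT_comp => //; exact: measurable_rV_coord.
  by apply/funext => p; rewrite mxE ij liftK.
- rewrite (_ : (fun _ => _) = fst); first exact: measurable_fst.
  by apply/funext => p; rewrite mxE i0 unlift_none.
Qed.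

Section step.
Variables (n : nat) (mu : {finite_measure set 'rV[R]_n -> \bar R}).

Definition leb_step : set 'rV[R]_n.+1 -> \bar R :=
  pushforward (leb_I \x mu)%E (@rV_cons n).

Let leb_step0 : leb_step set0 = 0%E.
Proof. by rewrite /leb_step /pushforward preimage_set0 measure0. Qed.

Let leb_step_ge0 A : (0 <= leb_step A)%E.
Proof. by rewrite /leb_step /pushforward measure_ge0. Qed.

Let leb_step_sigma_additive : semi_sigma_additive leb_step.
Proof.
exact: (@measure_semi_sigma_additive _ _ _
  (measure_function_pushforward__canonical__measure_function_Measure
     (leb_I \x mu)%E (@measurable_rV_cons n))).
Qed.

HB.instance Definition _ := isMeasure.Build _ _ _
  leb_step leb_step0 leb_step_ge0 leb_step_sigma_additive.

Let leb_step_fin : fin_num_fun leb_step.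
Proof.
move=> A mA; rewrite ge0_fin_numE ?measure_ge0//.
apply: (@le_lt_trans _ _ (leb_step setT)); first by rewrite le_measure ?inE.
rewrite /leb_step /pushforward preimage_setT -setXTT product_measure1E//.
by rewrite lte_mul_pinfty ?measure_ge0 ?fin_num_measure//
  -ge0_fin_numE ?fin_num_measure ?measure_ge0.
Qed.

HB.instance Definition _ := Measure_isFinite.Build _ _ _ leb_step leb_step_fin.

End step.

(* [leb_cube d] is the d-fold product of the Lebesgue measure on [-1, 1]. It is
   a measure on R^d that vanishes off the cube, so that functions on R^d taken
   modulo [leb_cube d] are functions on the cube taken modulo null sets. *)
Fixpoint leb_cube (d : nat) : {finite_measure set 'rV[R]_d -> \bar R} :=
  if d is n.+1 then leb_step (leb_cube n) else dirac (0 : 'rV[R]_0).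

Definition cube (d : nat) : set 'rV[R]_d := [set x | forall i, -1 <= x ord0 i <= 1].

End cube_measure.

Record pdist (R : realType) (T : Type) := PDist {
  pdist_fun :> T -> T -> R;
  pdistxx : forall x, pdist_fun x x = 0;
  pdistC : forall x y, pdist_fun x y = pdist_fun y x;
  pdist_triangle : forall y x z,
    pdist_fun x z <= pdist_fun x y + pdist_fun y z }.

Definition pdist_space (R : realType) (T : Type) (D : pdist R T) : Type := T.

Section pdist_space.
Context (R : realType) (T : Type) (D : pdist R T).
Notation S := (pdist_space D).

HB.instance Definition _ := gen_eqMixin S.
HB.instance Definition _ := gen_choiceMixin S.

Let pball (x : S) e : set S := [set y | D x y < e].
Let pent : set_system (S * S) := entourage_ pball.
Let pnbhs (x : S) : set_system S := nbhs_ pent x.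
Let pnbhsE : pnbhs = nbhs_ pent. Proof. by []. Qed.

HB.instance Definition _ := hasNbhs.Build S pnbhs.

Let pball_center x (e : R) : 0 < e -> pball x e x.
Proof. by move=> e0; rewrite /pball/= pdistxx. Qed.

Let pball_sym x y (e : R) : pball x e y -> pball y e x.
Proof. by rewrite /pball/= pdistC. Qed.

Let pball_triangle x y z e1 e2 :
  pball x e1 y -> pball y e2 z -> pball x (e1 + e2) z.
Proof.
by rewrite /pball/= => ? ?; rewrite (le_lt_trans (pdist_triangle D y _ _))// ltrD.
Qed.

Let pentE : pent = entourage_ pball. Proof. by []. Qed.

HB.instance Definition _ := @Nbhs_isPseudoMetric.Build R S
  pent pnbhsE pball pball_center pball_sym pball_triangle pentE.

Lemma pdist_ballE (x : S) (e : R) : ball x e = [set y | D x y < e].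
Proof. by []. Qed.

End pdist_space.

Section l2_sum.
Context {R : realType} (I : finType) (P : pred I).

Lemma l2_cauchy (a b : I -> R) :
  (\sum_(i | P i) a i * b i) ^+ 2 <=
  (\sum_(i | P i) a i ^+ 2) * (\sum_(i | P i) b i ^+ 2).
Proof.
rewrite -subr_ge0 -(pmulr_rge0 _ (ltr0n R 2)).
set A := \sum_(i | P i) a i ^+ 2; set B := \sum_(i | P i) b i ^+ 2.
set C := \sum_(i | P i) a i * b i.
suff -> : 2 * (A * B - C ^+ 2) =
    \sum_(i | P i) \sum_(j | P j) (a i * b j - a j * b i) ^+ 2.
  by apply: sumr_ge0 => i _; apply: sumr_ge0 => j _; exact: sqr_ge0.
have E i j : (a i * b j - a j * b i) ^+ 2 = a i ^+ 2 * b j ^+ 2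
    + b i ^+ 2 * a j ^+ 2 - 2 * ((a i * b i) * (a j * b j)) by ring.
rewrite (eq_bigr (fun i => a i ^+ 2 * B + b i ^+ 2 * A - 2 * (a i * b i * C))).
  rewrite sumrB big_split/= -!mulr_suml -mulr_sumr -mulr_suml -/A -/B -/C; ring.
move=> i _; rewrite (eq_bigr _ (fun j _ => E i j)).
by rewrite sumrB big_split/= -!mulr_sumr.
Qed.

Lemma l2_triangle (a b c : I -> R) : (forall i, P i -> 0 <= c i <= a i + b i) ->
  Num.sqrt (\sum_(i | P i) c i ^+ 2) <=
  Num.sqrt (\sum_(i | P i) a i ^+ 2) + Num.sqrt (\sum_(i | P i) b i ^+ 2).
Proof.
move=> cab.
have sq0 (f : I -> R) : 0 <= \sum_(i | P i) f i ^+ 2.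
  by apply: sumr_ge0 => i _; exact: sqr_ge0.
rewrite -[leRHS]ger0_norm ?addr_ge0 ?sqrtr_ge0// -sqrtr_sqr ler_wsqrtr//.
rewrite sqrrD !sqr_sqrtr//.
apply: (@le_trans _ _ (\sum_(i | P i) (a i + b i) ^+ 2)).
  apply: ler_sum => i /cab/andP[c0 cle].
  by rewrite ler_sqr// nnegrE// (le_trans c0).
under eq_bigr do rewrite sqrrD.
rewrite !big_split/= lerD2r lerD2l -mulr2n ler_wMn2r//.
by rewrite -sqrtrM// (le_trans (ler_norm _))// -sqrtr_sqr ler_wsqrtr// l2_cauchy.
Qed.

End l2_sum.

Section norm2.
Context dd (T : measurableType dd) (R : realType).
Variable mu : {measure set T -> \bar R}.

Definition norm2 (f : T -> R) : R := fine ('N[mu]_2%:E[EFin \o f])%E.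

Lemma norm2_ge0 f : 0 <= norm2 f.
Proof. by rewrite fine_ge0// Lnorm_ge0. Qed.

Lemma norm2_0 : norm2 (cst 0) = 0.
Proof. by rewrite /norm2 (_ : EFin \o _ = cst 0%E)// Lnorm0. Qed.

Lemma norm2N f : norm2 (\- f) = norm2 f.
Proof.
rewrite /norm2 (_ : EFin \o _ = \- (EFin \o f))%E ?oppe_Lnorm//.
Qed.

Lemma norm2_fin f : f \in Lfun mu 2%:E -> ('N[mu]_2%:E[EFin \o f] \is a fin_num)%E.
Proof.
case/andP => _; rewrite inE => ff.
by rewrite ge0_fin_numE ?Lnorm_ge0.
Qed.

Lemma norm2D f g : f \in Lfun mu 2%:E -> g \in Lfun mu 2%:E ->
  norm2 (f \+ g) <= norm2 f + norm2 g.
Proof.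
move=> f2 g2; have [mf mg] : measurable_fun setT f /\ measurable_fun setT g.
  by move: f2 g2 => /andP[/[!inE] ? _] /andP[/[!inE] ? _].
have p2 : (1 <= 2%:E :> \bar R)%E by rewrite lee_fin ler1n.
rewrite -lee_fin EFinD /norm2 !fineK ?norm2_fin//; first exact: eminkowski.
by have [_] := @Lfun_addr_closed _ _ _ mu _ p2; exact.
Qed.

End norm2.

Section L2.
Context {R : realType}.

Fact ge1_2 : (1 <= 2%:E :> \bar R)%E.
Proof. by rewrite lee_fin ler1n. Qed.

Definition L2fun (d : nat) := LfunType (@leb_cube R d) ge1_2.

Definition L2norm (d n : nat) (f : 'rV[R]_d -> 'cV[R]_n) : R :=
  Num.sqrt (\sum_(j < n) norm2 (leb_cube d) (fun x => f x j ord0) ^+ 2).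

Definition vfun (d n : nat) (u : 'I_n -> 'rV[R]_d -> R) (x : 'rV[R]_d) : 'cV[R]_n :=
  \col_j u j x.

Lemma L2norm_vfun d n (u v : 'I_n -> L2fun d) :
  L2norm (vfun u \- vfun v) =
  Num.sqrt (\sum_(j < n) norm2 (leb_cube d) (u j \- v j) ^+ 2).
Proof.
rewrite /L2norm; congr Num.sqrt; apply: eq_bigr => j _; congr (norm2 _ _ ^+ 2).
by apply/funext => x; rewrite /= !mxE.
Qed.

Lemma norm2xx dd (T : measurableType dd) (mu : {measure set T -> \bar R})
  (f : T -> R) : norm2 mu (f \- f) = 0.
Proof.
by rewrite (_ : f \- f = cst 0) ?norm2_0//; apply/funext => x; rewrite /= subrr.
Qed.

Lemma norm2BC dd (T : measurableType dd) (mu : {measure set T -> \bar R})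
  (f g : T -> R) : norm2 mu (f \- g) = norm2 mu (g \- f).
Proof.
by rewrite -norm2N; congr norm2; apply/funext => x; rewrite /= opprB.
Qed.

Lemma norm2_triangle dd (T : measurableType dd) (mu : {measure set T -> \bar R})
    (g f h : T -> R) :
  f \in Lfun mu 2%:E -> g \in Lfun mu 2%:E -> h \in Lfun mu 2%:E ->
  norm2 mu (f \- h) <= norm2 mu (f \- g) + norm2 mu (g \- h).
Proof.
move=> f2 g2 h2.
have B (u v : T -> R) : u \in Lfun mu 2%:E -> v \in Lfun mu 2%:E ->
    u \- v \in Lfun mu 2%:E.
  move=> u2 v2; have [_] := @Lfun_addr_closed _ _ _ mu _ ge1_2.
  by move=> /(_ u (- v) u2 (@Lfun_oppr_closed _ _ _ mu _ v v2)).
rewrite (_ : f \- h = (f \- g) \+ (g \- h)).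
  by apply: norm2D; exact: B.
by apply/funext => x /=; rewrite addrA subrK.
Qed.

Section dist.
Variables (d n : nat).
Implicit Types u v w : 'I_n -> L2fun d.

Definition L2dist u v : R := L2norm (vfun u \- vfun v).

Let L2distxx u : L2dist u u = 0.
Proof.
by rewrite /L2dist L2norm_vfun big1 ?sqrtr0// => j _; rewrite norm2xx expr0n.
Qed.

Let L2distC u v : L2dist u v = L2dist v u.
Proof.
by rewrite /L2dist !L2norm_vfun; congr Num.sqrt; apply: eq_bigr => j _;
  rewrite norm2BC.
Qed.

Let L2dist_triangle v u w : L2dist u w <= L2dist u v + L2dist v w.
Proof.
rewrite /L2dist !L2norm_vfun; apply: l2_triangle => j _.
by rewrite norm2_ge0/= norm2_triangle//; exact: LfunP.
Qed.

Definition L2pdist := PDist L2distxx L2distC L2dist_triangle.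

(* Elements are functions rather than classes of functions; functions that agree
   almost everywhere are at distance 0. *)
Definition L2 := pdist_space L2pdist.

Definition L2_fun (u : L2) : 'rV[R]_d -> 'cV[R]_n := vfun (u : 'I_n -> L2fun d).

End dist.

End L2.

Section sobolev.
Context {R : realType} (d : nat).
Notation X := 'rV[R]_d.
Notation mu := (@leb_cube R d).

Definition mdeg (alpha : 'I_d -> nat) : nat := (\sum_i alpha i)%N.

Definition mi n (k : {ffun 'I_d -> 'I_n}) : 'I_d -> nat := fun i => k i.

Definition partial (i : 'I_d) (f : X -> R) : X -> R :=
  fun x => 'D_(delta_mx ord0 i) f x.

Definition multi_partial (alpha : 'I_d -> nat) (f : X -> R) : X -> R :=
  foldr (fun i => iter (alpha i) (partial i)) f (enum 'I_d).

Definition smooth (f : X -> R) := forall s : seq 'I_d,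
  continuous (foldr partial f s) /\
  forall i x, derivable (foldr partial f s) x (delta_mx ord0 i).

Definition test_function (phi : X -> R) := smooth phi /\
  closure [set x | phi x != 0] `<=` [set x | forall i, -1 < x ord0 i < 1].

Definition weak_derivative (alpha : 'I_d -> nat) (u g : X -> R) :=
  forall phi, test_function phi ->
    \int[mu]_x (u x * multi_partial alpha phi x) =
    (-1) ^+ mdeg alpha * \int[mu]_x (g x * phi x).

(* D^alpha u; for alpha <> 0 the choice made by [xget] is irrelevant since weak
   derivatives are unique up to null sets. *)
Definition weak_partial (alpha : 'I_d -> nat) (u : L2fun d) : L2fun d :=
  if mdeg alpha == 0%N then u
  else xget 0 [set g : L2fun d | weak_derivative alpha u g].

Definition euclid (x : X) : R := Num.sqrt (\sum_i x ord0 i ^+ 2).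

(* The L^2 norm of this function on the product of two cubes is the
   Sobolev-Slobodeckij (Gagliardo) seminorm of order t, 0 < t < 1. *)
Definition gagliardo (t : R) (g : X -> R) (p : X * X) : R :=
  (g p.1 - g p.2) / euclid (p.1 - p.2) `^ (d%:R / 2 + t).

Definition sob_ord (s : R) : nat := Num.truncn s.
Definition sob_frac (s : R) : R := s - (sob_ord s)%:R.

Record sobolev (s : R) := Sobolev {
  sob_fun :> L2fun d;
  sob_weak : forall alpha : 'I_d -> nat, (mdeg alpha <= sob_ord s)%N ->
    exists g : L2fun d, weak_derivative alpha sob_fun g;
  sob_slob : 0 < sob_frac s ->
    forall alpha : 'I_d -> nat, mdeg alpha = sob_ord s ->
    gagliardo (sob_frac s) (weak_partial alpha sob_fun) \in Lfun (mu \x mu)%E 2%:E }.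

Variable s : R.
Local Notation m := (sob_ord s).
Local Notation t := (sob_frac s).

Definition sob_dist (u v : sobolev s) : R := Num.sqrt (
  \sum_(alpha : {ffun 'I_d -> 'I_m.+1} | (mdeg (mi alpha) <= m)%N)
     norm2 mu (weak_partial (mi alpha) u \- weak_partial (mi alpha) v) ^+ 2
  + \sum_(alpha : {ffun 'I_d -> 'I_m.+1} | (mdeg (mi alpha) == m) && (0 < t))
     norm2 (mu \x mu)%E (gagliardo t
       (weak_partial (mi alpha) u \- weak_partial (mi alpha) v)) ^+ 2).

Lemma gagliardoB (f g : X -> R) :
  gagliardo t (f \- g) = gagliardo t f \- gagliardo t g.
Proof. by apply/funext => p; rewrite /gagliardo /= -mulrBl; congr (_ / _); ring. Qed.

Lemma sob_distxx u : sob_dist u u = 0.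
Proof.
rewrite /sob_dist !big1 ?addr0 ?sqrtr0// => alpha _.
  by rewrite gagliardoB norm2xx expr0n.
by rewrite norm2xx expr0n.
Qed.

Lemma sob_distC u v : sob_dist u v = sob_dist v u.
Proof.
rewrite /sob_dist; congr (Num.sqrt (_ + _)); apply: eq_bigr => alpha _.
  by rewrite norm2BC.
by rewrite !gagliardoB norm2BC.
Qed.

Lemma sob_dist_triangle v u w : sob_dist u w <= sob_dist u v + sob_dist v w.
Proof.
pose J := {ffun 'I_d -> 'I_m.+1}.
pose P (k : J + J) := match k with
  | inl alpha => (mdeg (mi alpha) <= m)%N
  | inr alpha => (mdeg (mi alpha) == m) && (0 < t) end.
pose F (f g : sobolev s) (k : J + J) : R := match k with
  | inl alpha => norm2 mu (weak_partial (mi alpha) f \- weak_partial (mi alpha) g)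
  | inr alpha => norm2 (mu \x mu)%E (gagliardo t
       (weak_partial (mi alpha) f \- weak_partial (mi alpha) g)) end.
have E f g : sob_dist f g = Num.sqrt (\sum_(k | P k) F f g k ^+ 2).
  by rewrite /sob_dist big_sumType.
rewrite !E; apply: l2_triangle => -[alpha _|alpha /andP[/eqP am t0]] /=.
  by rewrite norm2_ge0/= norm2_triangle//; exact: LfunP.
by rewrite norm2_ge0/= !gagliardoB norm2_triangle//; exact: sob_slob.
Qed.

End sobolev.

Section sobolev_vector.
Context {R : realType}.
Variables (d n : nat) (s : R).
Implicit Types u v w : 'I_n -> sobolev d s.

Definition Hsdist u v : R := Num.sqrt (\sum_j sob_dist (u j) (v j) ^+ 2).

Let Hsdistxx u : Hsdist u u = 0.
Proof. by rewrite /Hsdist big1 ?sqrtr0// => j _; rewrite sob_distxx expr0n. Qed.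

Let HsdistC u v : Hsdist u v = Hsdist v u.
Proof.
by rewrite /Hsdist; congr Num.sqrt; apply: eq_bigr => j _; rewrite sob_distC.
Qed.

Let Hsdist_triangle v u w : Hsdist u w <= Hsdist u v + Hsdist v w.
Proof.
by apply: l2_triangle => j _; rewrite sqrtr_ge0/= sob_dist_triangle.
Qed.

Definition Hspdist := PDist Hsdistxx HsdistC Hsdist_triangle.

Definition Hs := pdist_space Hspdist.

Definition Hs_fun (u : Hs) : 'rV[R]_d -> 'cV[R]_n :=
  vfun (fun j => sob_fun ((u : 'I_n -> sobolev d s) j)).

End sobolev_vector.

Section chebyshev.
Context {R : realType}.

Fixpoint chebT (n : nat) : {poly R} :=
  match n with
  | 0 => 1
  | n1.+1 => match n1 with
             | 0 => 'X
             | n2.+1 => 2 *: 'X * chebT n1 - chebT n2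
             end
  end.

Definition shen_poly (k : nat) (a b : R) : {poly R} :=
  chebT k + a *: chebT k.+1 + b *: chebT k.+2.

Definition boundary_conditions (am bm ap bp : R) (p : {poly R}) : Prop :=
  am * p.[-1] + bm * p^`().[-1] = 0 /\ ap * p.[1] + bp * p^`().[1] = 0.

(* [ac] and [bc] are the sequences (a_k) and (b_k) determined by the boundary
   condition: (ac k, bc k) is the only pair of reals for which phi_k satisfies it. *)
Definition compact_combination (am bm ap bp : R) (ac bc : nat -> R) : Prop :=
  forall (k : nat) (a b : R),
    boundary_conditions am bm ap bp (shen_poly k a b) <-> a = ac k /\ b = bc k.

Variables ac bc : nat -> R.

Definition shen_phi (k : nat) : {poly R} := shen_poly k (ac k) (bc k).

Fixpoint compacting1 (n : nat) (alpha : nat -> 'cV[R]_n) (k : nat) : 'cV[R]_n :=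
  match k with
  | 0 => alpha 0%N
  | k1.+1 => match k1 with
             | 0 => alpha 1%N - ac 0%N *: compacting1 alpha k1
             | k2.+1 => alpha k - ac k1 *: compacting1 alpha k1
                                - bc k2 *: compacting1 alpha k2
             end
  end.

Variables d n : nat.
Notation X := 'rV[R]_d.
Notation mu := (@leb_cube R d).
Implicit Types (k : 'I_d -> nat) (v : X -> 'cV[R]_n).

Definition chebT_multi k (x : X) : R := \prod_i (chebT (k i)).[x ord0 i].

Definition shen_phi_multi k (x : X) : R := \prod_i (shen_phi (k i)).[x ord0 i].

(* The value 0 taken where some |x_i| >= 1 is immaterial: those points are null
   for [leb_cube]. *)
Definition cheb_weight (x : X) : R := \prod_i (Num.sqrt (1 - x ord0 i ^+ 2))^-1.

Definition cheb_integrable v : Prop := forall j,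
  mu.-integrable setT (fun x => (v x j ord0 * cheb_weight x)%:E).

Definition cheb_transform v k : 'cV[R]_n :=
  (\prod_i (2 / (pi * (if k i == 0%N then 2 else 1)))) *:
  \col_j \int[mu]_x (v x j ord0 * chebT_multi k x * cheb_weight x).

(* [compacting1] in the direction [i], the other indices being fixed. *)
Definition compacting_dir (i : 'I_d) (alpha : ('I_d -> nat) -> 'cV[R]_n) k : 'cV[R]_n :=
  compacting1 (fun m => alpha (fun j => if j == i then m else k j)) (k i).

Definition compacting (alpha : ('I_d -> nat) -> 'cV[R]_n) : ('I_d -> nat) -> 'cV[R]_n :=
  foldr compacting_dir alpha (enum 'I_d).

Definition shen_transform v : ('I_d -> nat) -> 'cV[R]_n :=
  compacting (cheb_transform v).

(* The inverse transform of coefficients supported in {k | k_i < N for all i}. *)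
Definition shen_inverse (N : nat) (beta : {ffun 'I_d -> 'I_N} -> 'cV[R]_n) (x : X) :
    'cV[R]_n :=
  \sum_(l : {ffun 'I_d -> 'I_N}) shen_phi_multi (mi l) x *: beta l.

(* Keeps the modes with k_i <= N for all i. *)
Definition shen_projection (N : nat) v : X -> 'cV[R]_n :=
  @shen_inverse N.+1 (fun l => shen_transform v (mi l)).

End chebyshev.

Section networks.
Context {R : realType}.

(* Fully connected feedforward networks R^m -> R^n with any number of hidden
   layers; [net_affine] is the output layer. *)
Inductive net : nat -> nat -> Type :=
| net_affine m n (W : 'M[R]_(n, m)) (b : 'cV[R]_n) : net m n
| net_hidden m k n (W : 'M[R]_(k, m)) (b : 'cV[R]_k) (f : net k n) : net m n.

Fixpoint net_eval (sigma : R -> R) m n (f : net m n) : 'cV[R]_m -> 'cV[R]_n :=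
  match f with
  | net_affine _ _ W b => fun y => W *m y + b
  | net_hidden _ _ _ W b g => fun y => net_eval sigma g (map_mx sigma (W *m y + b))
  end.

End networks.

Section opno.
Context {R : realType} (ac bc : nat -> R) (d : nat).
Notation X := 'rV[R]_d.

(* A linear map on frequency space, sending families of coefficients in R^m to
   families in R^n, that involves only the modes k with k_i < ker_modes, and is
   banded with bandwidth [ker_band] in every coordinate direction. *)
Record kernel (m n : nat) := Kernel {
  ker_modes : nat;
  ker_band : nat;
  ker_mx : {ffun 'I_d -> 'I_ker_modes} -> {ffun 'I_d -> 'I_ker_modes} -> 'M[R]_(n, m);
  ker_banded : forall i j : {ffun 'I_d -> 'I_ker_modes}, (exists q : 'I_d,
      (i q + ker_band < j q)%N \/ (j q + ker_band < i q)%N) -> ker_mx i j = 0 }.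

Arguments ker_mx {m n} k i j.

Definition kernel_apply m n (A : kernel m n) (v : X -> 'cV[R]_m) : X -> 'cV[R]_n :=
  @shen_inverse R ac bc d n (ker_modes A)
    (fun i => \sum_j ker_mx A i j *m cheb_transform v (mi j)).

(* S^{-1}(A . C_h(v)) makes sense when C_h(v) does; there is nothing to check
   when A = 0. *)
Definition kernel_defined m n (A : kernel m n) (v : X -> 'cV[R]_m) : Prop :=
  (exists i j, ker_mx A i j != 0) -> cheb_integrable v.

Record layer (dv : nat) := Layer {
  lay_W : 'M[R]_dv;
  lay_b : X -> 'cV[R]_dv;
  lay_A : kernel dv dv;
  lay_b_continuous : {within @cube R d, continuous lay_b} }.

Definition layer_apply (sigma : R -> R) dv (l : layer dv) (v : X -> 'cV[R]_dv) :
    X -> 'cV[R]_dv :=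
  fun x => v x + map_mx sigma (lay_W l *m v x + lay_b l x + kernel_apply (lay_A l) v x).

(* The channel width is [op_width + op_kwidth]: the lifting layer is the pointwise
   network [op_lift], applied to (a(x), x), concatenated with the kernel layer
   [op_klift], which is absent when [op_kwidth = 0]. *)
Record opno (da du : nat) := Opno {
  op_sigma : R -> R;
  op_sigma_continuous : continuous op_sigma;
  op_sigma_nonpoly : ~ exists p : {poly R}, forall y, op_sigma y = p.[y];
  op_width : nat;
  op_kwidth : nat;
  op_lift : @net R (da + d) op_width;
  op_klift : kernel da op_kwidth;
  op_layers : seq (layer (op_width + op_kwidth));
  op_final : @net R (op_width + op_kwidth) du;
  op_proj : option nat }.

Section eval.
Variables (da du : nat) (L : opno da du).

Definition op_lifting (a : X -> 'cV[R]_da) : X -> 'cV[R]_(op_width L + op_kwidth L) :=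
  fun x => col_mx (net_eval (op_sigma L) (op_lift L) (col_mx (a x) x^T))
                  (kernel_apply (op_klift L) a x).

(* The layers are listed in order of application. *)
Definition op_hidden (a : X -> 'cV[R]_da) :=
  foldl (fun v l => layer_apply (op_sigma L) l v) (op_lifting a) (op_layers L).

Fixpoint layers_defined dv (sigma : R -> R) (ls : seq (layer dv)) (v : X -> 'cV[R]_dv) :
    Prop :=
  if ls is l :: ls' then
    kernel_defined (lay_A l) v /\ layers_defined sigma ls' (layer_apply sigma l v)
  else True.

Definition op_pointwise (a : X -> 'cV[R]_da) : X -> 'cV[R]_du :=
  net_eval (op_sigma L) (op_final L) \o op_hidden a.

Definition op_eval (a : X -> 'cV[R]_da) : X -> 'cV[R]_du :=
  if op_proj L is Some N then shen_projection ac bc N (op_pointwise a)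
  else op_pointwise a.

(* Every Chebyshev transform taken in the evaluation of L at a is that of a
   function integrable against the Chebyshev weight, and L(a) is in L^2. *)
Definition op_defined (a : X -> 'cV[R]_da) : Prop :=
  [/\ kernel_defined (op_klift L) a,
      layers_defined (op_sigma L) (op_layers L) (op_lifting a),
      (op_proj L -> cheb_integrable (op_pointwise a)) &
      forall j, (fun x => op_eval a x j ord0) \in Lfun (@leb_cube R d) 2%:E].

End eval.

End opno.

Arguments ker_mx {R d m n} k i j.

(* Main.v *)
(* Applying the activation function to [a_j] and [- a_j] encodes the input by bounded
   features that determine it almost everywhere. The weighted L^1 distance rho of the
   features is continuous on H^s and vanishes only between points at distance 0, so by
   compactness K is covered by finitely many rho-balls on each of which G is almost
   constant.

   A kernel using the mode 0 alone sends channels v_k to phi_0(x) times a linear form in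
   the integrals of the v_k against the Chebyshev weight. Since |phi_0 y| = |phi_0| |y|
   for a scalar y, an absolute value followed by such a kernel computes |y|. Absolute
   values suffice for the rho-distances D_i to continuous approximations of the centres
   and for a partition of unity min(1, s_i) - min(1, s_(i-1)), where s_i sums the first i
   bumps (3 r_k - D_k)^+ / r_k. The last layer multiplies phi_0 times the i-th function
   of the partition by a bias w_i, as a combination of squares. The functions phi_0 w with
   w continuous are dense in L^2 because phi_0 <> 0 almost everywhere, so that phi_0 w_i
   can be taken close to the value of G at the i-th centre.

   One activation function does everything: it is injective on the negative half-line,
   an absolute value near 2 and a parabola near 5, and all arguments are rescaled. *)

Require Import Defs.
From mathcomp Require Import all_boot all_order all_algebra.
From mathcomp Require Import all_classical all_reals all_analysis.
From mathcomp Require Import ring lra measurable_realfun.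
Import Order.TTheory GRing.Theory Num.Theory.
Import numFieldNormedType.Exports.
Local Open Scope classical_set_scope.
Local Open Scope ring_scope.

Set Implicit Arguments.
Unset Strict Implicit.
Unset Printing Implicit Defensive.

(** * The activation function *)

(** The obstacle is to be defined on all of [Hs]. The Chebyshev weight is integrable but not square
    integrable, so an input that is merely square integrable (s = 0 is allowed) may have no
    Chebyshev transform, and no kernel may touch it. A bounded activation applied first makes all
    later signals bounded. The price is that rho has no quantitative relation to the Sobolev metric;
    injectivity of the encoding and compactness of K stand in for one.

    Boundary conditions are general, so phi_0 may vary and vanish at points, and cannot be divided
    out pointwise. It is carried through every layer, the biases included; integrating |phi_0|
    recovers scalars, and the density result absorbs the last factor.

    Layers are residual. A channel that must keep its value is therefore fed a zero of the
    activation, and every channel other than the features stays 0 until the single layer that writes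
    it. *)

Section activation.
Context {R : realType}.
Implicit Types s t u : R.

Definition clip (a b t : R) : R := Num.max a (Num.min b t).

Lemma clip_bounds (a b t : R) : a <= b -> a <= clip a b t <= b.
Proof.
by move=> ab; rewrite /clip le_max lexx/= ge_max ab/= ge_min lexx.
Qed.

Lemma clip_id (a b t : R) : a <= t <= b -> clip a b t = t.
Proof. by move=> /andP[at_ tb]; rewrite /clip min_r// max_r. Qed.

Lemma clip_left (a b t : R) : t <= a -> clip a b t = a.
Proof. by move=> ta; rewrite /clip max_l// ge_min ta orbT. Qed.

Lemma clip_right (a b t : R) : a <= b <= t -> clip a b t = b.
Proof. by move=> /andP[ab bt]; rewrite /clip min_l// max_r. Qed.

Lemma clip_lip (a b s t : R) : `|clip a b s - clip a b t| <= `|s - t|.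
Proof.
rewrite /clip !(maxEle, minEle).
by do ! case: ifP => [|/negbT]; rewrite -?ltNge => *; rewrite !ler_norml;
  have := ler_norm (s - t); have := ler_norm (t - s); rewrite distrC => *; lra.
Qed.

(** Makes the truncation errors of a function dominated by the function itself. *)
Lemma clip_dist (M t : R) : 0 <= M -> `|t - clip (- M) M t| <= `|t|.
Proof.
move=> M0; rewrite /clip !(maxEle, minEle).
by do ! case: ifP => [|/negbT]; rewrite -?ltNge => *; rewrite !ler_norml;
  have := ler_norm t; have := ler_norm (- t); rewrite normrN => *;
  apply/andP; split; lra.
Qed.

Lemma maxr_lip (M s t : R) : `|Num.max M s - Num.max M t| <= `|s - t|.
Proof.
rewrite !maxEle.
by do ! case: ifP => [|/negbT]; rewrite -?ltNge => *; rewrite !ler_norml;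
  have := ler_norm (s - t); have := ler_norm (t - s); rewrite distrC => *; lra.
Qed.

(* On [t < 0] the values exceed 1 and determine [t]; near 2 the function is the
   absolute value, near 5 it is a parabola; everywhere else these two pieces are
   constant. *)
Definition act (t : R) : R := 1 - (1 + Num.max (- t) 0)^-1
  + `|clip (- 1) 1 (t - 2)| - clip 0 2 (t - 4) ^+ 2.

Let max0 (t : R) : 0 <= Num.max (- t) 0. Proof. by rewrite le_max lexx orbT. Qed.

Lemma inv1_bounds (m : R) : 0 <= m -> 0 < (1 + m)^-1 <= 1.
Proof. by move=> m0; rewrite invr_gt0 invf_le1; lra. Qed.

Lemma inv1_lip (m n : R) : 0 <= m -> 0 <= n -> `|(1 + m)^-1 - (1 + n)^-1| <= `|m - n|.
Proof.
move=> m0 n0; have [m1 n1] : 1 + m != 0 /\ 1 + n != 0 by split; apply/eqP; lra.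
rewrite (_ : _ - _ = (n - m) * ((1 + m)^-1 * (1 + n)^-1)); last by field; rewrite m1 n1.
have /andP[? ?] := inv1_bounds m0; have /andP[? ?] := inv1_bounds n0.
by rewrite normrM distrC ler_piMr// ger0_norm ?mulr_ge0 ?mulr_ile1// ltW.
Qed.

Lemma act_bound (t : R) : `|act t| <= 4.
Proof.
rewrite /act; have /andP[? ?] := inv1_bounds (max0 t).
have /andP[? ?] := @clip_bounds (-1) 1 (t - 2) ltac:(lra).
have /andP[? ?] := @clip_bounds 0 2 (t - 4) ltac:(lra).
have : `|clip (- 1) 1 (t - 2)| <= 1 by rewrite ler_norml; apply/andP.
have := normr_ge0 (clip (- 1) 1 (t - 2)).
by move: (`|_|) => a ? ?; rewrite ler_norml; apply/andP; split; nra.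
Qed.

(** The three pieces have Lipschitz constants 1, 1 and 4, the last because the square is taken on
    [0, 2]. *)
Lemma act_lip s t : `|act s - act t| <= 6 * `|s - t|.
Proof.
have h1 : `|(1 + Num.max (- s) 0)^-1 - (1 + Num.max (- t) 0)^-1| <= `|s - t|.
  apply: (le_trans (inv1_lip (max0 s) (max0 t))); rewrite !maxEle.
  by do ! case: ifP => [|/negbT]; rewrite -?ltNge => *; rewrite !ler_norml;
    have := ler_norm (s - t); have := ler_norm (t - s); rewrite distrC => *; lra.
have h2 : `| `|clip (- 1) 1 (s - 2)| - `|clip (- 1) 1 (t - 2)| | <= `|s - t|.
  apply: le_trans (ler_dist_dist _ _) _.
  by apply: le_trans (clip_lip _ _ _ _) _; rewrite opprB addrA subrK.
have h3 : `|clip 0 2 (s - 4) ^+ 2 - clip 0 2 (t - 4) ^+ 2| <= 4 * `|s - t|.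
  rewrite subr_sqr normrM mulrC ler_pM//.
    have /andP[? ?] := @clip_bounds 0 2 (s - 4) ltac:(lra).
    have /andP[? ?] := @clip_bounds 0 2 (t - 4) ltac:(lra).
    by rewrite ger0_norm; lra.
  by apply: le_trans (clip_lip _ _ _ _) _; rewrite opprB addrA subrK.
rewrite /act; move: h1 h2 h3; rewrite !ler_norml => /andP[? ?] /andP[? ?] /andP[? ?].
by apply/andP; split; lra.
Qed.

Lemma continuous_act : continuous act.
Proof.
move=> x; apply/cvgrPdist_lt => e e0; near=> y.
apply: le_lt_trans (act_lip _ _) _.
rewrite mulrC -ltr_pdivlMr//; near: y.
by apply/nbhs_ballP; exists (e / 6) => //=; rewrite divr_gt0.
Unshelve. all: by end_near. Qed.

Lemma act_abs u : `|u| <= 1 -> act (2 + u) = `|u|.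
Proof.
move=> /[dup] ? /ler_normlP[? ?]; rewrite /act max_r; last lra.
rewrite (_ : 2 + u - 2 = u); last by ring.
by rewrite clip_id ?clip_left; [rewrite addr0 invr1; ring|lra|apply/andP; split; lra].
Qed.

(** In a residual layer, a channel whose argument is 2 keeps its value. *)
Lemma act2 : act 2 = 0.
Proof. by rewrite -[2 in LHS]addr0 act_abs ?normr0. Qed.

(** Around 5 the absolute-value piece is stuck at 1 and [t - 4 = 1 + u] stays in [0, 2], so only the
    square varies. *)
Lemma act_sqr u : `|u| <= 1 -> act (5 + u) = 1 - (1 + u) ^+ 2.
Proof.
move=> /ler_normlP[? ?]; rewrite /act max_r; last lra.
rewrite (@clip_right (- 1)); last by apply/andP; split; lra.
rewrite (_ : 5 + u - 4 = 1 + u); last by ring.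
by rewrite clip_id; [rewrite addr0 invr1 normr1; ring|apply/andP; split; lra].
Qed.

(* The linear and the pure quadratic terms of the four values cancel. *)
Lemma act_mul x y : `|x| <= 2^-1 -> `|y| <= 2^-1 ->
  act (5 - x + y) + act (5 + x - y) - act (5 + x + y) - act (5 - x - y) = 8 * (x * y).
Proof.
move=> /ler_normlP[? ?] /ler_normlP[? ?].
rewrite -!(addrA 5) !act_sqr; first (by ring); by apply/ler_normlP; split; lra.
Qed.

Let act_neg t : t < 0 -> act t = 2 - (1 - t)^-1.
Proof.
move=> t0; rewrite /act max_l; last lra.
rewrite clip_left; last lra.
by rewrite clip_left; [rewrite normrN normr1; ring|lra].
Qed.

Let act_neg_gt1 t : t < 0 -> 1 < act t.
Proof.
move=> t0; rewrite act_neg//; suff : (1 - t)^-1 < 1 by lra.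
by rewrite invf_lt1; lra.
Qed.

Let act_nneg_le1 t : 0 <= t -> act t <= 1.
Proof.
move=> t0; rewrite /act max_r; last lra.
have /andP[? ?] := @clip_bounds (-1) 1 (t - 2) ltac:(lra).
have : `|clip (- 1) 1 (t - 2)| <= 1 by rewrite ler_norml; apply/andP.
by have := sqr_ge0 (clip 0 2 (t - 4)); rewrite addr0 invr1; lra.
Qed.

(** Unless [s = 0], one of [s], [- s] is negative. Values above 1 come only from negative arguments,
    where [act] is strictly monotone, so the two values reveal first the sign and then the
    argument. *)
Lemma act_inj s t : act s = act t -> act (- s) = act (- t) -> s = t.
Proof.
have neg x y : x < 0 -> act x = act y -> x = y.
  move=> x0 xy; have y0 : y < 0.
    by rewrite ltNge; apply/negP => /act_nneg_le1; have := act_neg_gt1 x0; lra.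
  move: xy; rewrite !act_neg// => /addrI/oppr_inj/invr_inj; lra.
move=> h1 h2; have [s0|s0|s0] := ltgtP s 0; first exact: neg.
  by apply: oppr_inj; apply: neg => //; lra.
have [t0|t0|t0] := ltgtP t 0; first by rewrite (neg t s).
  by apply: esym; apply: oppr_inj; apply: neg; [lra|].
by rewrite s0 t0.
Qed.

(** [act] is the constant -3 beyond 6, so a polynomial equal to it would be constant, yet
    [act 2 = 0]. *)
Lemma act_nonpoly : ~ exists p : {poly R}, forall y, act y = p.[y].
Proof.
move=> [p ap]; have big n : act (6 + n%:R) = - 3.
  have n0 : 0 <= n%:R :> R by [].
  rewrite /act max_r; last lra.
  by rewrite !clip_right; [rewrite addr0 invr1 normr1; ring| |]; apply/andP; split; lra.
suff : p + 3%:P = 0.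
  move=> /(congr1 (horner^~ 2)); rewrite hornerD hornerC horner0 -ap act2; lra.
apply/eqP; apply: contraT => p0.
pose rs := [seq (6 + n%:R : R) | n <- iota 0 (size (p + 3%:P))].
have := @max_poly_roots _ (p + 3%:P) rs p0.
rewrite size_map size_iota ltnn; move=> -> //.
  apply/allP => _ /mapP[n _ ->]; rewrite rootE hornerD hornerC -ap big.
  by apply/eqP; ring.
rewrite map_inj_uniq ?iota_uniq// => m n /addrI /eqP.
by rewrite eqr_nat => /eqP.
Qed.

End activation.

(** * Measure theory of the cube *)

Section cube_measure_theory.
Context {R : realType}.
Notation mu := (@leb_cube R _).

Lemma leb_stepE n (A : set 'rV[R]_n.+1) :
  leb_cube n.+1 A = (leb_I \x leb_cube n)%E (@rV_cons R n @^-1` A).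
Proof. by []. Qed.

Lemma leb_I_setT : leb_I setT = 2%:E :> \bar R.
Proof.
rewrite /leb_I /= /mfrestr /mrestr setTI lebesgue_measure_itv/= lte_fin.
by rewrite ifT; [rewrite -EFinB; congr (_%:E); ring|lra].
Qed.

Lemma leb_I_countable (A : set R) : countable (A `&` `[-1, 1]) -> leb_I A = 0%E.
Proof. exact: countable_lebesgue_measure0. Qed.

Lemma leb_cube_setT_gt0 d : (0 < @leb_cube R d setT)%E.
Proof.
elim: d => [|n IH]; first by rewrite /= diracT lte01.
rewrite leb_stepE preimage_setT -setXTT product_measure1E//.
by rewrite mule_gt0// [ltRHS]leb_I_setT lte_fin.
Qed.

(** Under [rV_cons] the preimage is a product with one null factor: the first if [i] is the head
    coordinate, otherwise the second, by induction. *)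
Lemma leb_cube_coord_null d (i : 'I_d) (F : set R) : measurable F ->
  leb_I F = 0%E -> leb_cube d (@rV_coord R d i @^-1` F) = 0%E.
Proof.
move=> mF F0; elim: d i => [[]//|n IH] i; rewrite leb_stepE.
have [j ij|i0] := unliftP ord0 i.
  rewrite (_ : _ @^-1` _ = setT `*` (@rV_coord R n j @^-1` F)).
    rewrite product_measure1E//; first by rewrite [X in (_ * X)%E]IH mule0.
    by have := @measurable_rV_coord R _ j measurableT _ mF; rewrite setTI.
  by apply/seteqP; split => [p|p [_]]; rewrite /= /rV_coord mxE ij liftK.
rewrite (_ : _ @^-1` _ = F `*` setT).
  by rewrite product_measure1E//= F0 mul0e.
by apply/seteqP; split => [p|p []]; rewrite /= /rV_coord mxE i0 unlift_none.
Qed.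

Lemma ae_coord d (F : set R) : measurable F -> leb_I F = 0%E ->
  {ae (@leb_cube R d), forall x : 'rV[R]_d, forall i : 'I_d, ~ F (x ord0 i)}.
Proof.
move=> mF F0; apply: filter_forall => i.
exists (@rV_coord R d i @^-1` F); split.
- by have := @measurable_rV_coord R _ i measurableT _ mF; rewrite setTI.
- exact: leb_cube_coord_null.
- by move=> x /= /contrapT.
Qed.

(** On the boundary of the cube [cheb_weight] is 0, as an inverse of 0, so arguments by positivity
    of the weight need the open cube. *)
Lemma ae_open_cube d :
  {ae (@leb_cube R d), forall x : 'rV[R]_d, forall i : 'I_d, -1 < x ord0 i < 1}.
Proof.
pose F : set R := ~` `]-1, 1[.
have mF : measurable F by exact/measurableC.
have F0 : leb_I F = 0%E.
  apply: leb_I_countable; apply: (@sub_countable _ _ _ [set` [:: -1; 1 : R]]).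
    apply: subset_card_le => x /=; rewrite /F /= !in_itv/= !inE.
    move=> [/negP]; rewrite negb_and -!leNgt => /orP[x1|x1] /andP[x2 x3].
      by apply/orP; left; rewrite eq_le x1 x2.
    by apply/orP; right; rewrite eq_le x1 x3.
  exact: finite_set_countable.
have := @ae_coord d _ mF F0; apply: filterS => x Fx i.
by have := Fx i; rewrite /F/= in_itv/= => /contrapT.
Qed.

Lemma ae_cube d : {ae (@leb_cube R d), forall x : 'rV[R]_d, cube x}.
Proof. by have := @ae_open_cube d; apply: filterS => x h i; have := h i; lra. Qed.

(** If every finite list missed a root, roots could be added one at a time until there were [size p]
    distinct ones, more than the degree allows. *)
Lemma max_roots_list (p : {poly R}) : p != 0 ->
  exists rs : seq R, [set t | root p t] `<=` [set` rs].
Proof.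
move=> p0; apply: contrapT => /forallNP H.
suff [rs [urs rrs srs]] : exists rs : seq R, [/\ uniq rs, all (root p) rs & size rs = size p].
  by have := max_poly_roots p0 rrs urs; rewrite srs ltnn.
move: {p0}(size p) => n; elim: n => [|n [rs [urs rrs srs]]]; first by exists [::].
have /existsNP[t /not_implyP[/= pt trs]] := H rs.
by exists (t :: rs); rewrite /= urs rrs pt srs andbT; split => //; apply/negP.
Qed.

Lemma ae_roots d (p : {poly R}) : p != 0 ->
  {ae (@leb_cube R d), forall x : 'rV[R]_d, forall i : 'I_d, p.[x ord0 i] != 0}.
Proof.
move=> p0; pose F : set R := [set t | root p t].
have fF : countable F.
  have [rs prs] := max_roots_list p0.
  apply: (sub_countable (subset_card_le prs)); apply: finite_set_countable; exact: finite_seq.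
have mF : measurable F by apply: countable_measurable.
have F0 : leb_I F = 0%E.
  apply: leb_I_countable; apply: sub_countable fF; apply: subset_card_le.
  exact: subIsetl.
have := @ae_coord d _ mF F0; apply: filterS => x Fx i.
by apply/negP => /eqP h; apply: (Fx i); rewrite /F /= rootE h.
Qed.

Section continuous_measurable.
Variable d : nat.

(* Continuous functions are limits of functions constant on the cells of finer
   and finer grids, each grid having countably many cells. *)
Lemma continuous_measurable_rV (f : 'rV[R]_d -> R) :
  continuous f -> measurable_fun setT f.
Proof.
move=> cf.
pose pt n (z : 'rV[int]_d) : 'rV[R]_d := \row_i ((z ord0 i)%:~R / n.+1%:R).
pose fl n (x : 'rV[R]_d) : 'rV[int]_d := \row_i Num.floor (n.+1%:R * x ord0 i).
apply: (@measurable_fun_cvg _ _ _ _ (fun n => f \o pt n \o fl n)) => //.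
  move=> n _ B mB; rewrite setTI.
  pose cell (z : 'rV[int]_d) : set 'rV[R]_d :=
    \bigcap_(i in [set: 'I_d]) (@rV_coord R d i @^-1`
       [set t | (z ord0 i)%:~R <= n.+1%:R * t < (z ord0 i + 1)%:~R]).
  have cellP z x : cell z x <-> fl n x = z.
    split => [h|<- i _].
      by apply/rowP => i; rewrite mxE; apply: floor_def; exact: (h i).
    by rewrite /= /rV_coord mxE real_floor_itv// num_real.
  (* The preimage is the countable union of the cells whose corner [pt n z] has its value in [B]. *)
  rewrite (_ : _ @^-1` B = \bigcup_z (if `[< B (f (pt n z)) >] then cell z else set0)).
    apply: countable_bigcupT_measurable => [|z]; first exact: countableP.
    case: ifP => // _; apply: fin_bigcap_measurable => // i _.
    rewrite -[X in measurable X]setTI; apply: measurable_rV_coord => //.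
    rewrite (_ : [set t | _] = `[(z ord0 i)%:~R / n.+1%:R, (z ord0 i + 1)%:~R / n.+1%:R[%classic).
      exact: measurable_itv.
    apply/seteqP; split => t /=; rewrite in_itv/= ler_pdivrMr// ltr_pdivlMr//.
      by rewrite !(mulrC t).
    by rewrite !(mulrC t).
  apply/seteqP; split => [x Bx|x [z _]].
    exists (fl n x) => //; rewrite asboolT//; exact/cellP.
  by case: asboolP => // Bz /cellP xz; rewrite /= xz.
move=> x _; apply: (@cvg_comp _ _ _ (fun n => pt n (fl n x)) f _ (nbhs x)); last exact: cf.
apply/cvg_ballP => e e0; near=> n; split=> // i j.
rewrite !mxE ord1 /ball/=.
have n0 : 0 < n.+1%:R :> R by [].
have /andP[h1 h2] := real_floor_itv (num_real (n.+1%:R * x ord0 j)).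
rewrite {1}(_ : x ord0 j = n.+1%:R * x ord0 j / n.+1%:R); last by rewrite mulrAC mulfV ?mul1r// gt_eqF.
rewrite -mulrBl ger0_norm ?mulr_ge0 ?subr_ge0 ?invr_ge0//.
rewrite ltr_pdivrMr//; apply: (@lt_le_trans _ _ 1).
  by move: h2; rewrite rmorphD/= mulr1z; lra.
rewrite mulrC -ler_pdivrMr// div1r.
apply: (@le_trans _ _ n%:R); last by rewrite ler_nat.
by near: n; exact: nbhs_infty_ger.
Unshelve. all: by end_near. Qed.
End continuous_measurable.

End cube_measure_theory.

(** * Integrability of the Chebyshev weight *)

Section chebyshev_weight.
Context {R : realType}.

Definition weight1 (t : R) : R := (Num.sqrt (1 - t ^+ 2))^-1.

Lemma weight1_ge0 t : 0 <= weight1 t.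
Proof. by rewrite invr_ge0 sqrtr_ge0. Qed.

Lemma measurable_weight1 : measurable_fun setT weight1.
Proof.
(* Measurability of [powR] applies to this form; where the radicand is not positive both sides are
   0. *)
rewrite (_ : weight1 = fun t => (Num.max 0 (1 - t ^+ 2)) `^ (- 2^-1)).
  apply: (measurableT_comp (measurable_powR _)).
  apply: measurable_maxr => //; apply: measurable_funB => //.
apply/funext => t; rewrite powRN /weight1; congr (_^-1).
by rewrite powR12_sqrt ?le_max ?lexx//; case: leP => // /ltW t0; rewrite sqrtr0 ler0_sqrtr.
Qed.

(** At distance 4^-n from the ends of [-1, 1] the weight is of order 2^n: over these layers heights
    grow like 2^n while measures shrink like 4^-n. *)
Let A n : set R := [set t | 1 - (4^-1) ^+ n <= `|t|].

Let mA n : measurable (A n).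
Proof.
rewrite (_ : A n = ~` [set t | `|t| < 1 - (4^-1) ^+ n]).
  apply: measurableC; rewrite (_ : [set t | _] = `](- (1 - (4^-1) ^+ n)), (1 - (4^-1) ^+ n)[%classic).
    exact: measurable_itv.
  by apply/seteqP; split => t /=; rewrite in_itv/= ltr_norml.
by apply/seteqP; split => t /=; rewrite /A /= leNgt => /negP.
Qed.

Let leb_A n : (leb_I (A n) <= (2 * (4^-1) ^+ n)%:E)%E.
Proof.
set e := (4^-1) ^+ n; have e0 : 0 <= e by rewrite exprn_ge0.
have sub : A n `&` `[-1, 1] `<=` `[-1, -1 + e] `|` `[1 - e, 1].
  move=> t /= []; rewrite /A /= !in_itv/= -/e => At /andP[t1 t2].
  have [t0|t0] := leP 0 t; [right|left].
    by rewrite t2 andbT; move: At; rewrite ger0_norm.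
  by rewrite t1; move: At; rewrite ltr0_norm//; lra.
have -> : leb_I (A n) = lebesgue_measure (A n `&` `[-1, 1]) by [].
apply: (@le_trans _ _ (lebesgue_measure (`[-1, -1 + e] `|` `[1 - e, 1] : set R))).
  by apply: le_measure => //; rewrite inE; (apply: measurableU || apply: measurableI); (exact: mA || exact: measurable_itv).
apply: (@le_trans _ _ (lebesgue_measure (`[(-1)%R, (-1 + e)%R]%classic : set R) + lebesgue_measure (`[(1 - e)%R, 1%R]%classic : set R))%E).
  exact: measureU2.
rewrite !lebesgue_measure_itv/= !lte_fin.
have -> : (2 * e)%:E = (e%:E + e%:E)%E by rewrite -EFinD mulr2n mulrDl mul1r.
by apply: leeD; case: ifP => _; rewrite ?lee_fin//; lra.
Qed.

Let weight1_le t : (((weight1 t)%:E <= \sum_(n <oo) (2 ^+ n.+1 * \1_(A n) t)%:E)%E).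
Proof.
have term0 n : (0 <= (2 ^+ n.+1 * \1_(A n) t)%:E)%E.
  by rewrite lee_fin mulr_ge0.
have [t1|t1] := leP 1 `|t|.
  rewrite /weight1 ler0_sqrtr ?invr0; first exact: nneseries_ge0.
  by rewrite subr_le0 -(expr1n _ 2) -(real_normK (num_real t)) lerXn2r// nnegrE.
have ex : exists n, (4^-1) ^+ n.+1 < 1 - `|t|.
  have d0 : 0 < 1 - `|t| by lra.
  have [n _ /(_ n (leqnn _)) h] := near_infty_natSinv_expn_lt (PosNum d0).
  exists n; apply: le_lt_trans h; rewrite /= div1r -exprVn.
  apply: (@le_trans _ _ (4^-1 ^+ n)).
    by rewrite exprS ler_piMl ?exprn_ge0//; lra.
  by apply: lerXn2r; rewrite ?nnegrE; lra.
(* The least n with 4^-(n+1) < 1 - |t| bounds the weight by 2^(n+1). Minimality puts t in [A n]; for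
   n = 0 it says nothing, but [A 0] is everything. *)
have [n nt nmin] := ex_minnP ex.
have Ant : A n t.
  rewrite /A /=; case: n nt nmin => [|n] nt nmin; first by rewrite expr0 subrr.
  have := contraNN (nmin n); rewrite -ltnNge ltnSn => /(_ isT); rewrite -leNgt; lra.
apply: (@le_trans _ _ (2 ^+ n.+1 * \1_(A n) t)%:E).
  rewrite lee_fin indicE mem_set// mulr1 /weight1.
  have h : (2^-1 ^+ n.+1) ^+ 2 < 1 - t ^+ 2.
    rewrite -exprM mulnC exprM (_ : 2^-1 ^+ 2 = 4^-1); last by field.
    by rewrite -(real_normK (num_real t)); have := normr_ge0 t; nra.
  rewrite -[leRHS]invrK lef_pV2 ?posrE ?invr_gt0 ?exprn_gt0// ?sqrtr_gt0; last first.
    by apply: lt_trans h; rewrite exprn_gt0// exprn_gt0// invr_gt0.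
  rewrite -exprVn -[leLHS]ger0_norm ?exprn_ge0// -sqrtr_sqr ler_wsqrtr//.
  exact: ltW.
apply: le_trans (nneseries_lim_ge n.+1 _) => //.
by rewrite big_nat_recr//= leeDr// sume_ge0.
Qed.

Lemma weight1_lty : (\int[leb_I]_t (weight1 t)%:E < +oo)%E.
Proof.
have term0 n t : (0 <= (2 ^+ n.+1 * \1_(A n) t : R)%:E)%E.
  by rewrite lee_fin mulr_ge0.
have mt n : measurable_fun setT (fun t => (2 ^+ n.+1 * \1_(A n) t : R)%:E).
  by apply/measurable_EFinP; apply: measurable_funM => //; exact: measurable_indic.
apply: (@le_lt_trans _ _ (\int[leb_I]_t (\sum_(n <oo) (2 ^+ n.+1 * \1_(A n) t)%:E))%E).
  apply: ge0_le_integral => //.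
  - by move=> t _; rewrite lee_fin weight1_ge0.
  - by apply/measurable_EFinP; exact: measurable_weight1.
  - by apply: ge0_emeasurable_sum => [n t _ _|n _]; [exact: term0|exact: mt].
rewrite integral_nneseries//.
(* Height 2^(n+1) times measure 2 * 4^-n is 8 / 2^(n+1). *)
apply: (@le_lt_trans _ _ (\sum_(n <oo) (8 / (2 ^ n.+1)%:R)%:E)%E); last first.
  by apply: le_lt_trans (epsilon_trick0 _ _) _ => //; rewrite ltry.
apply: lee_nneseries => [n *|n *]; first by apply: integral_ge0 => t _; exact: term0.
under eq_integral do rewrite EFinM.
rewrite ge0_integralZl//; last first.
  by apply/measurable_EFinP; apply: measurable_indic; exact: mA.
rewrite integral_indic ?setIT//; last exact: mA.
apply: le_trans (lee_wpmul2l _ (leb_A n)) _; first by rewrite lee_fin exprn_ge0.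
rewrite -EFinM lee_fin.
rewrite (_ : 4^-1 = 2^-1 * 2^-1 :> R); last by field.
rewrite natrX exprMn exprS !exprVn.
have : 2 ^+ n != 0 :> R by rewrite expf_neq0.
by move: (2 ^+ n) => a a0; rewrite le_eqVlt; apply/orP; left; apply/eqP; field.
Qed.

End chebyshev_weight.

Section chebyshev_weight_cube.
Context {R : realType}.
Notation mu := (@leb_cube R _).

Lemma cheb_weightE d (x : 'rV[R]_d) : cheb_weight x = \prod_i weight1 (x ord0 i).
Proof. by []. Qed.

Lemma cheb_weight_ge0 d (x : 'rV[R]_d) : 0 <= cheb_weight x.
Proof. by apply: prodr_ge0 => i _; exact: weight1_ge0. Qed.

Lemma cheb_weight_gt0 d (x : 'rV[R]_d) :
  (forall i, -1 < x ord0 i < 1) -> 0 < cheb_weight x.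
Proof.
move=> h; apply: prodr_gt0 => i _; have := h i => /andP[h1 h2].
by rewrite invr_gt0 sqrtr_gt0; nra.
Qed.

(** A factor with negative radicand has [Num.sqrt] equal to 0, hence inverse 0. Values off the cube
    thus never matter in weighted integrals. *)
Lemma cheb_weight_eq0 d (x : 'rV[R]_d) : ~ cube x -> cheb_weight x = 0.
Proof.
move=> /existsNP[i /negP xi]; rewrite cheb_weightE (bigD1 i)//= /weight1.
rewrite ler0_sqrtr ?invr0 ?mul0r//.
by move: xi; rewrite negb_and -!ltNge => /orP[]; nra.
Qed.

Lemma measurable_cheb_weight d : measurable_fun setT (@cheb_weight R d).
Proof.
rewrite (_ : @cheb_weight R d = fun x => \prod_i weight1 (@rV_coord R d i x))//.
apply: measurable_prod => i _; apply: measurableT_comp; last exact: measurable_rV_coord.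
exact: measurable_weight1.
Qed.

Lemma cheb_weight_cons n (p : R * 'rV[R]_n) :
  cheb_weight (rV_cons p) = weight1 p.1 * cheb_weight p.2.
Proof.
rewrite !cheb_weightE big_ord_recl; congr (weight1 _ * _).
  by rewrite mxE unlift_none.
by apply: eq_bigr => i _; rewrite mxE liftK.
Qed.

(** Tonelli along [rV_cons] reduces the integral to one-dimensional ones. *)
Lemma cheb_weight_lty d : (\int[@leb_cube R d]_x (cheb_weight x)%:E < +oo)%E.
Proof.
elim: d => [|n IH].
  rewrite /= integral_dirac//; last by apply/measurable_EFinP; exact: measurable_cheb_weight.
  by rewrite diracT mul1e ltry.
rewrite [X in (X < _)%E](_ : _ =
    \int[pushforward (leb_I \x leb_cube n)%E (@rV_cons R n)]_x (cheb_weight x)%:E)%E//.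
rewrite ge0_integral_pushforward//=; last 3 first.
- exact: measurable_rV_cons.
- by apply/measurable_EFinP; exact: measurable_cheb_weight.
- by move=> x _; rewrite lee_fin cheb_weight_ge0.
rewrite preimage_setT.
under eq_integral do rewrite /comp cheb_weight_cons EFinM.
rewrite fubini_tonelli1//=; last 2 first.
- apply: emeasurable_funM; apply/measurable_EFinP.
    by apply: measurableT_comp => //; exact: measurable_weight1.
  by apply: measurableT_comp => //; exact: measurable_cheb_weight.
- by move=> x; rewrite mule_ge0// lee_fin ?weight1_ge0 ?cheb_weight_ge0.
rewrite /fubini_F /=.
under eq_integral => t _.
  rewrite ge0_integralZl//; last 3 first.
  - by apply/measurable_EFinP; exact: measurable_cheb_weight.
  - by move=> x _; rewrite lee_fin cheb_weight_ge0.
  - by rewrite lee_fin weight1_ge0.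
  over.
have fin : (\int[@leb_cube R n]_x (cheb_weight x)%:E \is a fin_num)%E.
  by rewrite ge0_fin_numE// integral_ge0// => x _; rewrite lee_fin cheb_weight_ge0.
rewrite -(fineK fin) ge0_integralZr//=; last 3 first.
- by apply/measurable_EFinP; exact: measurable_weight1.
- by move=> t _; rewrite lee_fin weight1_ge0.
- by rewrite lee_fin fine_ge0// integral_ge0// => x _; rewrite lee_fin cheb_weight_ge0.
rewrite muleC lte_mul_pinfty//; last exact: weight1_lty.
by rewrite lee_fin fine_ge0// integral_ge0// => x _; rewrite lee_fin cheb_weight_ge0.
Qed.

End chebyshev_weight_cube.

(** Dominated convergence, reduced to the single index that the approximation arguments consume. *)
Lemma dominated_small dd (T : measurableType dd) (R : realType)
    (mu : {measure set T -> \bar R}) (f : nat -> T -> R) (g : T -> R) (e : R) :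
  (forall n, measurable_fun setT (f n)) -> mu.-integrable setT (EFin \o g) ->
  (forall n x, `|f n x| <= g x) ->
  {ae mu, forall x, f n x @[n --> \oo] --> (0 : R)} -> 0 < e ->
  exists n, \int[mu]_x `|f n x| < e.
Proof.
move=> mf ig fg f0 e0.
have [||||_ + _] := @dominated_convergence _ _ _ mu setT measurableT
  (fun n => EFin \o f n) (cst 0%E) (EFin \o g) _ _ _ ig.
- by move=> n; apply/measurable_EFinP; exact: mf.
- exact: measurable_cst.
- by apply: filterS f0 => x fx _; apply: cvg_EFin => //; exact: nearW.
- by apply: aeW => x n _; rewrite lee_fin; exact: fg.
move=> /fine_cvgP[_ /cvgrPdist_lt/(_ e e0)[n _ /(_ n (leqnn _))]].
rewrite /= sub0r normrN => h; exists n; apply: le_lt_trans h.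
rewrite (le_trans _ (ler_norm _))//.
suff -> : fine (\int[mu]_x `|(f n x)%:E - 0|)%E = \int[mu]_x `|f n x| by [].
by congr fine; apply: eq_integral => x _; rewrite sube0.
Qed.

(** * Integrals of bounded functions against the Chebyshev weight *)

Section weighted_integral.
Context {R : realType} (d : nat).
Notation X := 'rV[R]_d.
Notation mu := (@leb_cube R d).
Implicit Types f g h : X -> R.

(** The bound is asked on the cube only, since polynomials such as the basis functions are unbounded
    on the whole space. *)
Definition bounded_mfun h :=
  measurable_fun setT h /\ exists C, forall x, cube x -> `|h x| <= C.

Lemma bounded_mfun_pos h : bounded_mfun h ->
  exists C, 0 < C /\ forall x, cube x -> `|h x| <= C.
Proof.
move=> [_ [C hC]]; exists (`|C| + 1); split; first by rewrite ltr_wpDl.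
by move=> x /hC /le_trans; apply; rewrite ler_wpDr// ler_norm.
Qed.

Lemma bounded_mfun_cst c : bounded_mfun (cst c).
Proof. by split=> //; exists `|c|. Qed.

Lemma bounded_mfunD f g : bounded_mfun f -> bounded_mfun g -> bounded_mfun (f \+ g).
Proof.
move=> [mf [C fC]] [mg [D gD]]; split; first exact: measurable_funD.
by exists (C + D) => x cx; rewrite (le_trans (ler_normD _ _))// lerD ?fC ?gD.
Qed.

Lemma bounded_mfunM f g : bounded_mfun f -> bounded_mfun g -> bounded_mfun (f \* g).
Proof.
move=> bf bg; have [C [C0 fC]] := bounded_mfun_pos bf; have [D [D0 gD]] := bounded_mfun_pos bg.
split; first by apply: measurable_funM; [case: bf|case: bg].
by exists (C * D) => x cx; rewrite normrM ler_pM ?fC ?gD.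
Qed.

Lemma bounded_mfunZ c f : bounded_mfun f -> bounded_mfun (fun x => c * f x).
Proof. exact: bounded_mfunM (bounded_mfun_cst c). Qed.

Lemma bounded_mfunN f : bounded_mfun f -> bounded_mfun (\- f).
Proof.
move=> bf; rewrite (_ : \- f = fun x => -1 * f x); first exact: bounded_mfunZ.
by apply/funext => x; rewrite mulN1r.
Qed.

Lemma bounded_mfunB f g : bounded_mfun f -> bounded_mfun g -> bounded_mfun (f \- g).
Proof. by move=> bf bg; apply: bounded_mfunD => //; exact: bounded_mfunN. Qed.

Lemma bounded_mfun_norm f : bounded_mfun f -> bounded_mfun (fun x => `|f x|).
Proof.
move=> [mf [C fC]]; split; first exact: measurableT_comp.
by exists C => x cx; rewrite normr_id fC.
Qed.

Lemma bounded_mfun_sum (I : finType) (F : I -> X -> R) :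
  (forall i, bounded_mfun (F i)) -> bounded_mfun (fun x => \sum_i F i x).
Proof.
move=> bF; rewrite (_ : (fun x => _) = \sum_i F i); last first.
  by apply/funext => x; rewrite fct_sumE.
apply: big_ind => //; first exact: bounded_mfun_cst.
exact: bounded_mfunD.
Qed.

Lemma bounded_mfun_comp (u : R -> R) f : continuous u -> (exists C, forall t, `|u t| <= C) ->
  measurable_fun setT f -> bounded_mfun (u \o f).
Proof.
move=> cu [C uC] mf; split; last by exists C => x _; exact: uC.
by apply: measurableT_comp mf; exact: continuous_measurable_fun.
Qed.

Definition wint h : R := \int[mu]_x (h x * cheb_weight x).

Lemma wint_integrable h : bounded_mfun h ->
  mu.-integrable setT (EFin \o (fun x => h x * cheb_weight x)).
Proof.
move=> bh; have [C [C0 hC]] := bounded_mfun_pos bh.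
apply: (@le_integrable _ _ _ _ _ _ _ (fun x => C%:E * (cheb_weight x)%:E)%E) => //.
- apply/measurable_EFinP; apply: measurable_funM; first by case: bh.
  exact: measurable_cheb_weight.
- move=> x _; rewrite -EFinM !abse_EFin lee_fin !normrM (gtr0_norm C0).
  have [cx|/cheb_weight_eq0 ->] := pselect (cube x); last by rewrite normr0 !mulr0.
  by rewrite ler_wpM2r// hC.
apply: integrableZl => //; apply/integrableP; split.
  by apply/measurable_EFinP; exact: measurable_cheb_weight.
under eq_integral => x _ do rewrite abse_EFin ger0_norm ?cheb_weight_ge0//.
exact: cheb_weight_lty.
Qed.

Lemma eq_wint f g : (forall x, cube x -> f x = g x) -> wint f = wint g.
Proof.
move=> fg; apply: eq_Rintegral => x _.
by have [/fg -> //|/cheb_weight_eq0 ->] := pselect (cube x); rewrite !mulr0.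
Qed.

Lemma wintD f g : bounded_mfun f -> bounded_mfun g -> wint (f \+ g) = wint f + wint g.
Proof.
move=> bf bg; rewrite /wint -RintegralD//; try exact: wint_integrable.
by apply: eq_Rintegral => x _; rewrite mulrDl.
Qed.

Lemma wintZ c f : bounded_mfun f -> wint (fun x => c * f x) = c * wint f.
Proof.
move=> bf; rewrite /wint -RintegralZl//; last exact: wint_integrable.
by apply: eq_Rintegral => x _; rewrite mulrA.
Qed.

Lemma le_wint f g : bounded_mfun f -> bounded_mfun g ->
  (forall x, cube x -> f x <= g x) -> wint f <= wint g.
Proof.
move=> bf bg fg; apply: le_Rintegral => //; try exact: wint_integrable.
move=> x _; have [/fg ? //|/cheb_weight_eq0 ->] := pselect (cube x); last by rewrite !mulr0.
by rewrite ler_wpM2r// cheb_weight_ge0.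
Qed.

Lemma wint0 : wint (cst 0) = 0.
Proof. by rewrite /wint; under eq_Rintegral do rewrite mul0r; rewrite Rintegral_cst// mul0r. Qed.

Lemma wint_ge0 f : bounded_mfun f -> (forall x, cube x -> 0 <= f x) -> 0 <= wint f.
Proof. by move=> bf f0; rewrite -wint0; apply: le_wint => //; exact: bounded_mfun_cst. Qed.

(** The weight is positive almost everywhere. *)
Lemma wint_eq0 f : bounded_mfun f -> (forall x, cube x -> 0 <= f x) -> wint f = 0 ->
  {ae mu, forall x, f x = 0}.
Proof.
move=> bf f0 /eqP wf0.
have mfw : measurable_fun setT (EFin \o (fun x => f x * cheb_weight x)).
  apply/measurable_EFinP; apply: measurable_funM; first by case: bf.
  exact: measurable_cheb_weight.
have fw0 x : 0 <= f x * cheb_weight x.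
  have [/f0 ?|/cheb_weight_eq0 ->] := pselect (cube x); last by rewrite mulr0.
  by rewrite mulr_ge0// cheb_weight_ge0.
have : (\int[mu]_x `|(f x * cheb_weight x)%:E| = 0)%E.
  under eq_integral do rewrite abse_EFin ger0_norm//.
  have := integrable_fin_num measurableT (wint_integrable bf).
  rewrite /= => /fineK <-; by rewrite -[fine _]/(wint f) (eqP wf0).
move=> /(ae_eq_integral_abs mu measurableT mfw) h.
have o := @ae_open_cube R d; apply: filterS2 h o => x hx ox.
move: (hx I) => [] /eqP.
by rewrite mulf_eq0 (gt_eqF (cheb_weight_gt0 ox)) orbF => /eqP.
Qed.

Lemma measurable_tail (a : R) : measurable_fun setT
  (fun x : X => if a < cheb_weight x then cheb_weight x else 0).
Proof.
apply: measurable_fun_ifT => //; last exact: measurable_cheb_weight.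
by apply: measurable_fun_ltr => //; exact: measurable_cheb_weight.
Qed.

Lemma weight_tail (e : R) : 0 < e -> exists n : nat,
  \int[mu]_x (if n%:R < cheb_weight x then cheb_weight x else 0) < e.
Proof.
move=> e0; pose f (n : nat) (x : X) : R := if n%:R < cheb_weight x then cheb_weight x else 0.
have [||||n hn] := @dominated_small _ _ _ mu f (@cheb_weight R d) e _ _ _ _ e0.
- by move=> n; exact: measurable_tail.
- have := wint_integrable (bounded_mfun_cst 1).
  by apply: eq_integrable => // x _; rewrite /= mul1r.
- by move=> n x; rewrite /f; case: ifP => _; rewrite ?normr0 ?ger0_norm ?cheb_weight_ge0.
- apply: aeW => x; apply: cvg_near_cst; near=> n; rewrite /f ltNge ifF//.
  by apply/negbTE; rewrite negbK; near: n; exact: nbhs_infty_ger.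
exists n; rewrite (_ : \int[mu]_x _ = \int[mu]_x `|f n x|)//; apply: eq_Rintegral => x _.
by rewrite /f; case: ifP => _; rewrite ?normr0 ?ger0_norm ?cheb_weight_ge0.
Unshelve. all: by end_near. Qed.

Lemma bounded_integrable h C : measurable_fun setT h -> (forall x, `|h x| <= C) ->
  mu.-integrable setT (EFin \o h).
Proof.
move=> mh hC; apply: measurable_bounded_integrable => //.
  by rewrite -ge0_fin_numE// fin_num_measure.
by exists C; split; [rewrite num_real|move=> M CM x _ /=; rewrite (le_trans (hC x))// ltW].
Qed.

(* Splits the weight at a level, as it is not square integrable. *)
Lemma wint_le_L1 (C e : R) : 0 < C -> 0 < e -> exists2 M, 0 < M & forall h,
  measurable_fun setT h -> (forall x, `|h x| <= C) ->
  wint (fun x => `|h x|) <= M * \int[mu]_x `|h x| + e.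
Proof.
move=> C0 e0; have [n hn] := @weight_tail (e / C) (divr_gt0 e0 C0).
exists (n%:R + 1) => [|h mh hC]; first by rewrite ltr_wpDl.
have bh : bounded_mfun (fun x => `|h x|).
  by apply: bounded_mfun_norm; split => //; exists C.
have ih : mu.-integrable setT (EFin \o (fun x => `|h x|)).
  by apply: (@bounded_integrable _ C) => [|x]; [exact: measurableT_comp|rewrite normr_id].
pose tail (x : X) : R := if n%:R < cheb_weight x then cheb_weight x else 0.
have it : mu.-integrable setT (EFin \o tail).
  have iw := wint_integrable (bounded_mfun_cst 1).
  apply: le_integrable iw => //; first by apply/measurable_EFinP; exact: (@measurable_tail n%:R).
  move=> x _; rewrite lee_fin mul1r /tail.
  by case: ifP => _ //; rewrite normr0.
have ih' : mu.-integrable setT (EFin \o (fun x => (n%:R + 1) * `|h x|)).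
  exact: (integrableZl measurableT (n%:R + 1) ih).
have it' : mu.-integrable setT (EFin \o (fun x => C * tail x)).
  exact: (integrableZl measurableT C it).
(* Below the level the weight is at most n; above it |h| is at most C. *)
apply: (@le_trans _ _ (\int[mu]_x ((n%:R + 1) * `|h x| + C * tail x))).
  apply: le_Rintegral => //; first exact: wint_integrable.
    exact: (integrableD measurableT ih' it').
  move=> x _; rewrite /tail.
  have w0 := cheb_weight_ge0 x; have := hC x; have := normr_ge0 (h x).
  have : 0 <= n%:R :> R by [].
  by case: ltP; nra.
rewrite RintegralD// !RintegralZl// lerD2l mulrC -ler_pdivlMr//.
exact: ltW.
Qed.

End weighted_integral.

(** * Density of the continuous multiples of a function *)

Section boxes.
Context {R : realType} (d : nat).
Notation X := 'rV[R]_d.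

(** Open orthants form a pi-system generating the product sigma-algebra, and their indicators are
    pointwise limits of continuous functions; both serve the Dynkin argument of
    [approximable_indic]. *)
Definition orthant (c : 'I_d -> R) : set X := [set x | forall i, c i < x ord0 i].

Definition orthants : set_system X := range orthant.

Lemma setI_closed_orthants : setI_closed orthants.
Proof.
move=> _ _ [a _ <-] [b _ <-]; exists (fun i => Num.max (a i) (b i)) => //.
apply/seteqP; split => x /=; rewrite /orthant/=.
  by move=> h; split => i; have := h i; rewrite gt_max => /andP[].
by move=> [h1 h2] i; rewrite gt_max h1 h2.
Qed.

Lemma coord_ray_orthants (i : 'I_d) (c : R) : <<s orthants >> [set x : X | c < x ord0 i].
Proof.
rewrite (_ : [set x | _] =
    \bigcup_n orthant (fun j => if j == i then c else - n%:R)).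
  apply: sigma_algebra_bigcup => n; apply: sub_sigma_algebra; by eexists.
apply/seteqP; split => [x /= cx|x [n _ /(_ i)]]; last by rewrite eqxx.
(* An index above every |x_j| makes all constraints but the i-th void. *)
exists (\max_j (Num.bound (x ord0 j))) => // j; case: eqP => [->//|_].
rewrite ltrNl (lt_le_trans (unstable.ltrNbound _))// ler_nat.
by rewrite (bigD1 j)//= leq_maxl.
Qed.

Lemma measurable_orthants (A : set X) : measurable A -> <<s orthants >> A.
Proof.
apply: smallest_sub; first exact: smallest_sigma_algebra.
rewrite -bigcup_seq => _ /= [i _ [B mB <-]]; rewrite setTI.
suff : <<s RGenOInfty.G (R := R) >> `<=`
    [set B | <<s orthants >> (@rV_coord R d i @^-1` B)].
  by apply; have := mB; rewrite -[measurable B]/((ocitv (R:=R)).-sigma.-measurable B)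
    RGenOInfty.measurableE.
apply: smallest_sub.
  split => /=; first by rewrite preimage_set0; exact: sigma_algebra0.
  - by move=> C mC; rewrite setTD preimage_setC; exact: sigma_algebraC.
  - by move=> F mF; rewrite preimage_bigcup; exact: sigma_algebra_bigcup.
move=> _ [a ->] /=; rewrite (_ : _ @^-1` _ = [set x : X | a < x ord0 i]).
  exact: coord_ray_orthants.
by apply/seteqP; split => x /=; rewrite in_itv/= andbT.
Qed.

End boxes.

Section L1_triangle.
Context dd (T : measurableType dd) (R : realType) (mu : {measure set T -> \bar R}).

Lemma Rintegral_norm_triangle (f g h : T -> R) :
  mu.-integrable setT (EFin \o f) -> mu.-integrable setT (EFin \o g) ->
  mu.-integrable setT (EFin \o h) ->
  \int[mu]_x `|f x - h x| <= \int[mu]_x `|f x - g x| + \int[mu]_x `|g x - h x|.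
Proof.
move=> jf jg jh.
have B (u v : T -> R) : mu.-integrable setT (EFin \o u) -> mu.-integrable setT (EFin \o v) ->
    mu.-integrable setT (EFin \o (fun x => `|u x - v x|)).
  by move=> ju jv; exact: (integrable_abse (integrableB measurableT ju jv)).
rewrite -RintegralD//; try exact: B.
apply: le_Rintegral => //; try exact: B.
  exact: (integrableD measurableT (B _ _ jf jg) (B _ _ jg jh)).
by move=> x _; rewrite -{1}(subrK (g x) (f x)) -addrA ler_normD.
Qed.

End L1_triangle.

Section density.
Context {R : realType} (d : nat) (p : 'rV[R]_d -> R).
Notation X := 'rV[R]_d.
Notation mu := (@leb_cube R d).
Hypothesis cp : continuous p.
Hypothesis p0 : {ae mu, forall x, p x != 0}.
Implicit Types b h : X -> R.

(** The bound on [b] lets a bias built from it be scaled into the range of [act_mul]; the bound on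
    [p * b] gives integrability although [p] may be unbounded off the cube. *)
Definition multiplier b : Prop := [/\ continuous b,
  exists B, forall x, `|b x| <= B & exists B, forall x, `|p x * b x| <= B].

Definition approximable h : Prop := mu.-integrable setT (EFin \o h) /\
  forall e, 0 < e -> exists2 b, multiplier b & \int[mu]_x `|h x - p x * b x| < e.

Lemma measurable_pb b : multiplier b -> measurable_fun setT (fun x => p x * b x).
Proof.
move=> [cb _ _]; apply: measurable_funM; exact: continuous_measurable_rV.
Qed.

Lemma integrable_pb b : multiplier b -> mu.-integrable setT (EFin \o (fun x => p x * b x)).
Proof.
by move=> mb; have [_ _ [B hB]] := mb; apply: bounded_integrable hB; exact: measurable_pb.
Qed.

Lemma approximable_lim h : mu.-integrable setT (EFin \o h) ->
  (forall e, 0 < e -> exists2 g, approximable g & \int[mu]_x `|h x - g x| < e) ->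
  approximable h.
Proof.
move=> ih H; split => // e e0; have e2 : 0 < e / 2 by rewrite divr_gt0.
have [g [ig /(_ _ e2)[b mb gb]] hg] := H _ e2; exists b => //.
apply: le_lt_trans (Rintegral_norm_triangle ih ig (integrable_pb mb)) _.
by rewrite [ltRHS]splitr ltrD.
Qed.

Lemma approximable0 : approximable (cst 0).
Proof.
split; first exact: (@integrable0 _ _ _ mu).
move=> e e0; exists (cst 0); last first.
  under eq_Rintegral do rewrite mulr0 subrr normr0.
  by rewrite Rintegral_cst// mul0r.
split; first exact: cst_continuous.
  by exists 0 => x; rewrite normr0.
by exists 0 => x; rewrite mulr0 normr0.
Qed.

Lemma approximable_lin (c : R) g h : approximable g -> approximable h ->
  approximable (fun x => c * g x + h x).
Proof.
move=> [ig ag] [ih ah].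
have icg : mu.-integrable setT (EFin \o (fun x => c * g x)).
  exact: (integrableZl measurableT c ig).
have igh : mu.-integrable setT (EFin \o (fun x => c * g x + h x)).
  exact: (integrableD measurableT icg ih).
split => // e e0.
have e2 : 0 < e / 2 by rewrite divr_gt0.
have ec : 0 < e / 2 / (`|c| + 1) by rewrite divr_gt0// ltr_wpDl.
have [b mb hb] := ag _ ec; have [b' mb' hb'] := ah _ e2.
have [cb [B bB] [P pB]] := mb; have [cb' [B' bB'] [P' pB']] := mb'.
have mbb : multiplier (fun x => c * b x + b' x).
  split.
  - by move=> x; exact: (cvgD (cvgM (cvg_cst c) (cb x)) (cb' x)).
  - exists (`|c| * B + B') => x; rewrite (le_trans (ler_normD _ _))// lerD// normrM.
    by rewrite ler_wpM2l.
  - exists (`|c| * P + P') => x.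
    rewrite (_ : _ * _ = c * (p x * b x) + p x * b' x); last by ring.
    by rewrite (le_trans (ler_normD _ _))// lerD// normrM ler_wpM2l.
exists (fun x => c * b x + b' x) => //.
have iD u v : mu.-integrable setT (EFin \o u) -> multiplier v ->
    mu.-integrable setT (EFin \o (fun x => `|u x - p x * v x|)).
  by move=> ju jv; exact: (integrable_abse (integrableB measurableT ju (integrable_pb jv))).
apply: (@le_lt_trans _ _ (\int[mu]_x (`|c| * `|g x - p x * b x| + `|h x - p x * b' x|))).
  apply: le_Rintegral => //.
  - exact: iD.
  - exact: (integrableD measurableT (integrableZl measurableT `|c| (iD _ _ ig mb)) (iD _ _ ih mb')).
  move=> x _; rewrite -normrM; apply: le_trans (ler_normD _ _).
  by rewrite le_eqVlt; apply/orP; left; apply/eqP; congr (`|_|); ring.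
rewrite RintegralD//; last 2 first.
- exact: (integrableZl measurableT `|c| (iD _ _ ig mb)).
- exact: iD.
rewrite RintegralZl//; last exact: iD.
rewrite [ltRHS]splitr ltrD//.
have := hb; rewrite ltr_pdivlMr ?ltr_wpDl// => /(le_lt_trans _); apply.
by rewrite mulrC ler_wpM2l ?lerDl// Rintegral_ge0.
Qed.

Lemma approximable_sum (I : Type) (s : seq I) (c : I -> R) (F : I -> X -> R) :
  (forall i, approximable (F i)) -> approximable (fun x => \sum_(i <- s) c i * F i x).
Proof.
move=> aF; elim: s => [|i s IH].
  rewrite (_ : (fun x => _) = cst 0); first exact: approximable0.
  by apply/funext => x; rewrite big_nil.
rewrite (_ : (fun x => _) = fun x => c i * F i x + \sum_(i <- s) c i * F i x).
  exact: approximable_lin.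
by apply/funext => x; rewrite big_cons.
Qed.

Lemma continuous_coord (i : 'I_d) : continuous (fun x : X => x ord0 i).
Proof. exact: coord_continuous. Qed.

Lemma continuous_big_prod (I : Type) (s : seq I) (F : I -> X -> R) :
  (forall i, continuous (F i)) -> continuous (fun x => \prod_(i <- s) F i x).
Proof.
move=> cF; elim: s => [|i s IH].
  by under eq_fun do rewrite big_nil; exact: cst_continuous.
under eq_fun do rewrite big_cons.
by move=> x; exact: (cvgM (cF i x) (IH x)).
Qed.

Lemma continuous_clip (a c : R) : continuous (clip a c).
Proof.
move=> x; apply/cvgrPdist_lt => e e0; near=> y.
apply: le_lt_trans (clip_lip _ _ _ _) _.
by near: y; apply/nbhs_ballP; exists e.
Unshelve. all: by end_near. Qed.

(** It is 0 off the open orthant and eventually 1 at each of its points, so it tends to the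
    indicator everywhere. *)
Let bump (c : 'I_d -> R) (n : nat) (x : X) : R :=
  \prod_i clip 0 1 (n%:R * (x ord0 i - c i)).

Let continuous_bump c n : continuous (bump c n).
Proof.
apply: continuous_big_prod => i x.
apply: (@continuous_comp _ _ _ (fun y : X => n%:R * (y ord0 i - c i)) (clip 0 1)); last exact: continuous_clip.
exact: (cvgM (cvg_cst _) (cvgB (@continuous_coord i x) (cvg_cst _))).
Qed.

Let bump_01 c n x : 0 <= bump c n x <= 1.
Proof.
have h (t : R) := @clip_bounds _ 0 1 t ler01.
apply/andP; split; first by apply: prodr_ge0 => i _; have /andP[] := h (n%:R * (x ord0 i - c i)).
by apply: prodr_ile1 => i _; exact: h.
Qed.

Let bump_in c x : orthant c x -> \forall n \near \oo, bump c n x = 1.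
Proof.
move=> cx.
have : \forall n \near \oo, forall i, (x ord0 i - c i)^-1 <= n%:R.
  by apply: filter_forall => i; exact: nbhs_infty_ger.
apply: filterS => n h; apply: big1 => i _; apply: clip_right; rewrite ler01/=.
by rewrite -ler_pdivrMr ?subr_gt0// div1r.
Qed.

Let bump_out c n x : ~ orthant c x -> bump c n x = 0.
Proof.
move=> /existsNP[i /negP]; rewrite -leNgt => xi; apply/eqP; rewrite prodf_seq_eq0.
apply/hasP; exists i; first by rewrite mem_index_enum.
by rewrite /= clip_left// mulr_ge0_le0 ?subr_le0.
Qed.

Lemma measurable_orthant (c : 'I_d -> R) : measurable (orthant c).
Proof.
rewrite (_ : orthant c = \bigcap_(i in [set: 'I_d]) (@rV_coord R d i @^-1` `]c i, +oo[)).
  apply: fin_bigcap_measurable => // i _; rewrite -[X in measurable X]setTI.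
  by apply: measurable_rV_coord.
apply/seteqP; split => x cx i; first by move=> _; rewrite /= in_itv/= andbT; exact: cx.
by have := cx i I; rewrite /= in_itv/= andbT.
Qed.

(* [p / (p ^ 2 + 1 / n)] is a bounded continuous substitute for [1 / p]. *)
Lemma approximable_orthant (c : 'I_d -> R) : approximable (\1_(orthant c)).
Proof.
have mA := measurable_orthant c.
pose r (n : nat) (x : X) := p x / (p x ^+ 2 + n.+1%:R^-1).
have den n x : 0 < p x ^+ 2 + n.+1%:R^-1 by rewrite ltr_wpDl// sqr_ge0.
have pr n x : 0 <= p x * r n x <= 1.
  rewrite /r mulrA -expr2 ler_pdivrMr// mul1r lerDl invr_ge0 ler0n andbT.
  by rewrite divr_ge0 ?sqr_ge0// ltW.
have mb n : multiplier (fun x => bump c n x * r n x).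
  split.
  - have cr : continuous (r n).
      move=> x; have d0 : p x ^+ 2 + n.+1%:R^-1 != 0 by rewrite gt_eqF.
      have c1 : p y ^+ 2 @[y --> x] --> p x ^+ 2 by exact: (cvgM (@cp x) (@cp x)).
      have c2 : p y ^+ 2 + n.+1%:R^-1 @[y --> x] --> p x ^+ 2 + n.+1%:R^-1.
        exact: (cvgD c1 (cvg_cst _)).
      have c3 : (p y ^+ 2 + n.+1%:R^-1)^-1 @[y --> x] --> (p x ^+ 2 + n.+1%:R^-1)^-1.
        exact: (cvgV d0 c2).
      exact: (cvgM (@cp x) c3).
    by move=> x; exact: (cvgM (@continuous_bump c n x) (cr x)).
  (* With q = |p x| and k = n + 1 this amounts to q <= (1 + k) (q^2 + 1/k), a consequence of q <=
     q^2 + 1/4. *)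
  - exists (1 + n.+1%:R) => x; have /andP[b0 b1] := bump_01 c n x.
    rewrite normrM (ger0_norm b0) -[leRHS]mul1r ler_pM//.
    rewrite /r normrM normfV (gtr0_norm (den n x)) ler_pdivrMr//.
    rewrite -(real_normK (num_real (p x))).
    have n0 : 0 < n.+1%:R :> R by [].
    have n1 : n.+1%:R * n.+1%:R^-1 = 1 :> R by rewrite divff// gt_eqF.
    have := normr_ge0 (p x); move: (`|p x|) n.+1%:R n.+1%:R^-1 n0 n1 => q k k' k0 kk' q0.
    have k'0 : 0 < k' by rewrite -(pmulr_rgt0 _ k0) kk'.
    have : 0 <= k * q ^+ 2 by rewrite mulr_ge0 ?sqr_ge0// ltW.
    have := sqr_ge0 (q - 2^-1); nra.
  - exists 1 => x; have /andP[b0 b1] := bump_01 c n x; have /andP[r0 r1] := pr n x.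
    by rewrite mulrCA normrM (ger0_norm b0) (ger0_norm r0) mulr_ile1.
split.
  apply: (@bounded_integrable _ _ _ 1); first exact: measurable_indic.
  by move=> x; rewrite indicE; case: (_ \in _); rewrite ?normr1 ?normr0.
move=> e e0.
have [||||n hn] := @dominated_small _ _ _ mu
  (fun n x => \1_(orthant c) x - p x * (bump c n x * r n x)) (cst 1) e _ _ _ _ e0.
- move=> n; apply: measurable_funB; first exact: measurable_indic.
  exact: measurable_pb.
- exact: finite_measure_integrable_cst.
- move=> n x; have [cx|ncx] := pselect (orthant c x); last first.
    by rewrite bump_out// indicE memNset// mul0r mulr0 subrr normr0 ler01.
  rewrite indicE mem_set// mulrCA; have /andP[b0 b1] := bump_01 c n x.
  have /andP[r0 r1] := pr n x.
  have : 0 <= bump c n x * (p x * r n x) by rewrite mulr_ge0.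
  have : bump c n x * (p x * r n x) <= 1 by rewrite mulr_ile1.
  by move=> ? ?; rewrite ger0_norm /=; lra.
- apply: filterS p0 => x px.
  have [cx|ncx] := pselect (orthant c x); last first.
    apply: cvg_near_cst; apply: nearW => n.
    by rewrite bump_out// indicE memNset// mul0r mulr0 subrr.
  have p2 : 0 < p x ^+ 2 by rewrite exprn_even_gt0.
  apply/cvgrPdist_lt => e' e'0; have e2 : 0 < e' * p x ^+ 2 by rewrite mulr_gt0.
  near=> n; have -> : bump c n x = 1 by near: n; exact: bump_in.
  rewrite indicE mem_set// sub0r normrN mul1r /r mulrA -expr2.
  rewrite (_ : _ - _ = n.+1%:R^-1 / (p x ^+ 2 + n.+1%:R^-1)); last first.
    have := den n x; move: (n.+1%:R^-1) => k k0.
    by rewrite -{1}(@divff _ (p x ^+ 2 + k)) ?gt_eqF// -mulrBl addrC addKr.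
  rewrite ger0_norm; last by rewrite divr_ge0 ?invr_ge0// ltW.
  rewrite ltr_pdivrMr//.
  apply: (@lt_le_trans _ _ (e' * p x ^+ 2)); last first.
    by apply: ler_wpM2l; [exact: ltW|rewrite lerDl invr_ge0].
  near: n.
  exact: (near_infty_natSinv_lt (PosNum e2)).
by exists (fun x => bump c n x * r n x).
Unshelve. all: by end_near. Qed.

(** Dynkin's lemma: the good sets contain the orthants and are closed under proper differences, by
    linearity, and under increasing unions, by dominated convergence. *)
Lemma approximable_indic (A : set X) : measurable A -> approximable (\1_A).
Proof.
have ind (B : set X) : measurable B -> mu.-integrable setT (EFin \o (\1_B : X -> R)).
  move=> mB; apply: (@bounded_integrable _ _ _ 1); first exact: measurable_indic.
  by move=> x; rewrite indicE; case: (_ \in _); rewrite ?normr1 ?normr0.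
pose H := [set B : set X | measurable B /\ approximable (\1_B)].
have ndH : ndseq_closed H.
  move=> F ndF HF; have mF n : measurable (F n) by case: (HF n).
  have mU : measurable (\bigcup_n F n) by exact: bigcup_measurable.
  split => //; apply: approximable_lim => [|e e0]; first exact: ind.
  have [||||n hn] := @dominated_small _ _ _ mu
    (fun n x => \1_(\bigcup_n F n) x - \1_(F n) x) (cst 1) e _ _ _ _ e0.
  - by move=> n; apply: measurable_funB; exact: measurable_indic.
  - exact: finite_measure_integrable_cst.
  - move=> n x; rewrite !indicE; do 2 case: (_ \in _); rewrite ?subrr ?subr0 ?sub0r ?normrN ?normr1 ?normr0//=.
  - apply: aeW => x; apply: cvg_near_cst.
    have [[k _ Fkx]|nUx] := pselect ((\bigcup_n F n) x).
      near=> n; have kn : (k <= n)%N by near: n; exact: nbhs_infty_ge.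
      have Fnx : F n x by move/subsetPset: (ndF _ _ kn); apply.
      by rewrite !indicE !mem_set ?subrr//; exists k.
    apply: nearW => n; rewrite !indicE !memNset ?subrr// => Fnx.
    by apply: nUx; exists n.
  by exists (\1_(F n)) => //; case: (HF n).
(* The whole space has to be reached as an increasing union of orthants. *)
have HT : H setT.
  rewrite (_ : setT = \bigcup_n orthant (fun=> - n%:R : R)).
    apply: ndH => [m n mn|n].
      apply/subsetPset => x mx i; apply: le_lt_trans (mx i).
      by rewrite lerN2 ler_nat.
    by split; [exact: measurable_orthant|exact: approximable_orthant].
  apply/seteqP; split => // x _; exists (\max_j (Num.bound (x ord0 j))) => // j.
  rewrite ltrNl (lt_le_trans (unstable.ltrNbound _))// ler_nat.
  by rewrite (bigD1 j)//= leq_maxl.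
move=> mA; suff : H A by case.
apply: (@lambda_system_subset _ _ (@setI_closed_orthants R d) setT H _ _ _ A).
- split => //.
  move=> B C CB [mB aB] [mC aC]; split; first exact: measurableD.
  rewrite (_ : \1_(B `\` C) = fun x => -1 * \1_C x + \1_B x); first exact: approximable_lin.
  apply/funext => x; rewrite !indicE in_setD mulN1r.
  have [xC|xC] := boolP (x \in C).
    by rewrite (mem_set (CB _ (set_mem xC)))/= addNr.
  by rewrite andbT oppr0 add0r.
- move=> _ [c _ <-]; split; last exact: approximable_orthant.
  exact: measurable_orthant.
- by [].
- exact: measurable_orthants.
Unshelve. all: by end_near. Qed.

End density.

(** * Square integrability and the L^2 norm as an integral *)

Section norm2_theory.
Context dd (T : measurableType dd) (R : realType) (mu : {measure set T -> \bar R}).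
Implicit Types f g : T -> R.

Let sqrE f : (\int[mu]_x `|(EFin \o f) x| `^ 2 = \int[mu]_x (f x ^+ 2)%:E)%E.
Proof.
apply: eq_integral => x _.
by rewrite /= (@powR_mulrn _ _ 2%N)// real_normK// num_real.
Qed.

Lemma norm2E f : norm2 mu f = Num.sqrt (\int[mu]_x f x ^+ 2).
Proof.
rewrite /norm2 unlock fine_poweR powR12_sqrt ?fine_ge0//.
  by rewrite sqrE.
by apply: integral_ge0 => x _; exact: poweR_ge0.
Qed.

Lemma norm2_sqr f : norm2 mu f ^+ 2 = \int[mu]_x f x ^+ 2.
Proof.
by rewrite norm2E sqr_sqrtr// Rintegral_ge0// => x _; exact: sqr_ge0.
Qed.

Lemma Lfun_measurable f : f \in Lfun mu 2%:E -> measurable_fun setT f.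
Proof. by case/andP => /[!inE]. Qed.

Lemma Lfun2_integrable f : measurable_fun setT f ->
  f \in Lfun mu 2%:E <-> mu.-integrable setT (EFin \o (fun x => f x ^+ 2)).
Proof.
move=> mf; have mf2 : measurable_fun setT (EFin \o (fun x => f x ^+ 2)).
  by apply/measurable_EFinP; exact: measurable_funX.
have absE : (\int[mu]_x `|(f x ^+ 2)%:E| = \int[mu]_x (f x ^+ 2)%:E)%E.
  by apply: eq_integral => x _; rewrite gee0_abs// lee_fin sqr_ge0.
have p2 : (2 : R) != 0 by [].
split => [fL|/integrableP[_ /=]]; last first.
  rewrite absE -sqrE -(poweR_Lnorm _ _ p2) => h.
  apply/andP; split; apply: mem_set => //; rewrite /= /finite_norm ltey.
  by apply/eqP => h'; move: h; rewrite h' poweRyr.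
apply/integrableP; split => //=; rewrite absE -sqrE -(poweR_Lnorm _ _ p2).
by have := norm2_fin fL => /fineK <-; rewrite poweR_EFin ltry.
Qed.

Lemma norm2_ae_eq f g : measurable_fun setT f -> measurable_fun setT g ->
  {ae mu, forall x, f x = g x} -> norm2 mu f = norm2 mu g.
Proof.
move=> mf mg fg; rewrite !norm2E; congr (Num.sqrt (fine _)).
apply: ae_eq_integral => //; try by apply/measurable_EFinP; exact: measurable_funX.
by apply: filterS fg => x fgx _; rewrite /= fgx.
Qed.

Lemma Lfun2Z c f : f \in Lfun mu 2%:E -> (fun x => c * f x) \in Lfun mu 2%:E.
Proof.
move=> /[dup] /Lfun_measurable mf /(Lfun2_integrable mf) jf.
have mcf : measurable_fun setT (fun x => c * f x) by exact: measurable_funM.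
apply/(Lfun2_integrable mcf); under [X in _ \o X]eq_fun do rewrite exprMn.
exact: (integrableZl measurableT (c ^+ 2) jf).
Qed.

Lemma norm2Z c f : f \in Lfun mu 2%:E -> norm2 mu (fun x => c * f x) = `|c| * norm2 mu f.
Proof.
move=> /[dup] /Lfun_measurable mf /(Lfun2_integrable mf) jf; rewrite !norm2E.
under eq_Rintegral do rewrite exprMn.
by rewrite RintegralZl// sqrtrM ?sqr_ge0// sqrtr_sqr.
Qed.

Lemma Lfun2D f g : f \in Lfun mu 2%:E -> g \in Lfun mu 2%:E ->
  (fun x => f x + g x) \in Lfun mu 2%:E.
Proof. by have [_] := @Lfun_addr_closed _ _ _ mu _ (@ge1_2 R); apply. Qed.

Lemma Lfun2B f g : f \in Lfun mu 2%:E -> g \in Lfun mu 2%:E ->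
  (fun x => f x - g x) \in Lfun mu 2%:E.
Proof. by move=> f2 g2; apply: Lfun2D => //; exact: Lfun_oppr_closed. Qed.

End norm2_theory.

Section density_L2.
Import HBSimple.
Context {R : realType} (d : nat) (p : 'rV[R]_d -> R).
Notation X := 'rV[R]_d.
Notation mu := (@leb_cube R d).
Hypothesis cp : continuous p.
Hypothesis p0 : {ae mu, forall x, p x != 0}.

(** Simple functions are finite combinations of indicators and are dense in L^1. *)
Lemma approximable_integrable (h : X -> R) :
  mu.-integrable setT (EFin \o h) -> approximable p h.
Proof.
move=> ih; apply: approximable_lim => // e e0.
have [g [ig _ /fine_cvgP[_ /cvgrPdist_lt/(_ e e0)[n _ /(_ n (leqnn _))]]]] :=
  approximation_sfun_integrable measurableT ih.
rewrite /= sub0r normrN => hn.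
exists (g n); last exact: le_lt_trans (ler_norm _) hn.
rewrite (_ : (g n : X -> R) = fun x : X =>
    \sum_(y <- finmap.enum_fset (fset_set (range ((g n : X -> R)))))
      y * \1_((g n : X -> R) @^-1` [set y]) x).
  by apply: approximable_sum => // y; apply: approximable_indic.
by apply/funext => x; rewrite fimfunE fsbig_finite.
Qed.

(** Truncating [p * b] must again give a multiple of [p]; here truncation becomes multiplication by
    a factor continuous in [t]. *)
Lemma mul_clip (M t : R) : 0 < M -> t * (M / Num.max M `|t|) = clip (- M) M t.
Proof.
move=> M0; have [tM|Mt] := leP `|t| M.
  rewrite divff ?gt_eqF// mulr1 clip_id//.
  by move: tM; rewrite ler_norml.
have t0 : 0 < `|t| by rewrite (lt_trans M0).
have [t1|t1] := leP 0 t.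
  move: Mt t0; rewrite ger0_norm// => Mt t0.
  rewrite clip_right; last by apply/andP; split; lra.
  by rewrite mulrCA divff ?mulr1// gt_eqF.
move: Mt t0; rewrite ltr0_norm// => Mt t0; rewrite clip_left; last lra.
by rewrite invrN mulrN mulrN mulrCA divff ?mulr1// lt_eqF.
Qed.

Lemma continuous_maxr_norm (M : R) (f : X -> R) : continuous f ->
  continuous (fun x => Num.max M `|f x|).
Proof.
move=> cf x; rewrite (_ : (fun x => _) = (fun t => Num.max M `|t|) \o f)//.
apply: continuous_comp; first exact: cf.
apply/cvgrPdist_lt => e e0; near=> y.
apply: (@le_lt_trans _ _ `|f x - y|).
  exact: le_trans (maxr_lip _ _ _) (ler_dist_dist _ _).
by near: y; apply/nbhs_ballP; exists e.
Unshelve. all: by end_near. Qed.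

(** Clipping [p * b] at the bound of [h] cannot increase the distance to [h]: it fixes [h] and is
    1-Lipschitz. *)
Lemma dense_bounded (M e : R) (h : X -> R) : 0 < M -> measurable_fun setT h ->
  (forall x, `|h x| <= M) -> 0 < e ->
  exists b, [/\ multiplier p b, forall x, `|p x * b x| <= M &
    \int[mu]_x `|h x - p x * b x| < e].
Proof.
move=> M0 mh hM e0; have ih := bounded_integrable mh hM.
have [_ /(_ _ e0)[b mb hb]] := approximable_integrable ih.
have [cb [B bB] [P pB]] := mb.
pose b' x := b x * (M / Num.max M `|p x * b x|).
have pbE x : p x * b' x = clip (- M) M (p x * b x) by rewrite mulrA mul_clip.
have MM : - M <= M by lra.
have pbM x : `|p x * b' x| <= M.
  by rewrite pbE ler_norml; exact: clip_bounds.
have mb' : multiplier p b'.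
  split; last by exists M.
    have cpb : continuous (fun x => p x * b x) by move=> x; exact: (cvgM (@cp x) (cb x)).
    move=> x; have d0 : Num.max M `|p x * b x| != 0 by rewrite gt_eqF// lt_max M0.
    have c1 := @continuous_maxr_norm M _ cpb x.
    exact: (cvgM (cb x) (cvgM (cvg_cst M) (cvgV d0 c1))).
  exists B => x; rewrite normrM; apply: le_trans (bB x).
  have m0 : 0 < Num.max M `|p x * b x| by rewrite lt_max M0.
  rewrite ler_piMr// ger0_norm; first by rewrite ler_pdivrMr// mul1r le_max lexx.
  by rewrite divr_ge0// ltW.
exists b'; split => //; apply: le_lt_trans hb.
have D v : multiplier p v -> mu.-integrable setT (EFin \o (fun x => `|h x - p x * v x|)).
  by move=> mv; exact: (integrable_abse (integrableB measurableT ih (integrable_pb cp mv))).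
apply: le_Rintegral => //; try exact: D.
move=> x _; rewrite pbE -{1}(@clip_id _ (- M) M (h x)); first exact: clip_lip.
by rewrite -ler_norml.
Qed.

(** L^1 density upgrades to L^2 between functions bounded by M, since their difference y satisfies
    y^2 <= 2 M |y|; hence [u] is truncated first. *)
Lemma dense_L2 (u : X -> R) (e : R) : u \in Lfun mu 2%:E -> 0 < e ->
  exists2 b, multiplier p b & norm2 mu (fun x => u x - p x * b x) < e.
Proof.
move=> uL e0; have mu_ := Lfun_measurable uL.
have iu2 := (Lfun2_integrable mu mu_).1 uL.
pose uM (n : nat) (x : X) := clip (- n%:R) n%:R (u x).
have muM n : measurable_fun setT (uM n).
  by apply: measurableT_comp mu_; apply: continuous_measurable_fun; exact: continuous_clip.
have e2 : 0 < e / 2 by rewrite divr_gt0.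
have NN n : - n%:R <= n%:R :> R by have : 0 <= n%:R :> R by []; lra.
have [||||n hn] := @dominated_small _ _ _ mu (fun n x => (u x - uM n x) ^+ 2)
  (fun x => u x ^+ 2) ((e / 2) ^+ 2) _ _ _ _ (exprn_gt0 2 e2).
- by move=> n; apply: measurable_funX; exact: measurable_funB.
- exact: iu2.
- move=> n x; rewrite ger0_norm ?sqr_ge0// -(real_normK (num_real (u x))).
  rewrite -(real_normK (num_real (_ - _))) lerXn2r ?nnegrE//.
  exact: clip_dist.
- apply: aeW => x; apply: cvg_near_cst; near=> n.
  rewrite /uM clip_id ?subrr ?expr0n//.
  by rewrite -ler_norml; near: n; exact: nbhs_infty_ger.
have uMn x : `|uM n x| <= n%:R by rewrite ler_norml; exact: clip_bounds.
have uML : uM n \in Lfun mu 2%:E.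
  apply/Lfun2_integrable => //; apply: (@bounded_integrable _ _ _ (n%:R ^+ 2)).
    exact: measurable_funX.
  by move=> x; rewrite normrX lerXn2r ?nnegrE.
(* [n.+1] keeps M positive when n = 0. *)
pose M : R := n.+1%:R; have M0 : 0 < M by [].
have d0 : 0 < (e / 2) ^+ 2 / (2 * M) by rewrite divr_gt0 ?exprn_gt0 ?mulr_gt0.
have uMM x : `|uM n x| <= M by rewrite (le_trans (uMn x))// ler_nat.
have [b [mb bM hb]] := dense_bounded M0 (muM n) uMM d0.
exists b => //.
have mpb := measurable_pb cp mb.
have pbL : (fun x => p x * b x) \in Lfun mu 2%:E.
  apply/Lfun2_integrable => //; apply: (@bounded_integrable _ _ _ (M ^+ 2)).
    exact: measurable_funX.
  by move=> x; rewrite normrX lerXn2r ?nnegrE// ltW.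
have lt2 (f : X -> R) : \int[mu]_x f x ^+ 2 < (e / 2) ^+ 2 -> norm2 mu f < e / 2.
  move=> h; rewrite norm2E -[ltRHS]ger0_norm ?ltW// -sqrtr_sqr ltr_sqrt//.
  by rewrite exprn_gt0.
apply: le_lt_trans (norm2_triangle uL uML pbL) _; rewrite [ltRHS]splitr ltrD//; apply: lt2.
  apply: le_lt_trans hn; rewrite le_eqVlt; apply/orP; left; apply/eqP.
  by apply: eq_Rintegral => x _; rewrite ger0_norm// sqr_ge0.
have iM : mu.-integrable setT (EFin \o (fun x => `|uM n x - p x * b x|)).
  exact: (integrable_abse (integrableB measurableT (bounded_integrable (muM n) uMM)
    (integrable_pb cp mb))).
apply: (@le_lt_trans _ _ (\int[mu]_x (2 * M * `|uM n x - p x * b x|))).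
  apply: le_Rintegral => //.
  - have := Lfun2B uML pbL => /Lfun2_integrable; apply.
    exact: measurable_funB.
  - exact: (integrableZl measurableT (2 * M) iM).
  move=> x _; rewrite -(real_normK (num_real (_ - _))) expr2 ler_wpM2r//.
  by rewrite (le_trans (ler_normB _ _))// mulr2n mulrDl mul1r lerD.
by rewrite RintegralZl// mulrC -ltr_pdivlMr// mulr_gt0.
Unshelve. all: by end_near. Qed.

End density_L2.

(** * The basis function of mode 0 *)

Section window.
Context {R : realType} (d : nat) (q : {poly R}).
Notation X := 'rV[R]_d.
Notation mu := (@leb_cube R d).

(* For [q] the basis function [phi_0] this is what [shen_inverse] makes of the mode 0;
   under general boundary conditions it is not constant and may vanish. *)
Definition window (x : X) : R := \prod_i q.[x ord0 i].

Lemma continuous_window : continuous window.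
Proof.
apply: continuous_big_prod => i x.
apply: (@continuous_comp _ _ _ (fun y : X => y ord0 i) (horner q)).
  exact: continuous_coord.
exact: continuous_horner.
Qed.

Lemma window_neq0 : q != 0 -> {ae mu, forall x, window x != 0}.
Proof.
move=> q0; apply: filterS (ae_roots d q0) => x h.
by apply/prodf_neq0 => i _; exact: h.
Qed.

Lemma horner_bound : exists2 B, 1 <= B & forall t, -1 <= t <= 1 -> `|q.[t]| <= B.
Proof.
exists (1 + \sum_(i < size q) `|q`_i|); first by rewrite lerDl sumr_ge0.
move=> t t1; rewrite horner_coef (le_trans (ler_norm_sum _ _ _))//.
rewrite ler_wpDl// ler_sum// => i _; rewrite normrM ler_piMr// normrX.
by rewrite exprn_ile1// ler_norml.
Qed.

Lemma window_bound : exists2 B, 1 <= B & forall x, cube x -> `|window x| <= B.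
Proof.
have [B B1 hB] := horner_bound; exists (B ^+ d); first exact: exprn_ege1.
move=> x cx; rewrite normr_prod -[X in B ^+ X]card_ord -prodr_const.
by apply: ler_prod => i _; rewrite normr_ge0 hB.
Qed.

Lemma bounded_mfun_window : bounded_mfun window.
Proof.
split; first by apply: continuous_measurable_rV; exact: continuous_window.
by have [B _ hB] := window_bound; exists B.
Qed.

(** For a scalar z, |window| * |z| has weighted integral |z| times this mass, which the following
    layer divides out. *)
Lemma wint_window_gt0 : q != 0 -> 0 < wint (fun x => `|window x|).
Proof.
move=> q0; have b := bounded_mfun_norm bounded_mfun_window.
rewrite lt_neqAle wint_ge0// andbT eq_sym; apply/eqP => /(wint_eq0 b) h.
have {}h : {ae mu, forall x, `|window x| = 0} by exact: h.
(* The window would both vanish and not vanish almost everywhere, although the cube has positive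
   measure. *)
have : {ae mu, forall x : X, False}.
  apply: filterS2 h (window_neq0 q0) => x /eqP; rewrite normr_eq0 => /eqP ->.
  by rewrite eqxx.
move=> [A [mA A0 TA]].
have /(lt_le_trans (leb_cube_setT_gt0 d)) : (mu setT <= mu A)%E.
  apply: le_measure; [by rewrite inE|by rewrite inE|by move=> x _; apply: TA].
by rewrite A0 ltxx.
Qed.

End window.

(** phi_0 = (1 - b) + a X + 2 b X^2: if the coefficient of X^2 is 0, then b = 0 and the constant
    term is 1. *)
Lemma shen_phi0_neq0 (R : realType) (ac bc : nat -> R) : shen_phi ac bc 0 != 0.
Proof.
rewrite /shen_phi /shen_poly /=; apply/eqP => h.
have := congr1 (fun p : {poly R} => p`_2) h; have := congr1 (fun p : {poly R} => p`_0) h.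
rewrite !(coefD, coefZ, coefB, coefN, coef1, coefX, coef0, coefMX, coefC)/=.
lra.
Qed.

(** * Features of the input and compactness *)

Section ae_equal_sobolev.
Context {R : realType} (d : nat).
Notation X := 'rV[R]_d.
Notation mu := (@leb_cube R d).

Lemma multi_partial_foldr (alpha : 'I_d -> nat) (f : X -> R) :
  exists s, multi_partial alpha f = foldr (@partial R d) f s.
Proof.
rewrite /multi_partial; elim: (enum 'I_d) => [|i r [s IH]]; first by exists [::].
exists (nseq (alpha i) i ++ s); rewrite /= IH foldr_cat.
by elim: (alpha i) => //= n ->.
Qed.

Lemma measurable_multi_partial (alpha : 'I_d -> nat) (phi : X -> R) :
  test_function phi -> measurable_fun setT (multi_partial alpha phi).
Proof.
move=> [sphi _]; have [s ->] := multi_partial_foldr alpha phi.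
by apply: continuous_measurable_rV; case: (sphi s).
Qed.

Lemma weak_derivative_ae (alpha : 'I_d -> nat) (u v g : X -> R) :
  measurable_fun setT u -> measurable_fun setT v -> {ae mu, forall x, u x = v x} ->
  weak_derivative alpha u g -> weak_derivative alpha v g.
Proof.
move=> mu_ mv uv ug phi tphi; rewrite -ug//; congr fine.
have mphi := measurable_multi_partial alpha tphi.
apply: ae_eq_integral => //; try by apply/measurable_EFinP; exact: measurable_funM.
by apply: filterS uv => x uvx _; rewrite /= uvx.
Qed.

(* The choice made by [weak_partial] only depends on the class of the function. *)
Lemma weak_partial_ae (alpha : 'I_d -> nat) (u v : L2fun d) : mdeg alpha != 0%N ->
  {ae mu, forall x, u x = v x} -> weak_partial alpha u = weak_partial alpha v.
Proof.
move=> a0 uv; rewrite /weak_partial (negbTE a0); congr xget.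
have mL (f : L2fun d) : measurable_fun setT f by apply: Lfun_measurable; exact: LfunP.
apply/seteqP; split => g; apply: weak_derivative_ae => //.
by apply: filterS uv => x ->.
Qed.

Lemma ae_prod (P : set X) : {ae mu, forall x, P x} ->
  {ae (mu \x mu)%E, forall q, P q.1 /\ P q.2}.
Proof.
move=> [N [mN N0 PN]]; exists ((N `*` setT) `|` (setT `*` N)); split.
- by apply: measurableU; exact: measurableX.
- apply/eqP; rewrite eq_le measure_ge0 andbT.
  apply: le_trans (measureU2 _ _ _) _; [exact: measurableX|exact: measurableX|].
  have h1 : (mu \x mu)%E (N `*` setT) = 0%E.
    by rewrite product_measure1E// [X in (X * _)%E]N0 mul0e.
  have h2 : (mu \x mu)%E (setT `*` N) = 0%E.
    by rewrite product_measure1E// [X in (_ * X)%E]N0 mule0.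
  by rewrite [X in (X + _)%E]h1 [X in (_ + X)%E]h2 adde0.
- move=> q /= /not_andP[h|h]; [left|right]; split => //; exact: PN.
Qed.

(** Above order 0 both functions receive the very same chosen weak derivative; at order 0 the
    functions, hence their Gagliardo quotients, agree almost everywhere. *)
Lemma sob_dist_ae (s : R) (u v : sobolev d s) :
  {ae mu, forall x, sob_fun u x = sob_fun v x} -> sob_dist u v = 0.
Proof.
move=> uv.
have wuv alpha : {ae mu, forall x, weak_partial alpha u x = weak_partial alpha v x}.
  have [a0|a0] := eqVneq (mdeg alpha) 0%N.
    by apply: filterS uv => x; rewrite /weak_partial a0 eqxx.
  by rewrite (weak_partial_ae a0 uv); exact: aeW.
rewrite /sob_dist !big1 ?addr0 ?sqrtr0// => alpha.
  move=> /andP[/eqP am t0]; rewrite gagliardoB.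
  rewrite (@norm2_ae_eq _ _ _ _ _ (cst 0)) ?norm2_0 ?expr0n//.
    by apply: measurable_funB; apply: Lfun_measurable; exact: sob_slob.
  apply: filterS (ae_prod (wuv (mi alpha))) => q [h1 h2].
  by rewrite /gagliardo /= h1 h2 subrr.
move=> _; rewrite (@norm2_ae_eq _ _ _ _ _ (cst 0)) ?norm2_0 ?expr0n//.
by apply: filterS (wuv (mi alpha)) => x h; rewrite /= h subrr.
Qed.

Lemma norm2_le_sob_dist (s : R) (u v : sobolev d s) : norm2 mu (sob_fun u \- sob_fun v) <= sob_dist u v.
Proof.
rewrite /sob_dist -[leLHS]ger0_norm ?norm2_ge0// -sqrtr_sqr ler_wsqrtr//.
pose al0 : {ffun 'I_d -> 'I_(sob_ord s).+1} := [ffun=> ord0].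
have m0 : mdeg (mi al0) = 0%N by rewrite /mdeg big1// => i _; rewrite /mi ffunE.
rewrite (bigD1 al0)/=; last by rewrite m0.
rewrite (_ : weak_partial (mi al0) u = sob_fun u); last by rewrite /weak_partial m0.
rewrite (_ : weak_partial (mi al0) v = sob_fun v); last by rewrite /weak_partial m0.
rewrite -addrA lerDl addr_ge0//.
  by apply: sumr_ge0 => i _; exact: sqr_ge0.
by apply: sumr_ge0 => i _; exact: sqr_ge0.
Qed.

End ae_equal_sobolev.

Section features.
Context {R : realType} (d da : nat).
Notation X := 'rV[R]_d.
Notation mu := (@leb_cube R d).

Definition feature (a : X -> 'cV[R]_da) (c : 'I_da * bool) (x : X) : R :=
  act ((-1) ^+ c.2 * a x c.1 ord0).

Definition feature_dist (a b : X -> 'cV[R]_da) : R :=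
  \sum_c wint (fun x => `|feature a c x - feature b c x|).

Lemma feature_bound a c x : `|feature a c x| <= 4.
Proof. exact: act_bound. Qed.

Lemma measurable_feature (a : X -> 'cV[R]_da) c :
  (forall j, measurable_fun setT (fun x => a x j ord0)) -> measurable_fun setT (feature a c).
Proof.
move=> ma; rewrite (_ : feature a c = act \o (fun x => (-1) ^+ c.2 * a x c.1 ord0))//.
apply: measurableT_comp; first by apply: continuous_measurable_fun; exact: continuous_act.
by apply: measurable_funM => //; exact: ma.
Qed.

Variable s : R.
Implicit Types a b : Hs d da s.

Lemma measurable_Hs_fun a j : measurable_fun setT (fun x => Hs_fun a x j ord0).
Proof.
rewrite (_ : (fun x => _) = sob_fun ((a : 'I_da -> sobolev d s) j)).
  by apply: Lfun_measurable; exact: LfunP.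
by apply/funext => x; rewrite mxE.
Qed.

Lemma bounded_feature a c : bounded_mfun (feature (Hs_fun a) c).
Proof.
split; first by apply: measurable_feature; exact: measurable_Hs_fun.
by exists 4 => x _; exact: feature_bound.
Qed.

(** Both signs of each component are encoded, so [act_inj] recovers it almost everywhere. Elements
    of [Hs] are functions, so distance 0 is the best possible conclusion. *)
Lemma Hsdist_eq0 a b : feature_dist (Hs_fun a) (Hs_fun b) = 0 -> Hsdist a b = 0.
Proof.
move=> ab0.
have bD c := bounded_mfun_norm (bounded_mfunB (bounded_feature a c) (bounded_feature b c)).
have w0 c : 0 <= wint (fun x => `|feature (Hs_fun a) c x - feature (Hs_fun b) c x|).
  by apply: wint_ge0; [exact: bD|].
have ae0 c : {ae mu, forall x, feature (Hs_fun a) c x = feature (Hs_fun b) c x}.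
  have : wint (fun x => `|feature (Hs_fun a) c x - feature (Hs_fun b) c x|) = 0.
    exact: (psumr_eq0P (fun c _ => w0 c) ab0).
  move=> /(wint_eq0 (bD c)) h.
  have {}h : {ae mu, forall x, `|feature (Hs_fun a) c x - feature (Hs_fun b) c x| = 0} by exact: h.
  by apply: filterS h => x /eqP; rewrite normr_eq0 subr_eq0 => /eqP.
rewrite /Hsdist big1 ?sqrtr0// => j _; rewrite sob_dist_ae ?expr0n//.
apply: filterS2 (ae0 (j, false)) (ae0 (j, true)) => x.
rewrite /feature /= expr0 expr1 !mul1r !mulN1r !mxE => h1 h2.
exact: act_inj.
Qed.

End features.

(** Near-covering compactness is applied to the filter of all sufficiently large lists: any list
    containing [x] serves the neighbourhood [U x]. *)
Lemma compact_finite_cover (T : topologicalType) (K : set T) (U : T -> set T) :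
  compact K -> (forall x, K x -> nbhs x (U x)) ->
  exists l : seq T, forall y, K y -> exists2 x, x \in l & U x y.
Proof.
move=> /compact_near_coveringP cK KU.
pose F : set_system (seq T) := [set S | exists l0 : seq T,
  forall l : seq T, {subset l0 <= l} -> S l].
have FF : Filter F.
  split; first by exists [::].
    move=> P Q [l1 h1] [l2 h2]; exists (l1 ++ l2) => l sl; split.
      by apply: h1 => x xl; apply: sl; rewrite mem_cat xl.
    by apply: h2 => x xl; apply: sl; rewrite mem_cat xl orbT.
  by move=> P Q PQ [l0 h]; exists l0 => l sl; exact/PQ/h.
have [|l0 h] := cK _ F (fun (l : seq T) y => exists2 x, x \in l & U x y) FF.
  move=> x Kx; exists (U x, [set l : seq T | x \in l]).
    split; first exact: KU.
    by exists [:: x] => l sl; apply: sl; rewrite inE.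
  by move=> [y l] /= [Uxy xl]; exists x.
by exists l0; exact: h.
Qed.

Section norm2_L1.
Context dd (T : measurableType dd) (R : realType) (mu : {finite_measure set T -> \bar R}).

Lemma Lfun2_integrable1 (f : T -> R) : f \in Lfun mu 2%:E -> mu.-integrable setT (EFin \o f).
Proof.
move=> fL; have mf := Lfun_measurable fL; have if2 := (Lfun2_integrable mu mf).1 fL.
have i1 : mu.-integrable setT (EFin \o (fun x => 1 + f x ^+ 2)).
  have ic : mu.-integrable setT (EFin \o cst 1) by exact: finite_measure_integrable_cst.
  exact: (integrableD measurableT ic if2).
apply: le_integrable i1 => //; first exact/measurable_EFinP.
move=> x _; rewrite lee_fin [leRHS]ger0_norm ?addr_ge0 ?sqr_ge0//.
rewrite -(real_normK (num_real (f x))).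
by have := sqr_ge0 (`|f x| - 2^-1); nra.
Qed.

(** From |f| <= a + f^2 / a with a proportional to e: the first term integrates to at most e / 2
    because the measure is finite, the second to less than e / 2 by the choice of radius. *)
Lemma norm2_small_L1 (e : R) : 0 < e -> exists2 r, 0 < r & forall f : T -> R,
  f \in Lfun mu 2%:E -> norm2 mu f < r -> \int[mu]_x `|f x| < e.
Proof.
move=> e0; pose m := fine (mu setT).
have m0 : 0 <= m by rewrite fine_ge0.
pose a := e / (2 * (m + 1)).
have a0 : 0 < a by rewrite divr_gt0// mulr_gt0// ltr_wpDl.
(* The minimum with 1 bounds the squared norm by the norm. *)
exists (Num.min 1 (a * e / 2)) => [|f fL].
  by rewrite lt_min ltr01 divr_gt0// mulr_gt0.
rewrite lt_min => /andP[f1 fr]; have mf := Lfun_measurable fL.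
have if2 := (Lfun2_integrable mu mf).1 fL.
have ia : mu.-integrable setT (EFin \o cst a) by exact: finite_measure_integrable_cst.
have if2' : mu.-integrable setT (EFin \o (fun x => a^-1 * f x ^+ 2)).
  exact: (integrableZl measurableT a^-1 if2).
have le x : `|f x| <= a + a^-1 * f x ^+ 2.
  rewrite -(real_normK (num_real (f x))); have := normr_ge0 (f x).
  have k0 : 0 < a^-1 by rewrite invr_gt0.
  have ak : a * a^-1 = 1 by rewrite divff// gt_eqF.
  have := mulr_ge0 (ltW k0) (sqr_ge0 (a - `|f x|)).
  rewrite (_ : _ * _ ^+ 2 = a * a^-1 * a - 2 * (a * a^-1) * `|f x| + a^-1 * `|f x| ^+ 2); last by ring.
  by rewrite ak; lra.
have i1 : mu.-integrable setT (EFin \o (fun x => a + a^-1 * f x ^+ 2)).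
  exact: (integrableD measurableT ia if2').
apply: (@le_lt_trans _ _ (\int[mu]_x (a + a^-1 * f x ^+ 2))).
  by apply: le_Rintegral => //; exact: (integrable_abse (Lfun2_integrable1 fL)).
rewrite RintegralD// [X in _ + X]RintegralZl// -norm2_sqr.
rewrite [X in X + _](_ : _ = a * m); last by rewrite -(Rintegral_cst mu measurableT a).
have am : a * m <= e / 2.
  rewrite /a -mulrA; apply: ler_wpM2l; first exact: ltW.
  by rewrite invfM -mulrA ler_piMr ?invr_ge0// ler_pdivrMl ?mulr1; lra.
have : norm2 mu f ^+ 2 < a * e / 2.
  by apply: le_lt_trans fr; rewrite expr2 ler_piMr ?norm2_ge0// ltW.
rewrite -mulrA -ltr_pdivrMl// => h; lra.
Qed.

End norm2_L1.

Section feature_topology.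
Context {R : realType} (d da : nat) (s : R).
Notation X := 'rV[R]_d.
Notation mu := (@leb_cube R d).
Implicit Types a b c : Hs d da s.
Local Notation fdist a b := (feature_dist (Hs_fun a) (Hs_fun b)).

Lemma bounded_feature_diff a b i :
  bounded_mfun (fun x => `|feature (Hs_fun a) i x - feature (Hs_fun b) i x|).
Proof. exact: bounded_mfun_norm (bounded_mfunB (bounded_feature a i) (bounded_feature b i)). Qed.

Lemma feature_dist_triangle b a c : fdist a c <= fdist a b + fdist b c.
Proof.
rewrite /feature_dist -big_split/=; apply: ler_sum => i _.
rewrite -wintD; try exact: bounded_feature_diff.
apply: le_wint; first exact: bounded_feature_diff.
  by apply: bounded_mfunD; exact: bounded_feature_diff.
by move=> x _; rewrite (le_trans _ (ler_normD _ _))// addrA subrK.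
Qed.

Lemma feature_dist_ge0 a b : 0 <= fdist a b.
Proof. by apply: sumr_ge0 => c _; apply: wint_ge0; first exact: bounded_feature_diff. Qed.

Lemma Hsdist_ge_norm2 a b (j : 'I_da) : norm2 mu
  (fun x : X => Hs_fun a x j ord0 - Hs_fun b x j ord0) <= Hsdist a b.
Proof.
rewrite (_ : (fun x => _) =
  sob_fun ((a : 'I_da -> sobolev d s) j) \- sob_fun ((b : 'I_da -> sobolev d s) j)); last first.
  by apply/funext => x; rewrite !mxE.
apply: le_trans (norm2_le_sob_dist _ _) _.
rewrite /Hsdist -[leLHS]ger0_norm ?sqrtr_ge0// -sqrtr_sqr ler_wsqrtr//.
by rewrite (bigD1 j)//= lerDl; apply: sumr_ge0 => i _; exact: sqr_ge0.
Qed.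

(** Features differ by at most 8, so [wint_le_L1] passes from the weighted to the plain L^1
    distance; the Lipschitz bound on [act] and the L^2 part of the Sobolev distance do the rest. *)
Lemma feature_dist_near a (e : R) : 0 < e -> \forall b \near a, fdist a b < e.
Proof.
(* One more than the number of features, so that the sum of the [e / N] is strictly below [e]. *)
move=> e0; pose N : R := #|{: 'I_da * bool}|%:R + 1.
have N0 : 0 < N by rewrite ltr_wpDl.
have e1 : 0 < e / N / 2 by rewrite !divr_gt0.
have [M M0 hM] := @wint_le_L1 R d 8 (e / N / 2) ltac:(done) e1.
(* M comes from the level of the weight, 6 is the Lipschitz constant of [act]. *)
have e2 : 0 < e / N / 2 / M / 6 by rewrite !divr_gt0.
have [r r0 hr] := @norm2_small_L1 _ _ _ mu _ e2.
apply/nbhs_ballP; exists r => // b /= abr.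
have ch i : wint (fun x => `|feature (Hs_fun a) i x - feature (Hs_fun b) i x|) <= e / N.
  apply: le_trans (hM _ _ _) _.
  - by apply: measurable_funB; apply: measurable_feature; exact: measurable_Hs_fun.
  - move=> x; apply: le_trans (ler_normB _ _) _.
    by rewrite (_ : 8 = 4 + 4) ?lerD ?feature_bound//; ring.
  rewrite [leRHS]splitr lerD2r mulrC -ler_pdivlMr//.
  have L2 (u : Hs d da s) : (fun x => Hs_fun u x i.1 ord0) \in Lfun mu 2%:E.
    rewrite (_ : (fun x => _) = sob_fun ((u : 'I_da -> sobolev d s) i.1)); first exact: LfunP.
    by apply/funext => x; rewrite mxE.
  pose f x := Hs_fun a x i.1 ord0 - Hs_fun b x i.1 ord0.
  have fL : f \in Lfun mu 2%:E by exact: Lfun2B.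
  have fr : norm2 mu f < r by apply: le_lt_trans (Hsdist_ge_norm2 _ _ _) abr.
  have if_ : mu.-integrable setT (EFin \o (fun x => `|f x|)).
    exact: (integrable_abse (Lfun2_integrable1 fL)).
  have iD : mu.-integrable setT (EFin \o (fun x => 6 * `|f x|)).
    exact: (integrableZl measurableT 6 if_).
  have le x : `|feature (Hs_fun a) i x - feature (Hs_fun b) i x| <= 6 * `|f x|.
    apply: le_trans (act_lip _ _) _; rewrite -mulrBr normrM normrX normrN normr1 expr1n mul1r.
    exact: lexx.
  apply: (@le_trans _ _ (\int[mu]_x (6 * `|f x|))).
    apply: le_Rintegral => //; apply: le_integrable iD => //.
      apply/measurable_EFinP; apply: measurableT_comp => //.
      by apply: measurable_funB; apply: measurable_feature; exact: measurable_Hs_fun.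
    by move=> x _; rewrite lee_fin normr_id (le_trans (le x))// ler_norm.
  by rewrite RintegralZl// mulrC -ler_pdivlMr// ltW// hr.
apply: (@le_lt_trans _ _ (\sum_(c : 'I_da * bool) e / N)); first exact: ler_sum.
by rewrite sumr_const -mulr_natr mulrAC ltr_pdivrMr// ltr_pM2l// ltrDl.
Qed.

Variables (du : nat) (G : Hs d da s -> @L2 R d du).
Hypothesis cG : continuous G.

Lemma continuous_near a (e : R) : 0 < e -> \forall b \near a, L2dist (G a) (G b) < e.
Proof.
move=> e0; apply: (@cG a [set u | L2dist (G a) u < e]).
by apply/nbhs_ballP; exists e.
Qed.

(** [Hs] is only pseudometric, so [a] and [b] may differ; continuity forces [G] to respect the
    identification. *)
Lemma L2dist_eq0 a b : Hsdist a b = 0 -> L2dist (G a) (G b) = 0.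
Proof.
move=> ab0; apply/eqP; rewrite eq_le sqrtr_ge0 andbT; apply/ler_addgt0Pl => e e0.
have /nbhs_ballP[r r0 h] := continuous_near a e0.
by rewrite addr0; apply/ltW/h; rewrite /= pdist_ballE /= ab0.
Qed.

(* Points at feature distance 0 are at Sobolev distance 0, so a cluster point of a
   violating sequence in [K] would be identified with [a]. *)
Lemma feature_separation (K : set (Hs d da s)) a (e : R) : compact K -> 0 < e ->
  exists2 r, 0 < r & forall b, K b -> fdist a b < r -> L2dist (G a) (G b) < e.
Proof.
move=> /compact_near_coveringP cK e0.
(* The radius runs along the filter of positive reals tending to 0; near covering yields one radius
   for all of K. *)
have := cK _ (0 : R)^'+ (fun r b => fdist a b < r -> L2dist (G a) (G b) < e) _ _.
case.
  move=> b Kb; have [ab0|ab0] := eqVneq (fdist a b) 0.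
    exists ([set b' | L2dist (G b) (G b') < e], setT).
      by split; [exact: continuous_near|exact: filterT].
    move=> [b' r] /= [h _] _; apply: le_lt_trans (pdist_triangle (@L2pdist R d du) (G b) _ _) _.
    by rewrite [X in X + _]L2dist_eq0 ?add0r//; exact: Hsdist_eq0.
  (* Here the premise fails near [b] once the radius is below half the distance, by the triangle
     inequality. *)
  have r0 : 0 < fdist a b / 2 by rewrite divr_gt0// lt_def ab0 feature_dist_ge0.
  exists ([set b' | fdist b b' < fdist a b / 2], [set r | r < fdist a b / 2]).
    by split; [exact: feature_dist_near|exact: nbhs_right_lt].
  move=> [b' r] /= [h1 h2] h3; exfalso.
  have := feature_dist_triangle b' a b; rewrite (_ : fdist b' b = fdist b b'); last first.
    apply: eq_bigr => i _; apply: eq_wint => x _; exact: distrC.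
  by move: h1 h2 h3; lra.
move=> r0 /= r0_gt0 h; exists (r0 / 2); first by rewrite divr_gt0.
apply: (h (r0 / 2)); last by rewrite divr_gt0.
by rewrite /= sub0r normrN ger0_norm; lra.
Qed.

End feature_topology.

(** * A finite net of continuous targets *)

Section finite_net.
Context {R : realType} (d da : nat) (s : R).
Notation X := 'rV[R]_d.
Notation mu := (@leb_cube R d).
Local Notation fdist a b := (feature_dist (Hs_fun a) (Hs_fun b)).

Definition target_dist (t : 'I_da * bool -> X -> R) (a : X -> 'cV[R]_da) : R :=
  \sum_c wint (fun x => `|feature a c x - t c x|).

(** Continuity allows [t] to be a bias; the bound 4, that of the features, keeps one eighth of a
    difference within [-1, 1]. *)
Definition target (t : X -> R) := continuous t /\ forall x, `|t x| <= 4.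

Lemma target_approx (h : X -> R) (e : R) : measurable_fun setT h ->
  (forall x, `|h x| <= 4) -> 0 < e ->
  exists2 t, target t & wint (fun x => `|h x - t x|) <= e.
Proof.
move=> mh h4 e0; have e2 : 0 < e / 2 by rewrite divr_gt0.
have [M M0 hM] := @wint_le_L1 R d 8 (e / 2) ltac:(done) e2.
have e3 : 0 < e / 2 / M by rewrite divr_gt0.
have c1 : continuous (cst 1 : X -> R) by exact: cst_continuous.
have n1 : {ae mu, forall x, (cst 1 : X -> R) x != 0} by apply: aeW => x; exact: oner_neq0.
have [//|b [[cb _ _] b4 hb]] := @dense_bounded R d _ c1 n1 4 _ h _ mh h4 e3.
have mb := continuous_measurable_rV cb.
have {}b4 x : `|b x| <= 4 by have := b4 x; rewrite /= mul1r.
exists b => //.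
apply: le_trans (hM _ _ _) _; first exact: measurable_funB.
  move=> x; apply: le_trans (ler_normB _ _) _.
  by have := h4 x; have := b4 x; lra.
rewrite [leRHS]splitr lerD2r mulrC -ler_pdivlMr// ltW//.
by move: hb; under eq_Rintegral do rewrite /= mul1r.
Qed.

Variables (du : nat) (G : Hs d da s -> @L2 R d du) (K : set (Hs d da s)).
Hypothesis cG : continuous G.
Hypothesis cK : compact K.

(** [G] varies by less than e at feature distance 4 r, and the targets lie within r of the centre's
    features. So target distance below 3 r means feature distance below 4 r, and a cover by feature
    balls of radius r gives target distance below 2 r. *)
Lemma finite_net (e : R) : 0 < e -> exists n (t : 'I_n -> 'I_da * bool -> X -> R)
    (r : 'I_n -> R) (u : 'I_n -> @L2 R d du),
  [/\ forall i c, target (t i c), forall i, 0 < r i,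
      forall i b, K b -> target_dist (t i) (Hs_fun b) < 3 * r i -> L2dist (u i) (G b) < e &
      forall b, K b -> exists i, target_dist (t i) (Hs_fun b) < 2 * r i].
Proof.
move=> e0; pose N : R := #|{: 'I_da * bool}|%:R + 1.
have N0 : 0 < N by rewrite ltr_wpDl.
have /choice[r hr] : forall a : Hs d da s, exists r, 0 < r /\
    forall b, K b -> fdist a b < 4 * r -> L2dist (G a) (G b) < e.
  move=> a; have [r r0 h] := @feature_separation _ _ _ _ _ G cG K a _ cK e0.
  exists (r / 4); split; first by rewrite divr_gt0.
  by move=> b Kb; rewrite mulrCA divff// mulr1; exact: h.
have r0 a : 0 < r a by case: (hr a).
have /choice[t ht] : forall a : Hs d da s, exists t : 'I_da * bool -> X -> R,
    (forall c, target (t c)) /\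
    \sum_c wint (fun x => `|feature (Hs_fun a) c x - t c x|) < r a.
  move=> a; have rN : 0 < r a / N by rewrite divr_gt0.
  have /choice[t ht] : forall c, exists t, target t /\
      wint (fun x => `|feature (Hs_fun a) c x - t x|) <= r a / N.
    move=> c; have [|x|t tt h] := @target_approx (feature (Hs_fun a) c) _ _ _ rN.
    - by apply: measurable_feature; exact: measurable_Hs_fun.
    - exact: feature_bound.
    by exists t.
  exists t; split => [c|]; first by case: (ht c).
  apply: (@le_lt_trans _ _ (\sum_(c : 'I_da * bool) r a / N)).
    by apply: ler_sum => c _; case: (ht c).
  by rewrite sumr_const -mulr_natr mulrAC ltr_pdivrMr// ltr_pM2l// ltrDl.
have bt a c : bounded_mfun (t a c).
  have [ct t4] := (ht a).1 c.
  by split; [exact: continuous_measurable_rV|exists 4 => x _; exact: t4].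
have bd (a b : Hs d da s) c : bounded_mfun (fun x => `|feature (Hs_fun b) c x - t a c x|).
  exact: bounded_mfun_norm (bounded_mfunB (bounded_feature b c) (bt a c)).
have near (a b : Hs d da s) : fdist a b < target_dist (t a) (Hs_fun b) + r a.
  have := (ht a).2; rewrite -(ltrD2l (target_dist (t a) (Hs_fun b))); apply: le_lt_trans.
  rewrite -big_split/=; apply: ler_sum => c _.
  rewrite -(wintD (bd a b c) (bd a a c)).
  apply: (le_wint (bounded_feature_diff a b c) (bounded_mfunD (bd a b c) (bd a a c))).
  move=> x _; rewrite /= -(subrKA (t a c x)) (le_trans (ler_normD _ _))//.
  by rewrite addrC (distrC (t a c x)).
have far (a b : Hs d da s) : target_dist (t a) (Hs_fun b) < fdist a b + r a.
  have := (ht a).2; rewrite -(ltrD2l (fdist a b)); apply: le_lt_trans.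
  rewrite -big_split/=; apply: ler_sum => c _.
  rewrite -(wintD (bounded_feature_diff a b c) (bd a a c)).
  apply: (le_wint (bd a b c) (bounded_mfunD (bounded_feature_diff a b c) (bd a a c))).
  move=> x _; rewrite /= -(subrKA (feature (Hs_fun a) c x)) (le_trans (ler_normD _ _))//.
  by rewrite (distrC (feature (Hs_fun b) c x)).
have [l hl] := compact_finite_cover cK (fun a _ => feature_dist_near a (r0 a)).
pose a (i : 'I_(size l)) := tnth (in_tuple l) i.
exists (size l), (t \o a), (r \o a), (G \o a); split => /=.
- by move=> i c; case: (ht (a i)).
- by move=> i; exact: r0.
- by move=> i b Kb h; apply: (hr (a i)).2 => //; have := near (a i) b; lra.
- move=> b /hl[c cl cb]; have /tnthP[i ci] : c \in in_tuple l by [].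
  by exists i; rewrite /a -ci; have := far c b; lra.
Qed.

End finite_net.

(** * Layers with labelled channels *)

Section linear_forms.
Context {R : realType} (J : finType).
Implicit Types l : (J -> R) -> R.

Definition linform l : Prop := exists c : J -> R, forall g, l g = \sum_k c k * g k.

Lemma linform0 : linform (fun=> 0).
Proof. by exists (fun=> 0) => g; rewrite big1// => k _; rewrite mul0r. Qed.

Lemma linform_proj j : linform (fun g => g j).
Proof.
exists (fun k => (k == j)%:R) => g; rewrite (bigD1 j)//= eqxx mul1r big1 ?addr0//.
by move=> k /negbTE ->; rewrite mul0r.
Qed.

Lemma linformD l l' : linform l -> linform l' -> linform (fun g => l g + l' g).
Proof.
move=> [c hc] [c' hc']; exists (fun k => c k + c' k) => g.
by rewrite hc hc' -big_split/=; apply: eq_bigr => k _; rewrite mulrDl.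
Qed.

Lemma linformZ a l : linform l -> linform (fun g => a * l g).
Proof.
move=> [c hc]; exists (fun k => a * c k) => g.
by rewrite hc mulr_sumr; apply: eq_bigr => k _; rewrite mulrA.
Qed.

Lemma linform_sum (I : finType) (P : pred I) (F : I -> (J -> R) -> R) :
  (forall i, linform (F i)) -> linform (fun g => \sum_(i | P i) F i g).
Proof.
move=> /choice[c hc]; exists (fun k => \sum_(i | P i) c i k) => g.
rewrite (eq_bigr _ (fun i _ => hc i g)) exchange_big/=; apply: eq_bigr => k _.
by rewrite mulr_suml.
Qed.

End linear_forms.

Section channels.
Context {R : realType} (ac bc : nat -> R) (d : nat) (J : finType).
Notation X := 'rV[R]_d.
Notation mu := (@leb_cube R d).
Implicit Types f : J -> X -> R.
Let p : X -> R := window (shen_phi ac bc 0).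

(** The [+ 0] is the width of an absent kernel part in the lifting layer, as the type of [opno]
    demands. *)
Definition width := (#|J| + 0)%N.
Definition chan (r : 'I_width) : J := enum_val (cast_ord (addn0 _) r).
Definition slot (j : J) : 'I_width := cast_ord (esym (addn0 _)) (enum_rank j).

Lemma slotK : cancel slot chan.
Proof. by move=> j; rewrite /chan /slot cast_ordKV enum_rankK. Qed.

Lemma chanK : cancel chan slot.
Proof. by move=> r; rewrite /chan /slot enum_valK cast_ordK. Qed.

Lemma sum_chan (F : J -> R) : \sum_(r < width) F (chan r) = \sum_j F j.
Proof. by rewrite (reindex slot)/=; [under eq_bigr do rewrite slotK|exists chan => ? _; rewrite ?slotK ?chanK]. Qed.

Definition signal f (x : X) : 'cV[R]_width := \col_r f (chan r) x.

Lemma continuous_signal (b : J -> X -> R) : (forall j, continuous (b j)) ->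
  continuous (signal b).
Proof.
move=> cb x A /nbhs_ballP[e e0 eA].
have H (r : 'I_width) : nbhs (x : X) [set y : X | `|b (chan r) x - b (chan r) y| < e].
  by move/cvgrPdist_lt: (cb (chan r) x); apply.
have := @filter_forall X 'I_width (fun r => [set y : X | `|b (chan r) x - b (chan r) y| < e])
  (nbhs (x : X)) (nbhs_filter (x : X)) H.
by apply: filterS => y h; apply: eA; split => // i j; rewrite !mxE; exact: h.
Qed.

Lemma ffun_ord1 (l : {ffun 'I_d -> 'I_1}) : l = [ffun=> ord0].
Proof. by apply/ffunP => i; rewrite ffunE ord1. Qed.

Lemma cheb_transform0 n (v : X -> 'cV[R]_n) (l : {ffun 'I_d -> 'I_1}) r :
  cheb_transform v (mi l) r ord0 =
  (\prod_(i < d) (2 / (pi * 2))) * wint (fun x => v x r ord0).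
Proof.
rewrite /cheb_transform !mxE; congr (_ * _).
  by apply: eq_bigr => i _; rewrite /mi ord1.
apply: eq_Rintegral => x _; rewrite /chebT_multi big1 ?mulr1// => i _.
by rewrite /mi ord1 hornerC.
Qed.

Lemma shen_phi_multi0 (l : {ffun 'I_d -> 'I_1}) : shen_phi_multi ac bc (mi l) = p.
Proof. by apply/funext => x; apply: eq_bigr => i _; rewrite /mi ord1. Qed.

(** The scalar cancels the normalisation of the mode-0 Chebyshev coefficient, so that [C] acts on
    plain weighted integrals. *)
Definition mode0_kernel m n (C : 'M[R]_(n, m)) : @Defs.kernel R d m n.
Proof.
exists 1%N 0%N (fun _ _ => (\prod_(i < d) (2 / (pi * 2)))^-1 *: C).
by move=> i j [q]; rewrite !ord1 addn0 ltnn => -[].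
Defined.

Lemma mode0_kernelE m n (C : 'M[R]_(n, m)) (v : X -> 'cV[R]_m) x :
  kernel_apply ac bc (mode0_kernel C) v x =
  p x *: (C *m \col_r wint (fun x => v x r ord0)).
Proof.
rewrite /kernel_apply /shen_inverse /= (big_pred1 [ffun=> ord0]) => [|l]; last first.
  by rewrite /= (ffun_ord1 l) eqxx.
rewrite shen_phi_multi0 (big_pred1 [ffun=> ord0]) => [|l]; last first.
  by rewrite /= (ffun_ord1 l) eqxx.
congr (_ *: _); rewrite -scalemxAl (_ : cheb_transform _ _ =
  (\prod_(i < d) (2 / (pi * 2))) *: \col_r wint (fun x => v x r ord0)).
  rewrite -scalemxAr scalerA mulVf ?scale1r//.
  apply/prodf_neq0 => i _; rewrite mulf_neq0// invr_neq0// mulf_neq0//.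
  by rewrite gt_eqF// pi_gt0.
by apply/colP => r; rewrite cheb_transform0 !mxE.
Qed.

Definition layer_map (LW LA : J -> (J -> R) -> R) (b : J -> X -> R) f (j : J) (x : X) : R :=
  f j x + act (LW j (f^~ x) + b j x + p x * LA j (fun k => wint (f k))).

Lemma bounded_layer_map (LW LA : J -> (J -> R) -> R) (b : J -> X -> R) f :
  (forall j, linform (LW j)) -> (forall j, continuous (b j)) ->
  (forall j, bounded_mfun (f j)) -> forall j, bounded_mfun (layer_map LW LA b f j).
Proof.
move=> hW cb bf j; apply: bounded_mfunD => //.
apply: (@bounded_mfun_comp R d act); first exact: continuous_act.
  by exists 4 => t; exact: act_bound.
have [c hc] := hW j; apply: measurable_funD; first apply: measurable_funD.
- under eq_fun do rewrite hc; apply: measurable_sum => k.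
  by apply: measurable_funM => //; case: (bf k).
- exact: continuous_measurable_rV.
- by apply: measurable_funM => //; case: (bounded_mfun_window d (shen_phi ac bc 0)).
Qed.

Lemma layer_exists (LW LA : J -> (J -> R) -> R) (b : J -> X -> R) :
  (forall j, linform (LW j)) -> (forall j, linform (LA j)) -> (forall j, continuous (b j)) ->
  exists l : layer d width, forall f,
    layer_apply ac bc act l (signal f) = signal (layer_map LW LA b f).
Proof.
move=> /choice[cW hW] /choice[cA hA] cb.
have cwb : {within @cube R d, continuous (signal b)}.
  exact/continuous_subspaceT/continuous_signal.
exists (@Layer R d width (\matrix_(r, q) cW (chan r) (chan q)) (signal b)
  (mode0_kernel (\matrix_(r, q) cA (chan r) (chan q))) cwb) => f.
apply/funext => x; apply/colP => r.
rewrite /layer_apply mode0_kernelE [LHS]mxE [RHS]mxE; congr (_ + _); first by rewrite mxE.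
rewrite mxE; congr act; rewrite [LHS]mxE; congr (_ + _).
  rewrite [LHS]mxE; congr (_ + _); last by rewrite mxE.
  by rewrite mxE hW -sum_chan; apply: eq_bigr => q _; rewrite !mxE.
rewrite [LHS]mxE; congr (_ * _).
rewrite mxE hA -sum_chan; apply: eq_bigr => q _; rewrite !mxE; congr (_ * _).
by congr wint; apply/funext => y; rewrite mxE.
Qed.

(** One hidden layer with weights 1 or -1 selects the signed components; the remaining channels have
    argument 2, hence value 0. *)
Lemma lift_exists da (sel : J -> option ('I_da * bool)) : exists N : @net R (da + d) #|J|,
  forall (a : X -> 'cV[R]_da) (K : @Defs.kernel R d da 0) x,
  col_mx (net_eval act N (col_mx (a x) x^T)) (kernel_apply ac bc K a x) =
  signal (fun j x => if sel j is Some c then feature a c x else 0) x.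
Proof.
pose W : 'M[R]_(#|J|, da + d) := \matrix_(r, q)
  if sel (enum_val r) is Some c then (-1) ^+ c.2 * (q == lshift d c.1)%:R else 0.
pose b : 'cV[R]_#|J| := \col_r if sel (enum_val r) is Some c then 0 else 2.
exists (net_hidden W b (net_affine 1%:M 0)) => a K x; apply/colP => r.
rewrite [RHS]mxE -{1}(chanK r) (_ : slot (chan r) = lshift 0 (enum_rank (chan r))); last first.
  exact: val_inj.
rewrite col_mxEu /= mul1mx addr0 [LHS]mxE [in LHS]mxE [X in act (_ + X)]mxE.
rewrite [X in act (X + _)]mxE enum_rankK; case E: (sel _) => [c|]; last first.
  by rewrite big1 ?add0r ?act2// => q _; rewrite mxE enum_rankK E mul0r.
rewrite addr0 /feature; congr act; rewrite (bigD1 (lshift d c.1))//= big1 => [|q qc].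
  by rewrite addr0 mxE enum_rankK E eqxx mulr1 col_mxEu.
by rewrite mxE enum_rankK E (negbTE qc) mulr0 mul0r.
Qed.

Lemma readout_exists du (LF : 'I_du -> (J -> R) -> R) : (forall m, linform (LF m)) ->
  exists N : @net R width du, forall f x m,
  net_eval act N (signal f x) m ord0 = LF m (f^~ x).
Proof.
move=> /choice[c hc].
exists (net_affine (\matrix_(m, q) c m (chan q)) 0) => f x m.
rewrite /= !mxE addr0 hc -sum_chan; apply: eq_bigr => q _.
by rewrite !mxE.
Qed.

End channels.

(** * The partition of unity and its network *)

Section partition_of_unity.
Context {R : realType} (n : nat) (r D : 'I_n -> R).

Definition chi (i : 'I_n) : R := (3 * r i - D i + `|3 * r i - D i|) / (2 * r i).

(** The flag says whether the term [i] is included, so that both partial sums around [i] are indexed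
    by [i], like the channels that compute them. *)
Definition chi_sum (i : 'I_n) (b : bool) : R :=
  \sum_(k < n | (k < i)%N || b && (k == i)) chi k.

(* With s' <= s'' the two values of [chi_sum i] this is min(1, s'') - min(1, s'). *)
Definition pou (i : 'I_n) : R :=
  (chi i - `|1 - chi_sum i true| + `|1 - chi_sum i false|) / 2.

Hypothesis r0 : forall i, 0 < r i.
Hypothesis D0 : forall i, 0 <= D i.

Lemma chi_ge0 i : 0 <= chi i.
Proof.
rewrite /chi divr_ge0//; last by rewrite mulr_ge0// ltW.
have := ler_norm (- (3 * r i - D i)); rewrite normrN; lra.
Qed.

(** Through [chi_sum_bounds] this fixes the scale of the third layer. *)
Lemma chi_le3 i : chi i <= 3.
Proof.
rewrite /chi ler_pdivrMr ?mulr_gt0//; have := D0 i; have := r0 i.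
by case: (leP 0 (3 * r i - D i)) => h; rewrite ?(ger0_norm h) ?(ltr0_norm h); lra.
Qed.

Lemma chi_eq0 i : 3 * r i <= D i -> chi i = 0.
Proof. by move=> h; rewrite /chi ler0_norm; [rewrite subrr mul0r|lra]. Qed.

Lemma chi_ge1 i : D i <= 2 * r i -> 1 <= chi i.
Proof.
have ri := r0 i; move=> h; rewrite /chi ger0_norm; last lra.
by rewrite ler_pdivlMr ?mulr_gt0//; lra.
Qed.

Lemma chi_sum_true i : chi_sum i true = chi_sum i false + chi i.
Proof.
rewrite /chi_sum (bigD1 i)/=; last by rewrite eqxx orbT.
rewrite addrC; congr (_ + _); apply: eq_bigl => k; rewrite orbF.
by case: eqP => [->|_]; rewrite ?ltnn ?orbF ?andbT.
Qed.

Lemma chi_sum_bounds i b : 0 <= chi_sum i b <= 3 * n%:R.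
Proof.
apply/andP; split; first by apply: sumr_ge0 => k _; exact: chi_ge0.
apply: (@le_trans _ _ (\sum_(k < n) 3)).
  rewrite /chi_sum [leLHS]big_mkcond; apply: ler_sum => k _.
  by case: ifP => _ //; exact: chi_le3.
by rewrite sumr_const card_ord mulr_natr.
Qed.

Lemma pou_bounds i : 0 <= pou i <= 1.
Proof.
rewrite /pou chi_sum_true; have := chi_ge0 i; have /andP[+ _] := chi_sum_bounds i false.
move: (chi_sum i false) (chi i) => s c s0 c0.
by have [h|h] := leP 0 (1 - (s + c)); have [h'|h'] := leP 0 (1 - s);
  rewrite ?(ger0_norm h) ?(ltr0_norm h) ?(ger0_norm h') ?(ltr0_norm h'); apply/andP; split; lra.
Qed.

Lemma pou_eq0 i : 3 * r i <= D i -> pou i = 0.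
Proof.
by move=> /chi_eq0 c0; rewrite /pou chi_sum_true c0 addr0 sub0r addNr mul0r.
Qed.

(** With g(s) = (s - |1 - s|) / 2 = min(1, s) - 1/2 the sum telescopes from g(0) = -1/2 to the value
    1/2 that g takes beyond 1. *)
Lemma pou_sum : (exists i, D i <= 2 * r i) -> \sum_i pou i = 1.
Proof.
move=> [i0 hi0].
pose S m := \sum_(k < n | (k < m)%N) chi k.
pose g (s : R) := (s - `|1 - s|) / 2.
have pg i : pou i = g (S i.+1) - g (S i).
  have -> : S i.+1 = chi_sum i true.
    by apply: eq_bigl => k; rewrite ltnS leq_eqVlt orbC.
  have -> : S i = chi_sum i false by apply: eq_bigl => k; rewrite orbF.
  by rewrite /pou /g chi_sum_true; field.
rewrite (eq_bigr _ (fun i _ => pg i)) -(big_mkord xpredT (fun i => g (S i.+1) - g (S i))).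
rewrite telescope_sumr//.
have -> : S 0%N = 0 by rewrite /S big_pred0.
have S1 : 1 <= S n.
  rewrite /S (bigD1 i0)//= ler_wpDr ?chi_ge1//.
  by apply: sumr_ge0 => k _; exact: chi_ge0.
by rewrite /g subr0 normr1 ler0_norm; [field|lra].
Qed.

End partition_of_unity.

Lemma bounded_mfun_Lfun (R : realType) (d : nat) (h : 'rV[R]_d -> R) :
  bounded_mfun h -> h \in Lfun (@leb_cube R d) 2%:E.
Proof.
move=> bh; have [mh _] := bh; have [C [C0 hC]] := bounded_mfun_pos bh.
have mh2 : measurable_fun setT (fun x => h x ^+ 2) by exact: measurable_funX.
apply/Lfun2_integrable => //; apply/integrableP; split; first exact/measurable_EFinP.
apply: (@le_lt_trans _ _ (\int[@leb_cube R d]_x (C ^+ 2)%:E)%E).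
  apply: ae_ge0_le_integral => //.
  - by apply: measurableT_comp => //; exact/measurable_EFinP.
  - by move=> x _; rewrite lee_fin sqr_ge0.
  - apply: filterS (@ae_cube R d) => x cx _.
    by rewrite /= lee_fin normrX lerXn2r ?nnegrE ?hC// ltW.
rewrite integral_cst// lte_mul_pinfty ?lee_fin ?sqr_ge0//.
by rewrite -ge0_fin_numE// fin_num_measure.
Qed.

(** * Weights, biases and states of the four layers *)

Section synthesis.
Context {R : realType} (ac bc : nat -> R) (d da du n : nat).
Notation X := 'rV[R]_d.
Notation mu := (@leb_cube R d).
Local Notation p := (@window R d (shen_phi ac bc 0)).
Variables (t : 'I_n -> 'I_da * bool -> X -> R) (r : 'I_n -> R) (w : 'I_n -> 'I_du -> X -> R).
Hypothesis tt : forall i c, target (t i c).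
Hypothesis r0 : forall i, 0 < r i.
Hypothesis cw : forall i m, continuous (w i m).
Variables (Bp Bw : R).
Hypothesis Bp1 : 1 <= Bp.
Hypothesis pB : forall x : X, cube x -> `|p x| <= Bp.
Hypothesis Bw1 : 1 <= Bw.
Hypothesis wB : forall i m x, `|w i m x| <= Bw.

(* [chA] carries the features, [chB] their pointwise distances to the targets, [chC]
   the functions |window * (3 r_i - D_i)|, [chE] the functions |window * (1 - s)| for
   the partial sums s = [chi_sum], and [chF] the four terms of [act_mul]. *)
Definition channel : finType :=
  ('I_da * bool + ('I_n * ('I_da * bool) + ('I_n + ('I_n * bool + 'I_n * 'I_du * (bool * bool)))))%type.

Local Notation chA c := (inl c : channel).
Local Notation chB i c := (inr (inl (i, c)) : channel).
Local Notation chC i := (inr (inr (inl i)) : channel).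
Local Notation chE i b := (inr (inr (inr (inl (i, b)))) : channel).
Local Notation chF i m e := (inr (inr (inr (inr (i, m, e)))) : channel).

(* The scales keep the arguments of [act] within 1 of 2 (resp. of 5), where it is
   the absolute value (resp. quadratic). *)
Definition window_mass : R := wint (fun x : X => `|p x|).
(** Bounds every |3 r_i - D_i|; the 8 is 4 + 4, for a feature minus a target. *)
Definition slack_sup : R := 1 + \sum_i 3 * r i + \sum_(c : 'I_da * bool) 8 * wint (cst 1 : X -> R).
Definition scale2 : R := (Bp * slack_sup)^-1.
Definition scale3 : R := (Bp * (1 + 3 * n%:R))^-1.
Definition scale4 : R := (2 * Bp)^-1.
Definition scale4w : R := (2 * Bw)^-1.

(* [chi k] is 3 / 2 plus this form of the integrals of the channels; likewise [pou i]
   is 3 / 4 plus [lin_pou i]. *)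
Definition lin_chi (k : 'I_n) (g : channel -> R) : R :=
  (2 * r k)^-1 * ((scale2 * window_mass)^-1 * g (chC k) + - 8 * \sum_c g (chB k c)).

Definition lin_pou (i : 'I_n) (g : channel -> R) : R :=
  2^-1 * (lin_chi i g + - (scale3 * window_mass)^-1 * g (chE i true) + (scale3 * window_mass)^-1 * g (chE i false)).

Definition weights1 (j : channel) (g : channel -> R) : R :=
  if j is inr (inl (i, c)) then 8^-1 * g (chA c) else 0.

Definition bias1 (j : channel) : X -> R :=
  if j is inr (inl (i, c)) then fun x => 2 - 8^-1 * t i c x else cst 2.

(** The 8 undoes the factor 1/8 of the first layer. *)
Definition kernel2 (j : channel) (g : channel -> R) : R :=
  if j is inr (inr (inl i)) then - (8 * scale2) * \sum_c g (chB i c) else 0.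

(** Kernel outputs carry the factor [p], so the constant [3 * r i] must carry it too for the
    argument to be 2 plus a multiple of [p * (3 r_i - D_i)]. *)
Definition bias2 (j : channel) : X -> R :=
  if j is inr (inr (inl i)) then fun x => 2 + scale2 * (3 * r i) * p x else cst 2.

Definition kernel3 (j : channel) (g : channel -> R) : R :=
  if j is inr (inr (inr (inl (i, b)))) then
    - scale3 * \sum_(k < n | (k < i)%N || b && (k == i)) lin_chi k g
  else 0.

(** The 3 / 2 restore the constants that [lin_chi] leaves out. *)
Definition bias3 (j : channel) : X -> R :=
  if j is inr (inr (inr (inl (i, b)))) then
    fun x => 2 + scale3 * (1 - \sum_(k < n | (k < i)%N || b && (k == i)) (3 / 2)) * p x
  else cst 2.

Definition kernel4 (j : channel) (g : channel -> R) : R :=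
  if j is inr (inr (inr (inr (i, m, e)))) then (-1) ^+ e.1 * scale4 * lin_pou i g else 0.

Definition bias4 (j : channel) : X -> R :=
  if j is inr (inr (inr (inr (i, m, e)))) then
    fun x => 5 + (-1) ^+ e.1 * scale4 * (3 / 4) * p x + (-1) ^+ e.2 * scale4w * w i m x
  else cst 2.

(** The signs follow [act_mul], [true] standing for a minus inside the argument; the prefactor
    removes its 8 and both scales. *)
Definition readout (m : 'I_du) (g : channel -> R) : R := (8 * scale4 * scale4w)^-1 *
  \sum_i (g (chF i m (true, false)) + g (chF i m (false, true)) +
          - 1 * g (chF i m (false, false)) + - 1 * g (chF i m (true, true))).

Lemma linform_lin_chi k : linform (lin_chi k).
Proof.
apply: linformZ; apply: linformD; apply: linformZ; first exact: linform_proj.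
by apply: linform_sum => c; exact: linform_proj.
Qed.

Lemma linform_lin_pou k : linform (lin_pou k).
Proof.
apply: linformZ; apply: linformD; last by apply: linformZ; exact: linform_proj.
by apply: linformD; [exact: linform_lin_chi|apply: linformZ; exact: linform_proj].
Qed.

Lemma linform_weights1 j : linform (weights1 j).
Proof.
by case: j => [c|[[i c]|j]]; [exact: linform0|apply: linformZ; exact: linform_proj|exact: linform0].
Qed.

Lemma linform_kernel2 j : linform (kernel2 j).
Proof.
case: j => [c|[[i c]|[i|j]]]; try exact: linform0.
by apply: linformZ; apply: linform_sum => c; exact: linform_proj.
Qed.

Lemma linform_kernel3 j : linform (kernel3 j).
Proof.
case: j => [c|[[i c]|[i|[[i b]|j]]]]; try exact: linform0.
by apply: linformZ; apply: linform_sum => k; exact: linform_lin_chi.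
Qed.

Lemma linform_kernel4 j : linform (kernel4 j).
Proof.
case: j => [c|[[i c]|[i|[[i b]|[[i m] e]]]]]; try exact: linform0.
by apply: linformZ; exact: linform_lin_pou.
Qed.

Lemma linform_readout m : linform (readout m).
Proof.
apply: linformZ; apply: linform_sum => i.
by do ! apply: linformD; try apply: linformZ; exact: linform_proj.
Qed.

Let cp : continuous p := @continuous_window R d _.

Lemma continuous_affine (c e : R) (f : X -> R) : continuous f -> continuous (fun x => c + e * f x).
Proof. by move=> cf x; exact: (cvgD (cvg_cst c) (cvgM (cvg_cst e) (cf x))). Qed.

Lemma continuous_bias1 j : continuous (bias1 j).
Proof.
case: j => [c|[[i c]|j]]; try exact: cst_continuous.
rewrite (_ : bias1 _ = fun x => 2 + - 8^-1 * t i c x).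
  by apply: continuous_affine; case: (tt i c).
by apply/funext => x; rewrite /bias1 mulNr.
Qed.

Lemma continuous_bias2 j : continuous (bias2 j).
Proof.
by case: j => [c|[[i c]|[i|j]]]; try exact: cst_continuous; exact: continuous_affine.
Qed.

Lemma continuous_bias3 j : continuous (bias3 j).
Proof.
by case: j => [c|[[i c]|[i|[[i b]|j]]]]; try exact: cst_continuous; exact: continuous_affine.
Qed.

Lemma continuous_bias4 j : continuous (bias4 j).
Proof.
case: j => [c|[[i c]|[i|[[i b]|[[i m] e]]]]]; try exact: cst_continuous.
move=> x; have c1 := @continuous_affine 5 ((-1) ^+ e.1 * scale4 * (3 / 4)) p cp x.
exact: (cvgD c1 (cvgM (cvg_cst _) (@cw i m x))).
Qed.

Variable a : X -> 'cV[R]_da.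
Hypothesis ma : forall j, measurable_fun setT (fun x => a x j ord0).

Definition input_of (j : channel) : option ('I_da * bool) := if j is inl c then Some c else None.

Definition state0 (j : channel) (x : X) : R := if input_of j is Some c then feature a c x else 0.
Definition state1 := layer_map ac bc weights1 (fun _ _ => 0) bias1 state0.
Definition state2 := layer_map ac bc (fun _ _ => 0) kernel2 bias2 state1.
Definition state3 := layer_map ac bc (fun _ _ => 0) kernel3 bias3 state2.
Definition state4 := layer_map ac bc (fun _ _ => 0) kernel4 bias4 state3.

Let idle (v z : R) : v + act (0 + 2 + z * 0) = v.
Proof. by rewrite mulr0 addr0 add0r act2 addr0. Qed.

Lemma bounded_state0 j : bounded_mfun (state0 j).
Proof.
rewrite /state0; case: (input_of j) => [c|]; last exact: bounded_mfun_cst.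
by split; [exact: measurable_feature|exists 4 => x _; exact: feature_bound].
Qed.

Lemma bounded_state1 j : bounded_mfun (state1 j).
Proof. by apply: bounded_layer_map; [exact: linform_weights1|exact: continuous_bias1|exact: bounded_state0]. Qed.

Lemma bounded_state2 j : bounded_mfun (state2 j).
Proof. by apply: bounded_layer_map; [move=> ?; exact: linform0|exact: continuous_bias2|exact: bounded_state1]. Qed.

Lemma bounded_state3 j : bounded_mfun (state3 j).
Proof. by apply: bounded_layer_map; [move=> ?; exact: linform0|exact: continuous_bias3|exact: bounded_state2]. Qed.

Lemma bounded_state4 j : bounded_mfun (state4 j).
Proof. by apply: bounded_layer_map; [move=> ?; exact: linform0|exact: continuous_bias4|exact: bounded_state3]. Qed.

Let tB i c (x : X) : `|t i c x| <= 4. Proof. by case: (tt i c). Qed.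

Let mt i c : measurable_fun setT (t i c).
Proof. by case: (tt i c) => ct _; exact: continuous_measurable_rV. Qed.

Let bD i c : bounded_mfun (fun x => `|feature a c x - t i c x|).
Proof.
apply/bounded_mfun_norm/bounded_mfunB.
  by split; [exact: measurable_feature|exists 4 => x _; exact: feature_bound].
by split => //; exists 4 => x _.
Qed.

Lemma state1_B i c x : state1 (chB i c) x = 8^-1 * `|feature a c x - t i c x|.
Proof.
rewrite /state1 /layer_map /= /state0 /= mulr0 addr0 add0r.
rewrite (_ : _ + _ = 2 + 8^-1 * (feature a c x - t i c x)); last by ring.
rewrite act_abs normrM (ger0_norm (_ : 0 <= 8^-1)) ?invr_ge0//.
rewrite mulrC ler_pdivrMr// mul1r (le_trans (ler_normB _ _))//.
by have := feature_bound a c x; have := tB i c x; lra.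
Qed.

Lemma state2_B i c : state2 (chB i c) = state1 (chB i c).
Proof. by apply/funext => x; rewrite /state2 /layer_map /= idle. Qed.

(** A channel is still 0 when its own layer writes it, so the residual term adds nothing to the
    computed value. *)
Lemma state1_C i x : state1 (chC i) x = 0.
Proof. by rewrite /state1 /layer_map /= idle. Qed.

Local Notation D := (fun i => target_dist (t i) a).

Lemma wint_state1_B i c : 8 * wint (state1 (chB i c)) = wint (fun x => `|feature a c x - t i c x|).
Proof.
rewrite (@eq_wint _ _ _ (fun x => 8^-1 * `|feature a c x - t i c x|)); last by move=> x _; exact: state1_B.
by rewrite wintZ// mulrA divff// mul1r.
Qed.

Lemma sum_wint_state1_B i : 8 * \sum_c wint (state1 (chB i c)) = D i.
Proof. by rewrite mulr_sumr; apply: eq_bigr => c _; exact: wint_state1_B. Qed.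

Lemma target_dist_bounds i : 0 <= D i <= \sum_(c : 'I_da * bool) 8 * wint (cst 1 : X -> R).
Proof.
apply/andP; split; first by apply: sumr_ge0 => c _; exact: wint_ge0.
apply: ler_sum => c _; rewrite -wintZ; last exact: bounded_mfun_cst.
apply: le_wint => //; first by apply: bounded_mfunZ; exact: bounded_mfun_cst.
move=> x _; rewrite /= mulr1 (le_trans (ler_normB _ _))//.
by have := feature_bound a c x; have := tB i c x; lra.
Qed.

Let slack i : R := 3 * r i - D i.

Lemma slack_bound i : `|slack i| <= slack_sup.
Proof.
have /andP[D0 D1] := target_dist_bounds i.
have r1 : 3 * r i <= \sum_i 3 * r i.
  by rewrite (bigD1 i)//= lerDl; apply: sumr_ge0 => k _; rewrite mulr_ge0// ltW.
have := r0 i; rewrite /slack /slack_sup ler_norml => ?; apply/andP; split; lra.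
Qed.

Let slack_sup_ge1 : 1 <= slack_sup.
Proof.
rewrite /slack_sup -addrA lerDl addr_ge0//; apply: sumr_ge0 => i _; rewrite mulr_ge0//.
  exact: ltW.
by apply: wint_ge0 => //; exact: bounded_mfun_cst.
Qed.

Let scale2_gt0 : 0 < scale2.
Proof. by rewrite invr_gt0 mulr_gt0//; [exact: lt_le_trans Bp1|exact: lt_le_trans slack_sup_ge1]. Qed.

Lemma scaled_abs (c e z : R) (x : X) : cube x -> 0 < c -> `|z| <= c -> e = (Bp * c)^-1 ->
  act (2 + e * (p x * z)) = e * (`|p x| * `|z|).
Proof.
move=> cx c0 zc ->; have B0 : 0 < Bp by exact: lt_le_trans Bp1.
have e0 : 0 <= (Bp * c)^-1 by rewrite invr_ge0 mulr_ge0// ltW.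
rewrite act_abs !normrM (ger0_norm e0)// mulrC ler_pdivrMr ?mulr_gt0// mul1r.
by apply: ler_pM => //; exact: pB.
Qed.

Lemma state2_C i x : cube x -> state2 (chC i) x = scale2 * (`|p x| * `|slack i|).
Proof.
move=> cx; rewrite /state2 /layer_map /= state1_C !add0r.
rewrite (_ : _ + _ + _ = 2 + scale2 * (p x * slack i)).
  exact: (scaled_abs cx (lt_le_trans ltr01 slack_sup_ge1) (slack_bound i) erefl).
by rewrite /slack -sum_wint_state1_B; ring.
Qed.

Lemma state3_B i c : state3 (chB i c) = state2 (chB i c).
Proof. by apply/funext => x; rewrite /state3 /layer_map /= idle. Qed.

Lemma state3_C i : state3 (chC i) = state2 (chC i).
Proof. by apply/funext => x; rewrite /state3 /layer_map /= idle. Qed.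

Lemma state2_E i b x : state2 (chE i b) x = 0.
Proof. by rewrite /state2 /layer_map /= /state1 /layer_map /= !idle. Qed.

Lemma state3_F i m e x : state3 (chF i m e) x = 0.
Proof. by rewrite /state3 /layer_map /= /state2 /layer_map /= /state1 /layer_map /= !idle. Qed.

Let window_mass_gt0 : 0 < window_mass.
Proof. by apply: wint_window_gt0; exact: shen_phi0_neq0. Qed.

Let bp : bounded_mfun (fun x : X => `|p x|).
Proof. exact/bounded_mfun_norm/bounded_mfun_window. Qed.

Lemma wint_state2_C i : wint (state2 (chC i)) = scale2 * window_mass * `|slack i|.
Proof.
rewrite (@eq_wint _ _ _ (fun x => scale2 * `|slack i| * `|p x|)).
  by rewrite wintZ// -/window_mass; ring.
by move=> x cx; rewrite state2_C//; ring.
Qed.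

Lemma lin_chiE i : lin_chi i (fun k => wint (state2 k)) = chi r D i - 3 / 2.
Proof.
rewrite /lin_chi wint_state2_C mulKf; last by rewrite gt_eqF// mulr_gt0.
under eq_bigr do rewrite state2_B.
rewrite mulNr sum_wint_state1_B /chi -/(slack i).
have ri : r i != 0 by rewrite gt_eqF.
by rewrite /slack; field.
Qed.

Lemma state3_E i b x : cube x -> state3 (chE i b) x = scale3 * (`|p x| * `|1 - chi_sum r D i b|).
Proof.
move=> cx; rewrite /state3 /layer_map /= state2_E !add0r (eq_bigr _ (fun k _ => lin_chiE k)) sumrB.
rewrite -/(chi_sum r D i b).
rewrite (_ : _ + _ + _ = 2 + scale3 * (p x * (1 - chi_sum r D i b))); last by ring.
have n0 : 0 <= n%:R :> R by [].
apply: (scaled_abs cx _ _ erefl); first by rewrite ltr_pwDl// mulr_ge0.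
have /andP[s0 s1] := chi_sum_bounds r0 (fun i => proj1 (andP (target_dist_bounds i))) i b.
by rewrite ler_norml; apply/andP; split; lra.
Qed.

Lemma wint_state3_E i b : wint (state3 (chE i b)) = scale3 * window_mass * `|1 - chi_sum r D i b|.
Proof.
rewrite (@eq_wint _ _ _ (fun x => scale3 * `|1 - chi_sum r D i b| * `|p x|)).
  by rewrite wintZ// -/window_mass; ring.
by move=> x cx; rewrite state3_E//; ring.
Qed.

Let scale3_gt0 : 0 < scale3.
Proof.
have B0 : 0 < Bp by exact: lt_le_trans Bp1.
have n0 : 0 < 1 + 3 * n%:R :> R by rewrite ltr_pwDl// mulr_ge0.
by rewrite invr_gt0 mulr_gt0.
Qed.

Lemma lin_pouE i : lin_pou i (fun k => wint (state3 k)) = pou r D i - 3 / 4.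
Proof.
(* The third layer leaves unchanged the channels that [lin_chi] reads, so they can be read again one
   layer later. *)
have lc : lin_chi i (fun k => wint (state3 k)) = chi r D i - 3 / 2.
  by rewrite -lin_chiE /lin_chi state3_C; under eq_bigr do rewrite state3_B.
have lk : scale3 * window_mass != 0 by rewrite gt_eqF// mulr_gt0.
rewrite /lin_pou lc !wint_state3_E mulNr !mulKf// /pou.
by field.
Qed.

Lemma state4_F i m e x : state4 (chF i m e) x =
  act (5 + (-1) ^+ e.1 * (scale4 * (p x * pou r D i)) + (-1) ^+ e.2 * (scale4w * w i m x)).
Proof.
rewrite /state4 /layer_map /= state3_F !add0r lin_pouE; congr act.
by ring.
Qed.

Lemma readout_state4 m x : cube x -> readout m (state4^~ x) = \sum_i pou r D i * (p x * w i m x).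
Proof.
move=> cx; rewrite /readout mulr_sumr; apply: eq_bigr => i _.
have B0 : 0 < Bp by exact: lt_le_trans Bp1.
have Bw0 : 0 < Bw by exact: lt_le_trans Bw1.
have /andP[p0 p1] := pou_bounds r0 (fun i => proj1 (andP (target_dist_bounds i))) i.
(* [act_mul] wants both factors at most 1/2, whence the 2 in [scale4] and [scale4w]. *)
have hx : `|scale4 * (p x * pou r D i)| <= 2^-1.
  have l4p : 0 <= scale4 by rewrite invr_ge0 mulr_ge0// ltW.
  rewrite normrM (ger0_norm l4p) normrM (ger0_norm p0) /scale4 invfM -mulrA ler_piMr// ler_pdivrMl// mulr1.
  by rewrite (le_trans _ (pB cx))// ler_piMr.
have hy : `|scale4w * w i m x| <= 2^-1.
  have lwp : 0 <= scale4w by rewrite invr_ge0 mulr_ge0// ltW.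
  rewrite normrM (ger0_norm lwp) /scale4w.
  by rewrite invfM -mulrA ler_piMr// ler_pdivrMl// mulr1.
have := act_mul hx hy; rewrite !state4_F /= !expr0 !expr1 !mul1r !mulN1r.
rewrite (addrAC (act _)) => ->.
have l40 : scale4 != 0 by rewrite gt_eqF// invr_gt0 mulr_gt0.
have lw0 : scale4w != 0 by rewrite gt_eqF// invr_gt0 mulr_gt0.
by field; rewrite l40 lw0.
Qed.

End synthesis.

(** * The approximation theorem *)

Section assembly.
Context {R : realType} (ac bc : nat -> R) (d da du : nat).
Notation X := 'rV[R]_d.
Notation mu := (@leb_cube R d).
Local Notation p := (@window R d (shen_phi ac bc 0)).

Lemma cheb_integrable_signal (J : finType) (f : J -> X -> R) :
  (forall j, bounded_mfun (f j)) -> cheb_integrable (signal f).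
Proof.
move=> bf r; have := wint_integrable (bf (chan r)).
by apply: eq_integrable => // x _; rewrite /= mxE.
Qed.

(** Measurability of the input is enough, because the kernels only ever see the bounded states. *)
Lemma synthesis (n : nat) (t : 'I_n -> 'I_da * bool -> X -> R) (r : 'I_n -> R)
    (w : 'I_n -> 'I_du -> X -> R) :
  (forall i c, target (t i c)) -> (forall i, 0 < r i) ->
  (forall i m, multiplier p (w i m)) ->
  exists L : @opno R d da du, forall a : X -> 'cV[R]_da,
    (forall j, measurable_fun setT (fun x => a x j ord0)) ->
    op_defined ac bc L a /\ forall x m, cube x -> op_eval ac bc L a x m ord0 =
      \sum_i pou r (fun i => target_dist (t i) a) i * (p x * w i m x).
Proof.
move=> tt r0 mw; have [Bp Bp1 pB] := @window_bound R d (shen_phi ac bc 0).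
have cw i m : continuous (w i m) by case: (mw i m).
have [Bw Bw1 wB] : exists2 B, 1 <= B & forall i m x, `|w i m x| <= B.
  have /choice[B hB] : forall im : 'I_n * 'I_du, exists B, forall x, `|w im.1 im.2 x| <= B.
    by move=> [i m]; case: (mw i m).
  exists (1 + \sum_im `|B im|) => [|i m x]; first by rewrite lerDl sumr_ge0.
  rewrite (le_trans (hB (i, m) x))// (bigD1 (i, m))//= addrCA.
  by rewrite (le_trans (ler_norm _))// lerDl addr_ge0// sumr_ge0.
pose J := channel da du n.
have lin0 (j : J) : linform (fun _ : J -> R => 0 : R) by exact: linform0.
have [l1 h1] := @layer_exists R ac bc d J (@weights1 R da du n) (fun _ _ => 0) (bias1 t)
  (@linform_weights1 R da du n) lin0 (fun j => @continuous_bias1 R d da du n t tt j).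
have [l2 h2] := @layer_exists R ac bc d J (fun _ _ => 0) (kernel2 d r Bp) (bias2 ac bc r Bp)
  lin0 (linform_kernel2 d r Bp) (fun j => @continuous_bias2 R ac bc d da du n r Bp j).
have [l3 h3] := @layer_exists R ac bc d J (fun _ _ => 0) (kernel3 ac bc d r Bp) (bias3 ac bc Bp)
  lin0 (linform_kernel3 ac bc d r Bp) (fun j => @continuous_bias3 R ac bc d da du n Bp j).
have [l4 h4] := @layer_exists R ac bc d J (fun _ _ => 0) (kernel4 ac bc d r Bp) (bias4 ac bc w Bp Bw)
  lin0 (linform_kernel4 ac bc d r Bp) (fun j => @continuous_bias4 R ac bc d da du n w cw Bp Bw j).
have [N hN] := @lift_exists R ac bc d J da (@input_of da du n).
have [Q hQ] := @readout_exists R d J du _ (@linform_readout R da du n Bp Bw).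
pose L := (@Opno R d da du act continuous_act act_nonpoly #|J| 0 N
  (@mode0_kernel R d da 0 0) [:: l1; l2; l3; l4] Q None).
exists L => a ma.
pose F0 : J -> X -> R := state0 a.
pose F1 : J -> X -> R := state1 ac bc t a.
pose F2 : J -> X -> R := state2 ac bc t r Bp a.
pose F3 : J -> X -> R := state3 ac bc t r Bp a.
pose F4 : J -> X -> R := state4 ac bc t r w Bp Bw a.
have lift0 : op_lifting ac bc L a = signal F0 by apply/funext => x; exact: hN.
have e1 : layer_apply ac bc act l1 (signal F0) = signal F1 by exact: h1.
have e2 : layer_apply ac bc act l2 (signal F1) = signal F2 by exact: h2.
have e3 : layer_apply ac bc act l3 (signal F2) = signal F3 by exact: h3.
have e4 : layer_apply ac bc act l4 (signal F3) = signal F4 by exact: h4.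
have hid : op_hidden ac bc L a = signal F4.
  by rewrite /op_hidden /= lift0 e1 e2 e3 e4.
have evalE x m : op_eval ac bc L a x m ord0 = readout Bp Bw m (F4^~ x).
  by rewrite /op_eval /= /op_pointwise /= hid; exact: hQ.
split; last first.
  by move=> x m cx; rewrite evalE; exact: readout_state4.
split.
(* The lifting kernel has no output channels, so its matrices vanish and nothing is asked of the raw
   input. *)
- by move=> [i [j]] /eqP []; rewrite [ker_mx _ _ _]flatmx0.
- rewrite lift0 /= e1 e2 e3.
  split; first by move=> _; apply: cheb_integrable_signal; exact: bounded_state0.
  split; first by move=> _; apply: cheb_integrable_signal; exact: bounded_state1.
  split; first by move=> _; apply: cheb_integrable_signal; exact: bounded_state2.
  by split => // _; apply: cheb_integrable_signal; exact: bounded_state3.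
- by [].
- move=> m; under eq_fun do rewrite evalE.
  have [c hc] := linform_readout da n Bp Bw m.
  apply: bounded_mfun_Lfun; under eq_fun do rewrite hc.
  apply: bounded_mfun_sum => k; apply: bounded_mfunZ; exact: bounded_state4.
Qed.

Definition L2vec n (f : X -> 'cV[R]_n) := forall j, (fun x => f x j ord0) \in Lfun mu 2%:E.

Lemma L2vecB n (f g : X -> 'cV[R]_n) : L2vec f -> L2vec g -> L2vec (fun x => f x - g x).
Proof.
move=> hf hg j; rewrite (_ : (fun x => _) = fun x => f x j ord0 - g x j ord0).
  exact: Lfun2B.
by apply/funext => x; rewrite mxE [X in _ + X]mxE.
Qed.

Lemma L2norm_le n (f : X -> 'cV[R]_n) (e : R) : 0 <= e ->
  (forall j, norm2 mu (fun x => f x j ord0) <= e) -> L2norm f <= n%:R * e.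
Proof.
move=> e0 fe; apply: (@le_trans _ _ (Num.sqrt ((n%:R * e) ^+ 2))); last first.
  by rewrite sqrtr_sqr ger0_norm ?mulr_ge0.
rewrite ler_wsqrtr//; apply: (@le_trans _ _ (\sum_(j < n) e ^+ 2)).
  by apply: ler_sum => j _; rewrite lerXn2r ?nnegrE ?norm2_ge0.
rewrite sumr_const card_ord -[leLHS]mulr_natl exprMn ler_wpM2r ?sqr_ge0//.
case: n f fe => [|k] _ _; first by rewrite expr0n.
by rewrite expr2 ler_peMr ?ler1n.
Qed.

Lemma L2normD n (f g : X -> 'cV[R]_n) : L2vec f -> L2vec g ->
  L2norm (fun x => f x + g x) <= L2norm f + L2norm g.
Proof.
move=> hf hg; apply: l2_triangle => j _; rewrite norm2_ge0/=.
rewrite (_ : (fun x => _) = (fun x => f x j ord0) \+ (fun x => g x j ord0)); first exact: norm2D.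
by apply/funext => x; rewrite mxE.
Qed.

Lemma L2normZ n c (f : X -> 'cV[R]_n) : 0 <= c -> L2vec f ->
  L2norm (fun x => c *: f x) = c * L2norm f.
Proof.
move=> c0 hf; rewrite /L2norm -{2}(ger0_norm c0) -sqrtr_sqr -sqrtrM ?sqr_ge0// mulr_sumr.
congr Num.sqrt; apply: eq_bigr => j _; rewrite -exprMn -{2}(ger0_norm c0) -norm2Z//.
by congr (norm2 _ _ ^+ 2); apply/funext => x; rewrite mxE.
Qed.

Lemma L2norm_ae n (f g : X -> 'cV[R]_n) :
  (forall j, measurable_fun setT (fun x => f x j ord0)) ->
  (forall j, measurable_fun setT (fun x => g x j ord0)) ->
  {ae mu, forall x, f x = g x} -> L2norm f = L2norm g.
Proof.
move=> mf mg fg; rewrite /L2norm; congr Num.sqrt; apply: eq_bigr => j _.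
congr (_ ^+ 2); apply: norm2_ae_eq => //.
by apply: filterS fg => x ->.
Qed.

Lemma L2vec_sum n (I : Type) (s : seq I) (c : I -> R) (F : I -> X -> 'cV[R]_n) :
  (forall i, L2vec (F i)) -> L2vec (fun x => \sum_(i <- s) c i *: F i x).
Proof.
move=> hF j; elim: s => [|i s IH].
  under eq_fun do rewrite big_nil mxE.
  by apply: bounded_mfun_Lfun; exact: (@bounded_mfun_cst R d 0).
under eq_fun do rewrite big_cons mxE mxE.
by apply: Lfun2D => //; apply: Lfun2Z; exact: hF.
Qed.

Lemma L2norm_sum n (I : Type) (s : seq I) (c : I -> R) (F : I -> X -> 'cV[R]_n) :
  (forall i, 0 <= c i) -> (forall i, L2vec (F i)) ->
  L2norm (fun x => \sum_(i <- s) c i *: F i x) <= \sum_(i <- s) c i * L2norm (F i).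
Proof.
move=> c0 hF; elim: s => [|i s IH].
  rewrite big_nil /L2norm big1 ?sqrtr0// => j _.
  under eq_fun do rewrite big_nil mxE.
  by rewrite (norm2_0 mu) expr0n.
rewrite big_cons; under eq_fun do rewrite big_cons.
apply: le_trans (L2normD _ (L2vec_sum s c hF)) _.
  by move=> j; under eq_fun do rewrite mxE; apply: Lfun2Z; exact: hF.
by rewrite L2normZ// lerD2l.
Qed.

End assembly.

Theorem theorem3p2 (R : realType) (am bm ap bp : R) (ac bc : nat -> R)
    (d da du : nat) (s : R) (G : Hs d da s -> @L2 R d du) (K : set (Hs d da s)) :
  compact_combination am bm ap bp ac bc ->
  (0 < d)%N -> (0 < da)%N -> (0 < du)%N -> 0 <= s ->
  continuous G -> compact K ->
  forall eps : R, 0 < eps ->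
  exists L : @opno R d da du,
    (forall a : Hs d da s, op_defined ac bc L (Hs_fun a)) /\
    (forall a : Hs d da s, K a ->
       L2norm (op_eval ac bc L (Hs_fun a) \- L2_fun (G a)) < eps).
Proof.
move=> _ _ _ _ _ cG cK eps eps0.
pose p := @window R d (shen_phi ac bc 0).
have eps2 : 0 < eps / 2 by rewrite divr_gt0.
have [n [t [r [u [tt r0 near cover]]]]] := finite_net cG cK eps2.
(* Chosen so that du components with error eta cost at most eps / 4. *)
pose eta := eps / 4 / (du%:R + 1).
have eta0 : 0 < eta by rewrite !divr_gt0// ltr_wpDl.
have uL (v : @L2 R d du) : L2vec (L2_fun v).
  move=> m; rewrite (_ : (fun x => _) = (v : 'I_du -> L2fun d) m); first exact: LfunP.
  by apply/funext => x; rewrite mxE.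
have /choice[w hw] : forall im : 'I_n * 'I_du, exists w, multiplier p w /\
    norm2 (@leb_cube R d) (fun x => L2_fun (u im.1) x im.2 ord0 - p x * w x) < eta.
  move=> [i m]; have [w mw h] := @dense_L2 R d p (@continuous_window R d _)
    (window_neq0 d (shen_phi0_neq0 ac bc)) _ _ (uL (u i) m) eta0.
  by exists w.
pose W i m := w (i, m).
have mW i m : multiplier p (W i m) by case: (hw (i, m)).
have [L hL] := synthesis tt r0 mW.
exists L; split => [a|a Ka]; first by have [] := hL _ (@measurable_Hs_fun R d da s a).
have [[_ _ _ evalL] evalE] := hL _ (@measurable_Hs_fun R d da s a).
pose D i := target_dist (t i) (Hs_fun a).
have D0 i : 0 <= D i.
  apply: sumr_ge0 => c _; apply: Rintegral_ge0 => x _.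
  by rewrite mulr_ge0// cheb_weight_ge0.
pose V i (x : 'rV[R]_d) : 'cV[R]_du := \col_m (p x * W i m x).
have VL i : L2vec (V i).
  move=> m; rewrite (_ : (fun x => _) = fun x => p x * W i m x).
    have [cw _ [B hB]] := mW i m; apply: bounded_mfun_Lfun; split.
      exact: (measurable_pb (@continuous_window R d _) (mW i m)).
    by exists B => x _; exact: hB.
  by apply/funext => x; rewrite mxE.
pose F i x := V i x - L2_fun (G a) x.
have FL i : L2vec (F i) by exact: L2vecB (VL i) (uL (G a)).
have pou0 i : 0 <= pou r D i by have /andP[] := pou_bounds r0 D0 i.
have pou1 : \sum_i pou r D i = 1.
  by apply: pou_sum => //; have [i hi] := cover _ Ka; exists i; exact: ltW.
(* Either the weight is 0, or [a] is in the i-th ball and the error is eps / 4 from approximating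
   the value at the centre plus eps / 2 from the net. *)
have errF i : pou r D i * L2norm (F i) <= pou r D i * (3 / 4 * eps).
  have [Di|Di] := leP (3 * r i) (D i); first by rewrite pou_eq0// !mul0r.
  apply: ler_wpM2l => //.
  have uV := L2vecB (VL i) (uL (u i)).
  have uG := L2vecB (uL (u i)) (uL (G a)).
  rewrite (_ : F i = fun x => (V i x - L2_fun (u i) x) + (L2_fun (u i) x - L2_fun (G a) x)); last first.
    by apply/funext => x; rewrite subrKA.
  apply: le_trans (L2normD uV uG) _.
  have := near i a Ka Di; rewrite /L2dist => h.
  have {}h : L2norm (fun x => L2_fun (u i) x - L2_fun (G a) x) < eps / 2 by exact: h.
  suff : L2norm (fun x => V i x - L2_fun (u i) x) <= eps / 4 by lra.
  apply: (@le_trans _ _ (du%:R * eta)); last first.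
    by rewrite mulrC /eta mulrAC ler_pdivrMr ?ltr_wpDl// ler_pM2l ?divr_gt0// lerDl.
  apply: L2norm_le => [|m]; first exact: ltW.
  rewrite -norm2N; case: (hw (i, m)) => _ /ltW; apply: le_trans.
  rewrite le_eqVlt; apply/orP; left; apply/eqP; congr norm2; apply/funext => x.
  by rewrite /= !mxE opprB.
(* The weights sum to 1, so G(a) is itself a convex combination of copies of G(a). Equality holds
   almost everywhere only: the output of the network is known on the cube. *)
have -> : L2norm (op_eval ac bc L (Hs_fun a) \- L2_fun (G a)) =
    L2norm (fun x => \sum_i pou r D i *: F i x).
  apply: L2norm_ae.
  - move=> m; rewrite (_ : (fun x => _) =
        fun x => op_eval ac bc L (Hs_fun a) x m ord0 - L2_fun (G a) x m ord0).
      by apply: Lfun_measurable; apply: Lfun2B; [exact: evalL|exact: uL].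
    by apply/funext => x; rewrite [LHS]mxE [X in _ + X]mxE.
  - by move=> m; apply: Lfun_measurable; exact: L2vec_sum.
  - apply: filterS (@ae_cube R d) => x cx; apply/colP => m.
    rewrite [LHS]mxE evalE// [X in _ + X]mxE summxE.
    rewrite -[X in _ - X]mul1r -pou1 mulr_suml -sumrB; apply: eq_bigr => i _.
    rewrite [RHS]mxE [X in _ = _ * X]mxE [X in _ = _ * (X + _)]mxE [X in _ = _ * (_ + X)]mxE.
    by rewrite mulrBr.
apply: le_lt_trans (L2norm_sum _ pou0 FL) _.
apply: (@le_lt_trans _ _ (\sum_i pou r D i * (3 / 4 * eps))); first exact: ler_sum.
by rewrite -mulr_suml pou1 mul1r; lra.
Qed.
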